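(* Let $A$ be an artin algebra and $$A=H_{0}>H_{1}> \cdots > H_i > \cdots >H_{n}=0 \qquad ( * )$$ a chain of idempotent ideals of $A$. For $0 \leq i \leq n-1$, write $H_i = Ae_iA$, where $e_i$ is an idempotent of $A$, and let $e_n=0$. Then the following conditions are equivalent: (i) The chain $( * )$ is a right-strongly (resp. left-strongly) heredity chain. (ii) The chain $$\mathrm{proj}\, A=\mathrm{add}\, e_0 A \supset \mathrm{add}\, e_1 A \supset \cdots \supset \mathrm{add}\, e_n A =0$$ is a total right (resp. left) rejective chain of $\mathrm{proj}\, A$. In particular, an artin algebra $A$ is strongly (resp. right-strongly, left-strongly) quasi-hereditary if and only if $\mathrm{proj}\, A$ has a rejective (resp. total right rejective, total left rejective) chain.
   Context: All modules are finitely generated. $J(A)$ is the Jacobson radical of $A$; $\mathrm{proj}\,A$ is the category of finitely generated projective right $A$-modules; $\mathrm{add}\,M$ is the full subcategory of direct summands of finite direct sums of copies of $M$. All subcategories are assumed full and closed under isomorphisms, direct sums and direct summands. Heredity chains: a two-sided ideal $H$ of $A$ is heredity if (a) $H^2=H$; (b) $H$ is projective as a right $A$-module; (c) $HJ(A)H=0$. A chain of idempotent ideals $A=H_0>H_1>\cdots>H_n=0$ is a heredity chain if $H_i/H_{i+1}$ is a heredity ideal of $A/H_{i+1}$ for $0\le i\le n-1$. It is a right-strongly (resp. left-strongly) heredity chain if for every $0\le i\le n-1$: (a) $H_i$ is projective as a right (resp. left) $A$-module; (b) $(H_i/H_{i+1})\,J(A/H_{i+1})\,(H_i/H_{i+1})=0$.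 $A$ is strongly quasi-hereditary if it has a heredity chain which is both a right-strongly and a left-strongly heredity chain. Right-strongly quasi-hereditary: let $\{S(i)\mid i\in I\}$ be a complete set of representatives of isomorphism classes of simple right $A$-modules, and $P(i)$ the projective cover of $S(i)$. Given a partial order $\le$ on $I$, the standard module $\Delta(i)$ is the maximal factor module of $P(i)$ all of whose composition factors have the form $S(j)$ with $j\le i$. $\mathcal F(\Delta)$ is the full subcategory of modules having a finite filtration with successive quotients isomorphic to standard modules, and $(M:\Delta(j))$ is the number of quotients isomorphic to $\Delta(j)$. $(A,\le)$ is right-strongly quasi-hereditary if for every $i\in I$ we have $[\Delta(i):S(i)]=1$ (composition multiplicity), and the kernel $K(i)$ of $P(i)\to\Delta(i)$ satisfies: (a) $K(i)\in\mathcal F(\Delta)$; (b) if $(K(i):\Delta(j))\ne0$ then $i<j$; (c) $K(i)$ is projective. $(A,\le)$ is left-strongly quasi-hereditary if $(A^{\mathrm{op}},\le)$ is right-strongly quasi-hereditary. $A$ is right-strongly (resp. left-strongly) quasi-hereditary if $(A,\le)$ is so for some partial order $\le$ on $I$. Subcategories: let $\mathcal C$ be an additive category and $\mathcal C'$ a subcategory. $\mathcal C'$ is right (resp. left) rejective in $\mathcal C$ if the inclusion functor $\mathcal C'\hookrightarrow\mathcal C$ has a right (resp. left) adjoint whose counit $\varepsilon^-_X$ is a monomorphism in $\mathcal C$ (resp. whose unit $\varepsilon^+_X$ is an epimorphism in $\mathcal C$) for every $X\in\mathcal C$; it is rejective if it is both right and left rejective. Let $[\mathcal C']$ be the ideal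 of $\mathcal C$ of morphisms factoring through an object of $\mathcal C'$; for $\mathcal C$ Krull–Schmidt, $\mathcal C'$ is cosemisimple in $\mathcal C$ if the Jacobson radical of $\mathcal C/[\mathcal C']$ is zero. Chains: a chain of subcategories $\mathcal C=\mathcal C_0\supset\mathcal C_1\supset\cdots\supset\mathcal C_n=0$ is a rejective chain of $\mathcal C$ if $\mathcal C_i$ is a cosemisimple rejective subcategory of $\mathcal C_{i-1}$ for $1\le i\le n$. It is a total right (resp. left) rejective chain of $\mathcal C$ if for $1\le i\le n$, (a) $\mathcal C_i$ is a right (resp. left) rejective subcategory of $\mathcal C$ and (b) $\mathcal C_i$ is a cosemisimple subcategory of $\mathcal C_{i-1}$. *)

(* Defs.v *)
From HB Require Import structures.
From mathcomp Require Import all_boot all_algebra generic_quotient ring_quotient.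
From mathcomp Require Import boolp classical_sets.
Set Implicit Arguments.
Unset Strict Implicit.
Unset Printing Implicit Defensive.
Import GRing.Theory.
Local Open Scope classical_set_scope.
Local Open Scope quotient_scope.
Local Open Scope ring_scope.

(* Module notions are stated for [lmodType R]. A right A-module is an
   [lmodType A^c], and the right regular module A_A is [(A^c)^o]; the right
   modules over the opposite algebra are the [lmodType (A^c)^c], i.e. the left
   A-modules. *)

Record submod (R : pzRingType) (M : lmodType R) := Submod {
  submod_set :> M -> Prop;
  submod0 : submod_set 0;
  submodP : forall (a : R) (u v : M),
    submod_set u -> submod_set v -> submod_set (a *: u + v) }.

Section Submodule.
Variables (R : pzRingType) (M : lmodType R) (N : submod M).

Definition submod_pred : {pred M} := fun x => `[< N x >].

Fact submod_pred_closed : submod_closed submod_pred.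
Proof.
split=> [|a u v /asboolP Nu /asboolP Nv]; apply/asboolP; first exact: submod0.
exact: submodP.
Qed.

HB.instance Definition _ :=
  GRing.isSubmodClosed.Build R M submod_pred submod_pred_closed.

Record submod_type := SubmodType {
  submod_val : M; submod_valP : submod_val \in submod_pred }.

HB.instance Definition _ := [isSub for submod_val].
HB.instance Definition _ := [Choice of submod_type by <:].
HB.instance Definition _ := [SubChoice_isSubLmodule of submod_type by <:].

Definition quotmod := Quotient.quot submod_pred.
HB.instance Definition _ := GRing.Zmodule.on quotmod.

Definition quotmod_pi (x : M) : quotmod := \pi_(Quotient.quot submod_pred) x.

Lemma quotmod_piP x y : quotmod_pi x = quotmod_pi y <-> N (x - y).
Proof.
split=> [/eqP|Nxy]; first by rewrite -Quotient.idealrBE => /asboolP.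
by apply/eqP; rewrite -Quotient.idealrBE; apply/asboolP.
Qed.

Lemma quotmod_piD x y : quotmod_pi (x + y) = quotmod_pi x + quotmod_pi y.
Proof. exact: raddfD. Qed.

Lemma quotmod_reprK (x : quotmod) : quotmod_pi (repr x) = x.
Proof. exact: reprK. Qed.

Definition quotmod_scale (a : R) (x : quotmod) : quotmod :=
  quotmod_pi (a *: repr x).

Lemma quotmod_piZ a x : quotmod_scale a (quotmod_pi x) = quotmod_pi (a *: x).
Proof.
apply/quotmod_piP; rewrite -scalerBr -[_ *: _]addr0.
apply: submodP; last exact: submod0.
by apply/quotmod_piP; rewrite quotmod_reprK.
Qed.

Fact quotmod_scaleA a b v :
  quotmod_scale a (quotmod_scale b v) = quotmod_scale (a * b) v.
Proof. by rewrite -[v]quotmod_reprK !quotmod_piZ scalerA. Qed.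
Fact quotmod_scale1 : left_id 1 quotmod_scale.
Proof. by move=> v; rewrite -[v]quotmod_reprK quotmod_piZ scale1r. Qed.
Fact quotmod_scaleDr : right_distributive quotmod_scale +%R.
Proof.
move=> a u v; rewrite -[u]quotmod_reprK -[v]quotmod_reprK -quotmod_piD.
by rewrite !quotmod_piZ scalerDr quotmod_piD.
Qed.
Fact quotmod_scaleDl v : {morph quotmod_scale^~ v : a b / a + b}.
Proof.
by move=> a b; rewrite -[v]quotmod_reprK !quotmod_piZ scalerDl quotmod_piD.
Qed.

HB.instance Definition _ := GRing.Zmodule_isLmodule.Build R quotmod
  quotmod_scaleA quotmod_scale1 quotmod_scaleDr quotmod_scaleDl.

End Submodule.

Section Subquotient.
Variables (R : pzRingType) (M : lmodType R).

Definition submod_trace (W V : submod M) : submod (submod_type W) :=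
  @Submod R (submod_type W) [set x | V (val x)]
    (submod0 V) (fun a u v => @submodP _ _ V a (val u) (val v)).

(* W/V for V contained in W. *)
Definition subquot (W V : submod M) : lmodType R := quotmod (submod_trace W V).

End Subquotient.

Section ModuleNotions.
Variable R : pzRingType.
Implicit Types M N P : lmodType R.

Definition finitely_generated M :=
  exists s : seq M, forall x : M, exists c : nat -> R,
    x = \sum_(i < size s) c i *: s`_i.

Definition onto (T U : Type) (f : T -> U) := forall y, exists x, f x = y.

Definition projective P :=
  forall (M N : lmodType R) (g : {linear M -> N}) (f : {linear P -> N}),
    onto g -> exists h : {linear P -> M}, forall x, g (h x) = f x.

Definition miso M N := exists f : {linear M -> N}, bijective f.

Definition direct_summand M N := exists M' : lmodType R, miso (M * M')%type N.

(* [add_mod M] is add M, with [{ffun 'I_m -> M}] the direct sum M^m. *)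
Definition add_mod M N := exists m : nat, direct_summand N {ffun 'I_m -> M}.

Definition simple M :=
  (exists x : M, x <> 0) /\
  forall N : submod M, (N : set M) = [set 0] \/ (N : set M) = setT.

Definition projective_cover P M :=
  finitely_generated P /\ projective P /\
  exists p : {linear P -> M}, onto p /\
    forall U : submod P,
      (forall x, exists2 u, U u & p (x - u) = 0) -> forall x, U x.

Definition filtration M (l : nat) (F : nat -> submod M) :=
  [/\ (F 0 : set M) = setT, (F l : set M) = [set 0] &
      forall t, (t < l)%N -> F t.+1 `<=` F t].

Definition layer M (F : nat -> submod M) t := subquot (F t) (F t.+1).

Definition nb_layers M (l : nat) (F : nat -> submod M) N : nat :=
  #|[set t : 'I_l | `[< miso (layer F t) N >]]%SET|.

Definition composition_series M l (F : nat -> submod M) :=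
  filtration l F /\ forall t, (t < l)%N -> simple (layer F t).

Definition composition_factor M N :=
  exists l (F : nat -> submod M), composition_series l F /\
    exists2 t, (t < l)%N & miso (layer F t) N.

(* [M : N] = m; the value is the same for every composition series. *)
Definition composition_mult M N (m : nat) :=
  exists l (F : nat -> submod M), composition_series l F /\ nb_layers l F N = m.

Definition delta_filtration (I : Type) (D : I -> lmodType R) M l
    (F : nat -> submod M) :=
  filtration l F /\ forall t, (t < l)%N -> exists j, miso (layer F t) (D j).

Definition delta_filtered (I : Type) (D : I -> lmodType R) M :=
  exists l (F : nat -> submod M), delta_filtration D l F.

(* (M : D j) = m *)
Definition delta_mult (I : Type) (D : I -> lmodType R) M (j : I) (m : nat) :=
  exists l (F : nat -> submod M),
    delta_filtration D l F /\ nb_layers l F (D j) = m.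

Definition complete_simples (I : Type) (S : I -> lmodType R) :=
  [/\ forall i, simple (S i),
      forall i j, miso (S i) (S j) -> i = j &
      forall M, simple M -> exists i, miso M (S i)].

Definition partial_order (I : Type) (le : I -> I -> Prop) :=
  [/\ forall i, le i i,
      forall i j, le i j -> le j i -> i = j &
      forall i j l, le i j -> le j l -> le i l].

Definition factors_le (I : Type) (S : I -> lmodType R) (le : I -> I -> Prop)
    (i : I) M :=
  forall N, composition_factor M N -> exists2 j, le j i & miso N (S j).

(* K is the kernel of the projection of P onto its largest factor module
   with composition factors S j, j <= i. *)
Definition standard_kernel (I : Type) (S : I -> lmodType R)
    (le : I -> I -> Prop) (i : I) P (K : submod P) :=
  factors_le S le i (quotmod K) /\
  forall V : submod P, factors_le S le i (quotmod V) -> K `<=` V.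

Definition strongly_qh_order (I : Type) (S P : I -> lmodType R)
    (le : I -> I -> Prop) :=
  exists K : forall i, submod (P i),
    (forall i, standard_kernel S le i (K i)) /\
    let Delta i : lmodType R := quotmod (K i) in
    forall i,
      [/\ composition_mult (Delta i) (S i) 1,
          delta_filtered Delta (submod_type (K i)),
          forall j m, delta_mult Delta (submod_type (K i)) j m -> m <> 0%N ->
            le i j /\ i <> j &
          projective (submod_type (K i))].

Definition module_strongly_qh :=
  exists (I : Type) (S P : I -> lmodType R),
    complete_simples S /\ (forall i, projective_cover (P i) (S i)) /\
    exists le : I -> I -> Prop, partial_order le /\ strongly_qh_order S P le.

End ModuleNotions.

Definition right_strongly_qh (A : pzRingType) := module_strongly_qh A^c.
Definition left_strongly_qh (A : pzRingType) := right_strongly_qh A^c.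

Record ideal (A : pzRingType) := Ideal {
  ideal_set :> A -> Prop;
  ideal0 : ideal_set 0;
  idealB : forall x y, ideal_set x -> ideal_set y -> ideal_set (x - y);
  idealMl : forall a x, ideal_set x -> ideal_set (a * x);
  idealMr : forall a x, ideal_set x -> ideal_set (x * a) }.

Section IdealModules.
Variables (A : pzRingType) (H : ideal A).

Lemma idealD x y : H x -> H y -> H (x + y).
Proof.
move=> Hx Hy; rewrite -[y]opprK; apply: idealB => //.
by rewrite -sub0r; apply: idealB => //; apply: ideal0.
Qed.

Definition ideal_right : submod (A^c)^o :=
  @Submod A^c (A^c)^o (H : set A) (ideal0 H)
    (fun a u v Hu Hv => idealD (@idealMr A H a u Hu) Hv).

Definition ideal_left : submod A^o :=
  @Submod A A^o (H : set A) (ideal0 H)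
    (fun a u v Hu Hv => idealD (@idealMl A H a u Hu) Hv).

Definition ideal_pred : {pred A} := fun x => `[< H x >].

Fact ideal_pred_closed : zmod_closed ideal_pred.
Proof.
split=> [|u v /asboolP Hu /asboolP Hv]; apply/asboolP; first exact: ideal0.
exact: idealB.
Qed.

HB.instance Definition _ :=
  GRing.isZmodClosed.Build A ideal_pred ideal_pred_closed.

Definition quotring := Quotient.quot ideal_pred.
HB.instance Definition _ := GRing.Zmodule.on quotring.

Definition quotring_pi (x : A) : quotring := \pi_(Quotient.quot ideal_pred) x.

Lemma quotring_piP x y : quotring_pi x = quotring_pi y <-> H (x - y).
Proof.
split=> [/eqP|Hxy]; first by rewrite -Quotient.idealrBE => /asboolP.
by apply/eqP; rewrite -Quotient.idealrBE; apply/asboolP.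
Qed.

Lemma quotring_piD x y : quotring_pi (x + y) = quotring_pi x + quotring_pi y.
Proof. exact: raddfD. Qed.

Lemma quotring_piB x y : quotring_pi (x - y) = quotring_pi x - quotring_pi y.
Proof. exact: raddfB. Qed.

Lemma quotring_pi0 : quotring_pi 0 = 0.
Proof. exact: raddf0. Qed.

Lemma quotring_reprK (x : quotring) : quotring_pi (repr x) = x.
Proof. exact: reprK. Qed.

Definition quotring_mul (x y : quotring) : quotring :=
  quotring_pi (repr x * repr y).

Lemma quotring_piM x y :
  quotring_mul (quotring_pi x) (quotring_pi y) = quotring_pi (x * y).
Proof.
apply/quotring_piP; set x' := repr _; set y' := repr _.
have Hx : H (x' - x) by apply/quotring_piP; rewrite quotring_reprK.
have Hy : H (y' - y) by apply/quotring_piP; rewrite quotring_reprK.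
have -> : x' * y' - x * y = (x' - x) * y' + x * (y' - y).
  by rewrite mulrBl mulrBr addrA subrK.
by apply: idealD; [apply: idealMr | apply: idealMl].
Qed.

Fact quotring_mulA : associative quotring_mul.
Proof.
move=> x y z.
rewrite -[x]quotring_reprK -[y]quotring_reprK -[z]quotring_reprK.
by rewrite !quotring_piM mulrA.
Qed.
Fact quotring_mul1r : left_id (quotring_pi 1) quotring_mul.
Proof. by move=> x; rewrite -[x]quotring_reprK quotring_piM mul1r. Qed.
Fact quotring_mulr1 : right_id (quotring_pi 1) quotring_mul.
Proof. by move=> x; rewrite -[x]quotring_reprK quotring_piM mulr1. Qed.
Fact quotring_mulDl : left_distributive quotring_mul +%R.
Proof.
move=> x y z.
rewrite -[x]quotring_reprK -[y]quotring_reprK -[z]quotring_reprK.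
by rewrite -quotring_piD !quotring_piM mulrDl quotring_piD.
Qed.
Fact quotring_mulDr : right_distributive quotring_mul +%R.
Proof.
move=> x y z.
rewrite -[x]quotring_reprK -[y]quotring_reprK -[z]quotring_reprK.
by rewrite -quotring_piD !quotring_piM mulrDr quotring_piD.
Qed.

HB.instance Definition _ := GRing.Zmodule_isPzRing.Build quotring
  quotring_mulA quotring_mul1r quotring_mulr1 quotring_mulDl quotring_mulDr.

End IdealModules.

Section IdealQuotient.
Variables (A : pzRingType) (H K : ideal A).

Definition ideal_mod_set : set (quotring K) := quotring_pi K @` H.

Fact ideal_mod0 : ideal_mod_set 0.
Proof. by exists 0; [apply: ideal0 | apply: quotring_pi0]. Qed.
Fact ideal_modB x y :
  ideal_mod_set x -> ideal_mod_set y -> ideal_mod_set (x - y).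
Proof.
move=> [a Ha <-] [b Hb <-]; exists (a - b); first exact: idealB.
exact: quotring_piB.
Qed.
Fact ideal_modMl a x : ideal_mod_set x -> ideal_mod_set (a * x).
Proof.
move=> [b Hb <-]; exists (repr a * b); first exact: idealMl.
by rewrite -quotring_piM quotring_reprK.
Qed.
Fact ideal_modMr a x : ideal_mod_set x -> ideal_mod_set (x * a).
Proof.
move=> [b Hb <-]; exists (b * repr a); first exact: idealMr.
by rewrite -quotring_piM quotring_reprK.
Qed.

(* H/K as an ideal of A/K, for K contained in H. *)
Definition ideal_mod : ideal (quotring K) :=
  Ideal ideal_mod0 ideal_modB ideal_modMl ideal_modMr.

End IdealQuotient.

Section Heredity.
Variable A : pzRingType.
Implicit Types (X Y : set A) (H : nat -> ideal A).

(* The product XY: finite sums of products xy. *)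
Definition setmul X Y : set A :=
  [set z | exists m (x y : 'I_m -> A),
    [/\ forall i, X (x i), forall i, Y (y i) & z = \sum_(i < m) x i * y i]].

Definition maximal_right_ideal (N : submod (A^c)^o) :=
  (N : set A) <> setT /\
  forall N' : submod (A^c)^o, N `<=` N' ->
    (N' : set A) = N \/ (N' : set A) = setT.

Definition jacobson : set A :=
  [set x | forall N : submod (A^c)^o, maximal_right_ideal N -> N x].

Definition heredity_ideal (H : ideal A) :=
  [/\ setmul H H = H,
      projective (submod_type (ideal_right H)) &
      setmul (setmul H jacobson) H = [set 0]].

Definition idempotent_chain n H :=
  [/\ (H 0%N : set A) = setT,
      (H n : set A) = [set 0],
      forall i, (i <= n)%N -> setmul (H i) (H i) = H i &
      forall i, (i < n)%N -> H i.+1 `<` H i].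

End Heredity.

Section HeredityChains.
Variable A : pzRingType.
Implicit Type H : nat -> ideal A.

Definition heredity_chain n H :=
  idempotent_chain n H /\
  forall i, (i < n)%N -> heredity_ideal (ideal_mod (H i) (H i.+1)).

Definition layer_radical_zero H i :=
  let L := ideal_mod (H i) (H i.+1) in
  setmul (setmul L (@jacobson (quotring (H i.+1)))) L = [set 0].

Definition right_strongly_heredity_chain n H :=
  idempotent_chain n H /\
  forall i, (i < n)%N ->
    projective (submod_type (ideal_right (H i))) /\ layer_radical_zero H i.

Definition left_strongly_heredity_chain n H :=
  idempotent_chain n H /\
  forall i, (i < n)%N ->
    projective (submod_type (ideal_left (H i))) /\ layer_radical_zero H i.

Definition strongly_qh :=
  exists n H, [/\ heredity_chain n H, right_strongly_heredity_chain n H &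
                  left_strongly_heredity_chain n H].

End HeredityChains.

Definition artinian (k : comPzRingType) :=
  forall N : nat -> submod k^o, (forall n, N n.+1 `<=` N n) ->
    exists m, forall n, (m <= n)%N -> (N n : set k) = N m.

(* A is an algebra over a commutative artinian ring k, by a ring morphism
   from k to the centre of A, and is finitely generated as a k-module. *)
Definition artin_algebra (A : pzRingType) :=
  exists (k : comPzRingType) (phi : {rmorphism k -> A}),
    [/\ artinian k,
        forall c a, phi c * a = a * phi c &
        exists s : seq A, forall a, exists c : nat -> k,
          a = \sum_(i < size s) phi (c i) * s`_i].

Record precat := Precat {
  obj :> Type;
  hom : obj -> obj -> zmodType;
  idm : forall X, hom X X;
  comp : forall X Y Z, hom Y Z -> hom X Y -> hom X Z;
  compA : forall X Y Z T (h : hom Z T) (g : hom Y Z) (f : hom X Y),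
    comp h (comp g f) = comp (comp h g) f;
  comp1m : forall X Y (f : hom X Y), comp (idm Y) f = f;
  compm1 : forall X Y (f : hom X Y), comp f (idm X) = f;
  compDl : forall X Y Z (g g' : hom Y Z) (f : hom X Y),
    comp (g + g') f = comp g f + comp g' f;
  compDr : forall X Y Z (g : hom Y Z) (f f' : hom X Y),
    comp g (f + f') = comp g f + comp g f' }.

Arguments hom {_}.
Arguments idm {_}.
Arguments comp {_ _ _ _}.
Notation "g '\oc' f" := (comp g f) (at level 40, left associativity).

Section Precat.
Variable C : precat.
Implicit Types X Y Z : C.

Lemma comp0m X Y Z (f : hom X Y) : (0 : hom Y Z) \oc f = 0.
Proof. by apply: (addIr (0 \oc f)); rewrite -compDl !add0r. Qed.
Lemma compm0 X Y Z (g : hom Y Z) : g \oc (0 : hom X Y) = 0.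
Proof. by apply: (addIr (g \oc 0)); rewrite -compDr !add0r. Qed.
Lemma compNm X Y Z (g : hom Y Z) (f : hom X Y) : (- g) \oc f = - (g \oc f).
Proof. by apply: (addIr (g \oc f)); rewrite -compDl !addNr comp0m. Qed.
Lemma compmN X Y Z (g : hom Y Z) (f : hom X Y) : g \oc (- f) = - (g \oc f).
Proof. by apply: (addIr (g \oc f)); rewrite -compDr !addNr compm0. Qed.

Definition monic X Y (f : hom X Y) :=
  forall Z (g h : hom Z X), f \oc g = f \oc h -> g = h.
Definition epic X Y (f : hom X Y) :=
  forall Z (g h : hom Y Z), g \oc f = h \oc f -> g = h.
Definition invertible X Y (f : hom X Y) :=
  exists g : hom Y X, g \oc f = idm X /\ f \oc g = idm Y.
Definition isomorphic X Y := exists f : hom X Y, invertible f.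

Definition zero_object X := idm X = 0.

Definition biproduct X Y Z :=
  exists (i : hom X Z) (j : hom Y Z) (p : hom Z X) (q : hom Z Y),
    [/\ p \oc i = idm X, q \oc j = idm Y, p \oc j = 0, q \oc i = 0 &
        i \oc p + j \oc q = idm Z].

Definition radical X Y (f : hom X Y) :=
  forall g : hom Y X, invertible (idm X - g \oc f).

End Precat.

Record addcat := Addcat {
  addcat_cat :> precat;
  addcat_zero : exists X : addcat_cat, zero_object X;
  addcat_sum : forall X Y : addcat_cat, exists Z, biproduct X Y Z }.

(* Full subcategories, closed under isomorphisms, finite direct sums and
   direct summands, given by their objects. *)
Record subcat (C : addcat) := Subcat {
  subcat_obj :> C -> Prop;
  subcat_iso : forall X Y, isomorphic X Y -> subcat_obj X -> subcat_obj Y;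
  subcat_zero : forall X, zero_object X -> subcat_obj X;
  subcat_sum : forall X Y Z, biproduct X Y Z ->
    subcat_obj X -> subcat_obj Y -> subcat_obj Z;
  subcat_summand : forall X Y Z, biproduct X Y Z ->
    subcat_obj Z -> subcat_obj X }.

Section FullSubcategory.
Variables (C : addcat) (D : subcat C).

Definition fullsub_precat : precat :=
  @Precat {X : C | D X} (fun X Y => hom (sval X) (sval Y))
    (fun X => idm (sval X)) (fun X Y Z g f => g \oc f)
    (fun X Y Z T => @compA C (sval X) (sval Y) (sval Z) (sval T))
    (fun X Y => @comp1m C (sval X) (sval Y))
    (fun X Y => @compm1 C (sval X) (sval Y))
    (fun X Y Z => @compDl C (sval X) (sval Y) (sval Z))
    (fun X Y Z => @compDr C (sval X) (sval Y) (sval Z)).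

Fact fullsub_zero : exists X : fullsub_precat, zero_object X.
Proof.
by have [X X0] := addcat_zero C; exists (exist _ X (subcat_zero D X0)).
Qed.

Fact fullsub_sum (X Y : fullsub_precat) : exists Z, biproduct X Y Z.
Proof.
have [Z XYZ] := addcat_sum (sval X) (sval Y).
by exists (exist _ Z (subcat_sum XYZ (svalP X) (svalP Y))).
Qed.

Definition fullsub : addcat := Addcat fullsub_zero fullsub_sum.

(* D' as a subcategory of D, for D' contained in D. *)
Definition subcat_in (D' : subcat C) : subcat fullsub :=
  @Subcat fullsub (fun X => D' (sval X))
    (fun X Y => @subcat_iso C D' (sval X) (sval Y))
    (fun X => @subcat_zero C D' (sval X))
    (fun X Y Z => @subcat_sum C D' (sval X) (sval Y) (sval Z))
    (fun X Y Z => @subcat_summand C D' (sval X) (sval Y) (sval Z)).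

End FullSubcategory.

Record functor (C D : precat) := Functor {
  fobj :> C -> D;
  fhom : forall X Y, hom X Y -> hom (fobj X) (fobj Y);
  fhom1 : forall X, fhom (idm X) = idm (fobj X);
  fhomM : forall X Y Z (g : hom Y Z) (f : hom X Y),
    fhom (g \oc f) = fhom g \oc fhom f }.

(* F is left adjoint to G. *)
Record adjunction (C D : precat) (F : functor C D) (G : functor D C) :=
  Adjunction {
  adj_unit : forall X, hom X (G (F X));
  adj_counit : forall Y, hom (F (G Y)) Y;
  adj_unit_nat : forall X X' (f : hom X X'),
    adj_unit X' \oc f = fhom G (fhom F f) \oc adj_unit X;
  adj_counit_nat : forall Y Y' (f : hom Y Y'),
    adj_counit Y' \oc fhom F (fhom G f) = f \oc adj_counit Y;
  adj_triangleF : forall X, adj_counit (F X) \oc fhom F (adj_unit X) = idm (F X);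
  adj_triangleG : forall Y, fhom G (adj_counit Y) \oc adj_unit (G Y) = idm (G Y)
  }.

Section Rejective.
Variables (C : addcat) (D : subcat C).

Definition inclusion : functor (fullsub D) C :=
  @Functor (fullsub D) C (fun X => sval X) (fun X Y f => f)
    (fun X => erefl) (fun X Y Z g f => erefl).

Definition right_rejective :=
  exists (G : functor C (fullsub D)) (adj : adjunction inclusion G),
    forall X, monic (adj_counit adj X).

Definition left_rejective :=
  exists (F : functor C (fullsub D)) (adj : adjunction F inclusion),
    forall X, epic (adj_unit adj X).

Definition rejective := right_rejective /\ left_rejective.

End Rejective.

Record cat_ideal (C : precat) := CatIdeal {
  cat_ideal_set :> forall X Y : C, set (hom X Y);
  cat_ideal0 : forall X Y, cat_ideal_set (0 : hom X Y);
  cat_idealB : forall X Y (f g : hom X Y),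
    cat_ideal_set f -> cat_ideal_set g -> cat_ideal_set (f - g);
  cat_idealMl : forall X Y Z (g : hom Y Z) (f : hom X Y),
    cat_ideal_set f -> cat_ideal_set (g \oc f);
  cat_idealMr : forall X Y Z (g : hom Y Z) (f : hom X Y),
    cat_ideal_set g -> cat_ideal_set (g \oc f) }.

Section QuotientCategory.
Variables (C : precat) (I : cat_ideal C).

Section Hom.
Variables X Y : C.

Definition cat_ideal_pred : {pred hom X Y} := fun f => `[< I X Y f >].

Fact cat_ideal_pred_closed : zmod_closed cat_ideal_pred.
Proof.
split=> [|f g /asboolP If /asboolP Ig]; apply/asboolP; first exact: cat_ideal0.
exact: cat_idealB.
Qed.

HB.instance Definition _ :=
  GRing.isZmodClosed.Build (hom X Y) cat_ideal_pred cat_ideal_pred_closed.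

Definition quothom := Quotient.quot cat_ideal_pred.
HB.instance Definition _ := GRing.Zmodule.on quothom.

Definition quothom_pi (f : hom X Y) : quothom :=
  \pi_(Quotient.quot cat_ideal_pred) f.

Lemma quothom_piP f g : quothom_pi f = quothom_pi g <-> I X Y (f - g).
Proof.
split=> [/eqP|Ifg]; first by rewrite -Quotient.idealrBE => /asboolP.
by apply/eqP; rewrite -Quotient.idealrBE; apply/asboolP.
Qed.

Lemma quothom_piD f g : quothom_pi (f + g) = quothom_pi f + quothom_pi g.
Proof. exact: raddfD. Qed.

Lemma quothom_reprK (f : quothom) : quothom_pi (repr f) = f.
Proof. exact: reprK. Qed.

End Hom.

Definition quotcomp X Y Z (g : quothom Y Z) (f : quothom X Y) : quothom X Z :=
  quothom_pi (repr g \oc repr f).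

Lemma quothom_piM X Y Z (g : hom Y Z) (f : hom X Y) :
  quotcomp (quothom_pi g) (quothom_pi f) = quothom_pi (g \oc f).
Proof.
apply/quothom_piP; set g' := repr _; set f' := repr _.
have Ig : I _ _ (g' - g) by apply/quothom_piP; rewrite quothom_reprK.
have If : I _ _ (f - f') by apply/quothom_piP; rewrite quothom_reprK.
have -> : g' \oc f' - g \oc f = (g' - g) \oc f' - g \oc (f - f').
  by rewrite compDl compDr compNm compmN opprB addrA subrK.
by apply: cat_idealB; [apply: cat_idealMr | apply: cat_idealMl].
Qed.

Fact quotcompA X Y Z T (h : quothom Z T) (g : quothom Y Z) (f : quothom X Y) :
  quotcomp h (quotcomp g f) = quotcomp (quotcomp h g) f.
Proof.
rewrite -[h]quothom_reprK -[g]quothom_reprK -[f]quothom_reprK.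
by rewrite !quothom_piM compA.
Qed.
Fact quotcomp1m X Y (f : quothom X Y) : quotcomp (quothom_pi (idm Y)) f = f.
Proof. by rewrite -[f]quothom_reprK quothom_piM comp1m. Qed.
Fact quotcompm1 X Y (f : quothom X Y) : quotcomp f (quothom_pi (idm X)) = f.
Proof. by rewrite -[f]quothom_reprK quothom_piM compm1. Qed.
Fact quotcompDl X Y Z (g g' : quothom Y Z) (f : quothom X Y) :
  quotcomp (g + g') f = quotcomp g f + quotcomp g' f.
Proof.
rewrite -[g]quothom_reprK -[g']quothom_reprK -[f]quothom_reprK -quothom_piD.
by rewrite !quothom_piM compDl quothom_piD.
Qed.
Fact quotcompDr X Y Z (g : quothom Y Z) (f f' : quothom X Y) :
  quotcomp g (f + f') = quotcomp g f + quotcomp g f'.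
Proof.
rewrite -[g]quothom_reprK -[f]quothom_reprK -[f']quothom_reprK -quothom_piD.
by rewrite !quothom_piM compDr quothom_piD.
Qed.

Definition quotcat : precat :=
  @Precat C (fun X Y => quothom X Y : zmodType) (fun X => quothom_pi (idm X))
    quotcomp quotcompA quotcomp1m quotcompm1 quotcompDl quotcompDr.

End QuotientCategory.

Section FactorIdeal.
Variables (C : addcat) (D : subcat C).

Definition factor_set (X Y : C) : set (hom X Y) :=
  [set f | exists Z (g : hom Z Y) (h : hom X Z), D Z /\ f = g \oc h].

Fact factor_set0 X Y : factor_set (0 : hom X Y).
Proof.
have [Z Z0] := addcat_zero C; exists Z, 0, 0; split; first exact: subcat_zero.
by rewrite comp0m.
Qed.
Fact factor_setB X Y (f f' : hom X Y) :
  factor_set f -> factor_set f' -> factor_set (f - f').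
Proof.
move=> [Z [g [h [DZ ->]]]] [Z' [g' [h' [DZ' ->]]]].
have [T ZZ'T] := addcat_sum Z Z'; have DT := subcat_sum ZZ'T DZ DZ'.
have [i [j [p [q [pi qj pj qi _]]]]] := ZZ'T.
exists T, (g \oc p - g' \oc q), (i \oc h + j \oc h'); split=> //.
rewrite !(compDl, compDr) !compNm !compA -!(compA _ _ i) -!(compA _ _ j).
by rewrite pi qj pj qi !compm1 !compm0 !comp0m oppr0 addr0 add0r.
Qed.
Fact factor_setMl X Y Z (g : hom Y Z) (f : hom X Y) :
  factor_set f -> factor_set (g \oc f).
Proof.
move=> [T [a [b [DT ->]]]]; exists T, (g \oc a), b; split=> //.
by rewrite compA.
Qed.
Fact factor_setMr X Y Z (g : hom Y Z) (f : hom X Y) :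
  factor_set g -> factor_set (g \oc f).
Proof.
move=> [T [a [b [DT ->]]]]; exists T, a, (b \oc f); split=> //.
by rewrite compA.
Qed.

Definition factor_ideal : cat_ideal C :=
  @CatIdeal C factor_set factor_set0 factor_setB factor_setMl factor_setMr.

Definition cosemisimple :=
  forall (X Y : quotcat factor_ideal) (f : hom X Y), radical f -> f = 0.

End FactorIdeal.

Section Chains.
Variable C : addcat.
Implicit Type D : nat -> subcat C.

Definition subcat_chain n D :=
  [/\ forall X, D 0%N X,
      forall X, D n X -> zero_object X &
      forall i, (i < n)%N -> forall X, D i.+1 X -> D i X].

Definition rejective_chain n D :=
  subcat_chain n D /\
  forall i, (i < n)%N ->
    let Di := subcat_in (D i) (D i.+1) in cosemisimple Di /\ rejective Di.

Definition total_right_rejective_chain n D :=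
  subcat_chain n D /\
  forall i, (i < n)%N ->
    right_rejective (D i.+1) /\ cosemisimple (subcat_in (D i) (D i.+1)).

Definition total_left_rejective_chain n D :=
  subcat_chain n D /\
  forall i, (i < n)%N ->
    left_rejective (D i.+1) /\ cosemisimple (subcat_in (D i) (D i.+1)).

End Chains.

Section LinearMaps.
Variables (R : pzRingType) (U V : lmodType R).

Definition mhom := {linear U -> V}.

Lemma mhomP (f g : mhom) : (forall x, f x = g x) -> f = g.
Proof.
case: f g => [f [[[f1 f2]] [f3]]] [g [[[g1 g2]] [g3]]] /= /funext fg.
move: f1 f2 f3; rewrite {}fg => f1 f2 f3.
by rewrite (Prop_irrelevance f1 g1) (Prop_irrelevance f2 g2)
  (Prop_irrelevance f3 g3).
Qed.

HB.instance Definition _ := gen_eqMixin mhom.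
HB.instance Definition _ := gen_choiceMixin mhom.

Definition mhom0 : mhom := \0.
Definition mhom_opp (f : mhom) : mhom := \- f.
Definition mhom_add (f g : mhom) : mhom := f \+ g.

Fact mhom_addA : associative mhom_add.
Proof. by move=> f g h; apply: mhomP => x; apply: addrA. Qed.
Fact mhom_addC : commutative mhom_add.
Proof. by move=> f g; apply: mhomP => x; apply: addrC. Qed.
Fact mhom_add0 : left_id mhom0 mhom_add.
Proof. by move=> f; apply: mhomP => x; apply: add0r. Qed.
Fact mhom_addN : left_inverse mhom0 mhom_opp mhom_add.
Proof. by move=> f; apply: mhomP => x; apply: addNr. Qed.

HB.instance Definition _ :=
  GRing.isZmodule.Build mhom mhom_addA mhom_addC mhom_add0 mhom_addN.

End LinearMaps.

Section ProjectiveModules.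
Variable R : pzRingType.
Implicit Types M N P : lmodType R.

Lemma fg_pair M N : finitely_generated M -> finitely_generated N ->
  finitely_generated (M * N)%type.
Proof.
move=> [s sP] [t tP].
exists (map (fun x => (x, 0)) s ++ map (fun y => (0, y)) t) => -[x y].
have [c ->] := sP x; have [d ->] := tP y.
exists (fun i => if (i < size s)%N then c i else d (i - size s)%N).
rewrite size_cat !size_map big_split_ord /=.
have fstS m (F : 'I_m -> M * N) : (\sum_i F i).1 = \sum_i (F i).1.
  exact: (big_morph fst).
have sndS m (F : 'I_m -> M * N) : (\sum_i F i).2 = \sum_i (F i).2.
  exact: (big_morph snd).
have inl (i : 'I_(size s)) :
    (map (fun x => (x, 0)) s ++ map (fun y => (0, y)) t)`_i = (s`_i, 0 : N).
  by rewrite nth_cat size_map ltn_ord (nth_map 0).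
have inr (i : 'I_(size t)) :
    (map (fun x => (x, 0)) s ++ map (fun y => (0, y)) t)`_(size s + i)
    = (0 : M, t`_i).
  by rewrite nth_cat size_map ltnNge leq_addr /= addKn (nth_map 0).
congr pair; rewrite /= ?fstS ?sndS.
  rewrite [X in _ = _ + X]big1 => [|i _]; last by rewrite inr /= scaler0.
  by rewrite addr0; apply: eq_bigr => i _; rewrite inl ltn_ord.
rewrite [X in _ = X + _]big1 => [|i _]; last by rewrite inl /= scaler0.
by rewrite add0r; apply: eq_bigr => i _; rewrite inr ltnNge leq_addr addKn.
Qed.

Definition pair_map M N P (f : mhom M P) (g : mhom N P) (x : M * N) : P :=
  f x.1 + g x.2.
Fact pair_map_linear M N P (f : mhom M P) (g : mhom N P) :
  linear (pair_map f g).
Proof.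
by move=> a u v; rewrite /pair_map /= !linearP scalerDr addrACA.
Qed.
HB.instance Definition _ M N P (f : mhom M P) (g : mhom N P) :=
  GRing.isLinear.Build R (M * N)%type P *:%R (pair_map f g)
    (pair_map_linear f g).

Definition pair_in1 M N (x : M) : M * N := (x, 0).
Fact pair_in1_linear M N : linear (@pair_in1 M N).
Proof. by move=> a u v; congr pair; rewrite /= scaler0 addr0. Qed.
HB.instance Definition _ M N :=
  GRing.isLinear.Build R M (M * N)%type *:%R (@pair_in1 M N)
    (@pair_in1_linear M N).

Definition pair_in2 M N (y : N) : M * N := (0, y).
Fact pair_in2_linear M N : linear (@pair_in2 M N).
Proof. by move=> a u v; congr pair; rewrite /= scaler0 addr0. Qed.
HB.instance Definition _ M N :=
  GRing.isLinear.Build R N (M * N)%type *:%R (@pair_in2 M N)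
    (@pair_in2_linear M N).

Definition pair_fst M N (x : M * N) : M := x.1.
Fact pair_fst_linear M N : linear (@pair_fst M N).
Proof. by []. Qed.
HB.instance Definition _ M N :=
  GRing.isLinear.Build R (M * N)%type M *:%R (@pair_fst M N)
    (@pair_fst_linear M N).

Definition pair_snd M N (x : M * N) : N := x.2.
Fact pair_snd_linear M N : linear (@pair_snd M N).
Proof. by []. Qed.
HB.instance Definition _ M N :=
  GRing.isLinear.Build R (M * N)%type N *:%R (@pair_snd M N)
    (@pair_snd_linear M N).

Lemma projective_pair M N : projective M -> projective N ->
  projective (M * N)%type.
Proof.
move=> pM pN X Y g f gP.
have [h hP] := pM _ _ g (f \o @pair_in1 M N) gP.
have [k kP] := pN _ _ g (f \o @pair_in2 M N) gP.
exists (pair_map h k) => -[x y]; rewrite linearD hP kP /= -linearD.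
by congr (f (_, _)); rewrite ?addr0 ?add0r.
Qed.

Definition zero_module : lmodType R := {ffun 'I_0 -> R^o}.

Lemma zero_moduleP (x y : zero_module) : x = y.
Proof. by apply/ffunP => -[]. Qed.

Lemma fg_zero : finitely_generated zero_module.
Proof. by exists [::] => x; exists (fun=> 0); apply: zero_moduleP. Qed.

Lemma projective_zero : projective zero_module.
Proof.
move=> M N g f _; exists (mhom0 zero_module M) => x.
by rewrite (zero_moduleP x 0) !linear0.
Qed.

Definition proj_precat : precat.
refine (@Precat {M : lmodType R | finitely_generated M /\ projective M}
  (fun X Y => mhom (sval X) (sval Y) : zmodType)
  (fun X => (idfun : {linear sval X -> sval X}))
  (fun X Y Z (g : mhom (sval Y) (sval Z)) (f : mhom (sval X) (sval Y)) =>
     (g \o f : {linear sval X -> sval Z})) _ _ _ _ _).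
- by move=> *; apply: mhomP.
- by move=> *; apply: mhomP.
- by move=> *; apply: mhomP.
- by move=> *; apply: mhomP.
- by move=> X Y Z g f f'; apply: mhomP => x; apply: linearD.
Defined.

Fact proj_zero : exists X : proj_precat, zero_object X.
Proof.
exists (exist _ zero_module (conj fg_zero projective_zero)).
by apply: mhomP => x; apply: zero_moduleP.
Qed.

Fact proj_sum (X Y : proj_precat) : exists Z, biproduct X Y Z.
Proof.
case: X Y => [M [fM pM]] [N [fN pN]].
exists (exist _ (M * N : lmodType R)%type
  (conj (fg_pair fM fN) (projective_pair pM pN))).
exists (@pair_in1 M N : {linear _ -> _}), (@pair_in2 M N : {linear _ -> _}).
exists (@pair_fst M N : {linear _ -> _}), (@pair_snd M N : {linear _ -> _}).
split; apply: mhomP => //= -[x y]; congr pair; rewrite /= ?addr0 ?add0r //.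
Qed.

Definition projcat : addcat := Addcat proj_zero proj_sum.

Definition retract M N :=
  exists (i : {linear M -> N}) (p : {linear N -> M}), forall x, p (i x) = x.

Lemma retract_trans M N P : retract M N -> retract N P -> retract M P.
Proof.
move=> [i [p pi]] [j [q qj]]; exists (j \o i), (p \o q) => x /=.
by rewrite qj pi.
Qed.

Fact ker_closed M N (p : {linear M -> N}) (a : R) (u v : M) :
  p u = 0 -> p v = 0 -> p (a *: u + v) = 0.
Proof. by move=> pu pv; rewrite linearP pu pv scaler0 addr0. Qed.

Definition ker M N (p : {linear M -> N}) : submod M :=
  Submod (linear0 p) (@ker_closed M N p).

Definition mk_linear M N (f : M -> N) (fl : linear f) : {linear M -> N} :=
  HB.pack f (GRing.isLinear.Build R M N *:%R f fl).

Lemma retractP M N : direct_summand M N <-> retract M N.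
Proof.
split=> [[M' [f [g fK gK]]]|[i [p pi]]].
  have gl : linear g.
    by move=> a u v; apply: (can_inj fK); rewrite gK linearP !gK.
  exists (f \o @pair_in1 M M'), (@pair_fst M M' \o mk_linear gl) => x /=.
  by rewrite fK.
exists (submod_type (ker p)).
pose v : mhom (submod_type (ker p)) N := (val : {linear _ -> _}).
have vK (y : submod_type (ker p)) : p (v y) = 0 by exact/asboolP/(valP y).
have kP x : x - i (p x) \in submod_pred (ker p).
  by apply/asboolP; rewrite /= linearB pi subrr.
exists (pair_map i v); exists (fun x => (p x, SubmodType (kP x))).
  move=> [x y]; have px : p (i x + v y) = x by rewrite linearD pi vK addr0.
  congr pair; first exact: px.
  by apply: val_inj; rewrite /pair_map /= px addrC addKr.
by move=> x; apply: (etrans (addrC _ _)); apply: subrK.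
Qed.

Definition ffun_join M m n (x : {ffun 'I_m -> M} * {ffun 'I_n -> M}) :
    {ffun 'I_(m + n) -> M} :=
  [ffun t => match fintype.split t with inl a => x.1 a | inr b => x.2 b end].
Fact ffun_join_linear M m n : linear (@ffun_join M m n).
Proof.
by move=> a u v; apply/ffunP => t; rewrite !ffunE; case: fintype.split => b;
  rewrite !ffunE.
Qed.
Definition ffun_cut M m n (x : {ffun 'I_(m + n) -> M}) :
    {ffun 'I_m -> M} * {ffun 'I_n -> M} :=
  ([ffun a => x (lshift n a)], [ffun b => x (rshift m b)]).
Fact ffun_cut_linear M m n : linear (@ffun_cut M m n).
Proof.
by move=> a u v; congr pair; apply/ffunP => t; rewrite !ffunE.
Qed.

Lemma retract_ffunD M m n : retract
  ({ffun 'I_m -> M} * {ffun 'I_n -> M})%type {ffun 'I_(m + n) -> M}.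
Proof.
exists (mk_linear (@ffun_join_linear M m n)).
exists (mk_linear (@ffun_cut_linear M m n)) => -[x y].
congr pair; apply/ffunP => t; rewrite !ffunE.
  by rewrite -[lshift n t]/(unsplit (inl t)) unsplitK.
by rewrite -[rshift m t]/(unsplit (inr t)) unsplitK.
Qed.

Section Add.
Variable M : lmodType R.

Lemma add_modP N :
  add_mod M N <-> exists m : nat, retract N {ffun 'I_m -> M}.
Proof. by split=> -[m /retractP]; exists m => //; apply/retractP. Qed.

Definition add_obj (X : projcat) := add_mod M (sval X).

Lemma add_obj_retract (X Y : projcat) (i : hom X Y) (p : hom Y X) :
  p \oc i = idm X -> add_obj Y -> add_obj X.
Proof.
move=> pi /add_modP[m Ym]; apply/add_modP; exists m.
apply: retract_trans Ym; exists i, p => x.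
exact: (congr1 (fun f : mhom (sval X) (sval X) => f x) pi).
Qed.

Fact add_iso (X Y : projcat) : isomorphic X Y -> add_obj X -> add_obj Y.
Proof. by move=> [f [g [_ fg]]]; apply: add_obj_retract fg. Qed.

Fact add_zero (X : projcat) : zero_object X -> add_obj X.
Proof.
move=> X0; apply/add_modP; exists 0%N.
exists (mhom0 _ _), (mhom0 _ _) => x.
exact: (congr1 (fun f : mhom (sval X) (sval X) => f x) (esym X0)).
Qed.

Fact add_sum (X Y Z : projcat) :
  biproduct X Y Z -> add_obj X -> add_obj Y -> add_obj Z.
Proof.
move=> [i [j [p [q [_ _ _ _ ijpq]]]]] /add_modP[m [a [b ab]]].
move=> /add_modP[n [c [d cd]]]; apply/add_modP; exists (m + n)%N.
apply: retract_trans (retract_ffunD M m n).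
pose f : {linear sval Z -> ({ffun 'I_m -> M} * {ffun 'I_n -> M})%type} :=
  (@pair_in1 _ _ \o (a \o (p : mhom _ _))) \+
  (@pair_in2 _ _ \o (c \o (q : mhom _ _))).
exists f, (pair_map ((i : mhom _ _) \o b) ((j : mhom _ _) \o d)) => x.
have f1 : (f x).1 = a ((p : mhom _ _) x) by apply: addr0.
have f2 : (f x).2 = c ((q : mhom _ _) x) by apply: add0r.
rewrite /= /pair_map f1 f2 /= ab cd.
exact: (congr1 (fun f : mhom (sval Z) (sval Z) => f x) ijpq).
Qed.

Fact add_summand (X Y Z : projcat) : biproduct X Y Z -> add_obj Z -> add_obj X.
Proof. by move=> [i [j [p [q [pi _ _ _ _]]]]]; apply: add_obj_retract pi. Qed.

Definition add_subcat : subcat projcat :=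
  @Subcat projcat add_obj add_iso add_zero add_sum add_summand.

End Add.

End ProjectiveModules.

Section IdempotentModule.
Variables (A : pzRingType) (e : A).

Fact emod0 : exists a : A, 0 = e * a.
Proof. by exists 0; rewrite mulr0. Qed.
Fact emodP (a : A^c) (u v : (A^c)^o) :
  (exists b : A, u = e * b) -> (exists b : A, v = e * b) ->
  exists b : A, a *: u + v = e * b.
Proof.
move=> [b ->] [c ->]; exists (b * (a : A) + c).
by rewrite mulrDr mulrA.
Qed.

Definition emod : lmodType A^c :=
  submod_type (@Submod A^c (A^c)^o (fun x => exists a : A, x = e * a)
                 emod0 emodP).

End IdempotentModule.

Definition right_proj (A : pzRingType) : addcat := projcat A^c.

(* Main.v *)
From mathcomp Require Import all_boot all_algebra.
From mathcomp Require Import boolp classical_sets.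
Require Import Defs.
Set Implicit Arguments.
Unset Strict Implicit.
Unset Printing Implicit Defensive.
Import GRing.Theory.
Local Open Scope classical_set_scope.
Local Open Scope ring_scope.

(* A subcategory D of proj A is governed, without choosing idempotents, by its
   trace ideal H = {v z | z in Z, v : Z -> A, Z in D}:
   D consists of the X with X = XH, and a map into Y factors through D iff its
   image lies in YH.  The coreflection of A into D, when it exists, is the
   inclusion of H, and the reflection is the dual of the inclusion of H as a left
   ideal; so D is right (left) rejective iff H has a finite dual basis as a right
   (left) module.  The trick "1 - uv is invertible iff 1 - vu is" turns
   cosemisimplicity of D' in D into H rad(A/H') H = 0 modulo H'.  In a rejective
   chain the reflections make monomorphisms of D_i monomorphisms of proj A, so
   rejectivity is inherited along the chain.

   Given a right-strongly quasi-hereditary order, the ideals are the traces H_U of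
   the P(j), j in an upper set U; XH_U is projective for projective X by induction
   on the length of X, because P(i)H_U = K(i)H_U if i is not in U.  Conversely,
   given a chain of ideals, order the simples by the last H_l not killing them;
   then Delta(i) = P(i)/P(i)H_(l+1). *)

(** * Submodules and the action of ideals *)

(** The work is done for left modules over a ring [R] and read at [R = A^c]. Passing to the opposite
    ring exchanges [dualL] and [dualR], which is why projectivity of ideals and the radical
    condition are written with elements of the ring. The two sides need different arguments. A
    coreflection has the formula HX for every X at once; a reflection has none, so it is built for R
    and carried along biproducts and retracts. The artin hypothesis enters as finite length of A on
    both sides, encoded by a strictly increasing function from submodules to numbers. Counts in
    Jordan-Hölder arguments are thus replaced by inequalities. The simples are indexed by an
    arbitrary type. The upper sets U that define the ideals are therefore cut out by a counting
    function on the layers of one composition series of R. Chains of subcategories may repeat a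
    term, while chains of idempotent ideals are strict. [weak_chain] allows repetitions on the ideal
    side, and they are deleted only where [strongly_qh] asks for a strict chain. *)

Section Submodules.
Variable R : pzRingType.
Implicit Types M N L : lmodType R.

Lemma submod_ext M (V W : submod M) : (forall x, V x <-> W x) -> V = W.
Proof.
case: V W => [V V0 VP] [W W0 WP] /= VW.
have E : V = W by apply/funext => x; apply/propext.
move: V0 VP; rewrite {}E => V0 VP.
by rewrite (Prop_irrelevance V0 W0) (Prop_irrelevance VP WP).
Qed.

Section Closure.
Variables (M : lmodType R) (V : submod M).

Lemma submodZ a u : V u -> V (a *: u).
Proof. by move=> Vu; rewrite -[_ *: _]addr0; apply/submodP/submod0. Qed.

Lemma submodD u v : V u -> V v -> V (u + v).
Proof. by move=> Vu Vv; rewrite -[u]scale1r; apply: submodP. Qed.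

Lemma submodN u : V u -> V (- u).
Proof. by rewrite -scaleN1r; apply: submodZ. Qed.

Lemma submodB u v : V u -> V v -> V (u - v).
Proof. by move=> Vu Vv; apply/submodD/submodN. Qed.

Lemma submod_sum m (u : 'I_m -> M) : (forall i, V (u i)) -> V (\sum_i u i).
Proof. by move=> Vu; elim/big_ind: _ => //; [apply: submod0 | apply: submodD]. Qed.

End Closure.

Definition submod_full M : submod M :=
  @Submod R M (fun=> True) I (fun _ _ _ _ _ => I).

Fact submod_zero_closed M (a : R) (u v : M) : u = 0 -> v = 0 -> a *: u + v = 0.
Proof. by move=> -> ->; rewrite scaler0 addr0. Qed.
Definition submod_zero M : submod M :=
  @Submod R M (fun x => x = 0) erefl (@submod_zero_closed M).

Fact submod_preim0 M N (f : {linear M -> N}) (V : submod N) : V (f 0).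
Proof. by rewrite linear0; apply: submod0. Qed.
Fact submod_preim_closed M N (f : {linear M -> N}) (V : submod N) a u v :
  V (f u) -> V (f v) -> V (f (a *: u + v)).
Proof. by move=> Vu Vv; rewrite linearP; apply: submodP. Qed.
Definition submod_preim M N (f : {linear M -> N}) (V : submod N) : submod M :=
  @Submod R M (fun x => V (f x)) (submod_preim0 f V) (submod_preim_closed (V := V)).

Fact submod_im0 M N (f : {linear M -> N}) (V : submod M) :
  exists2 x, V x & f x = 0.
Proof. by exists 0; [apply: submod0 | apply: linear0]. Qed.
Fact submod_im_closed M N (f : {linear M -> N}) (V : submod M) a u v :
  (exists2 x, V x & f x = u) -> (exists2 x, V x & f x = v) ->
  exists2 x, V x & f x = a *: u + v.
Proof.
by move=> [x Vx <-] [y Vy <-]; exists (a *: x + y); [apply: submodP | rewrite linearP].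
Qed.
Definition submod_im M N (f : {linear M -> N}) (V : submod M) : submod N :=
  Submod (submod_im0 f V) (@submod_im_closed M N f V).

Fact submod_cap_closed M (V W : submod M) (a : R) u v :
  V u /\ W u -> V v /\ W v -> V (a *: u + v) /\ W (a *: u + v).
Proof. by move=> [? ?] [? ?]; split; apply: submodP. Qed.
Definition submod_cap M (V W : submod M) : submod M :=
  @Submod R M (fun x => V x /\ W x) (conj (submod0 V) (submod0 W))
    (@submod_cap_closed M V W).

Fact submod_add0 M (V W : submod M) : exists2 v, V v & W (0 - v).
Proof. by exists 0; rewrite ?subr0; apply: submod0. Qed.
Fact submod_add_closed M (V W : submod M) (a : R) (x y : M) :
  (exists2 v, V v & W (x - v)) -> (exists2 v, V v & W (y - v)) ->
  exists2 v, V v & W (a *: x + y - v).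
Proof.
move=> [u Vu Wu] [v Vv Wv]; exists (a *: u + v); first exact: submodP.
by rewrite opprD addrACA -scalerBr; apply: submodP.
Qed.
Definition submod_add M (V W : submod M) : submod M :=
  @Submod R M (fun x => exists2 v, V v & W (x - v)) (submod_add0 V W)
    (@submod_add_closed M V W).

Lemma submod_addl M (V W : submod M) : V `<=` submod_add V W.
Proof. by move=> x Vx; exists x => //; rewrite subrr; apply: submod0. Qed.

Lemma submod_addr M (V W : submod M) : W `<=` submod_add V W.
Proof. by move=> x Wx; exists 0; rewrite ?subr0 //; apply: submod0. Qed.

(** The modular law in the form used for lengths: a strict inclusion remains strict either inside N
    or modulo N. *)
Lemma submod_modular M (V W N : submod M) : V `<=` W ->
  submod_cap W N `<=` V -> W `<=` submod_add V N -> W `<=` V.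
Proof.
move=> VW WNV WVN x Wx; have [v Vv Nxv] := WVN x Wx.
rewrite -(subrK v x); apply: submodD => //; apply: WNV; split=> //.
by apply: submodB => //; apply: VW.
Qed.

Fact cyc0 M (x : M) : exists a : R, 0 = a *: x.
Proof. by exists 0; rewrite scale0r. Qed.
Fact cyc_closed M (x : M) (a : R) u v :
  (exists b : R, u = b *: x) -> (exists b : R, v = b *: x) ->
  exists b : R, a *: u + v = b *: x.
Proof. by move=> [b ->] [c ->]; exists (a * b + c); rewrite scalerDl scalerA. Qed.
Definition cyc M (x : M) : submod M := Submod (cyc0 x) (@cyc_closed M x).

Lemma cyc_id M (x : M) : cyc x x.
Proof. by exists 1; rewrite scale1r. Qed.

Lemma quotmod_pi_linear M (V : submod M) : linear (@quotmod_pi R M V).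
Proof. by move=> a u v; rewrite quotmod_piD -quotmod_piZ. Qed.
Definition qpi M (V : submod M) : {linear M -> quotmod V} :=
  mk_linear (@quotmod_pi_linear M V).

Lemma qpi_onto M (V : submod M) : onto (qpi V).
Proof. by move=> y; exists (generic_quotient.repr y); apply: quotmod_reprK. Qed.

Lemma qpiP M (V : submod M) x y : qpi V x = qpi V y <-> V (x - y).
Proof. exact: quotmod_piP. Qed.

Lemma qpi_eq0 M (V : submod M) x : qpi V x = 0 <-> V x.
Proof. by rewrite -[X in _ = X](linear0 (qpi V)) qpiP subr0. Qed.

Definition sval_lin M (V : submod M) : {linear submod_type V -> M} :=
  (val : {linear submod_type V -> M}).

Lemma sval_linP M (V : submod M) (x : submod_type V) : V (sval_lin V x).
Proof. exact/asboolP/(valP x). Qed.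

Lemma sval_lin_inj M (V : submod M) : injective (sval_lin V).
Proof. exact: val_inj. Qed.

Definition to_submod M (V : submod M) x (Vx : V x) : submod_type V :=
  SubmodType (introT (asboolP _) Vx : x \in submod_pred V).

Lemma to_submodK M (V : submod M) x (Vx : V x) : sval_lin V (to_submod Vx) = x.
Proof. by []. Qed.

Lemma factor_onto M N L (g : {linear M -> N}) (f : {linear M -> L}) :
  onto g -> (forall x, g x = 0 -> f x = 0) ->
  exists h : {linear N -> L}, forall x, h (g x) = f x.
Proof.
move=> gP gf; have [s sP] := choice gP.
have E x y : g x = g y -> f x = f y.
  by move=> xy; apply/eqP; rewrite -subr_eq0 -linearB gf // linearB xy subrr.
have hl : linear (f \o s).
  by move=> a u v /=; rewrite -linearP; apply: E; rewrite linearP !sP.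
by exists (mk_linear hl) => x; apply: E; rewrite sP.
Qed.

Lemma factor_inj M N L (g : {linear N -> L}) (f : {linear M -> L}) :
  injective g -> (forall x, exists y, g y = f x) ->
  exists h : {linear M -> N}, forall x, g (h x) = f x.
Proof.
move=> gI /choice[s sP].
have hl : linear s by move=> a u v; apply: gI; rewrite linearP !sP linearP.
by exists (mk_linear hl).
Qed.

Lemma inj_ker0 M N (f : {linear M -> N}) :
  (forall x, f x = 0 -> x = 0) -> injective f.
Proof.
by move=> f0 x y xy; apply/subr0_eq/f0; rewrite linearB xy subrr.
Qed.

Lemma misoP M N (f : {linear M -> N}) : injective f -> onto f -> miso M N.
Proof.
move=> fI /choice[g gP]; exists f; exists g => // x.
by apply: fI; rewrite gP.
Qed.

Lemma miso_map M N : miso M N ->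
  exists2 f : {linear M -> N}, injective f & onto f.
Proof.
move=> [f [g fK gK]]; exists f; first exact: can_inj fK.
by move=> y; exists (g y).
Qed.

Lemma miso_refl M : miso M M.
Proof. by exists (idfun : {linear M -> M}); exists id. Qed.

Lemma miso_sym M N : miso M N -> miso N M.
Proof.
move=> [f [g fK gK]].
have gl : linear g by move=> a u v; apply: (can_inj fK); rewrite gK linearP !gK.
by exists (mk_linear gl); exists f.
Qed.

Lemma miso_trans M N L : miso M N -> miso N L -> miso M L.
Proof.
move=> [f fB] [g gB]; exists (g \o f : {linear M -> L}).
exact: bij_comp.
Qed.

Lemma first_iso M N (g : {linear M -> N}) : onto g -> miso (quotmod (ker g)) N.
Proof.
move=> gP; have [h hP] := factor_onto (f := g) (@qpi_onto _ (ker g))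
  (fun x => proj1 (qpi_eq0 (ker g) x)).
apply: (misoP (f := h)).
  apply: inj_ker0 => y; have [x <-] := qpi_onto y.
  by rewrite hP => ?; apply/qpi_eq0.
by move=> y; have [x <-] := gP y; exists (qpi _ x).
Qed.

Lemma subquot_iso M N (W V : submod M) (g : {linear submod_type W -> N}) :
  onto g -> (forall x, g x = 0 <-> V (sval_lin W x)) -> miso (subquot W V) N.
Proof.
move=> gP gV; have := first_iso gP.
suff -> : ker g = submod_trace W V by [].
by apply: submod_ext => x; apply: gV.
Qed.

Lemma simple_neq0 M : simple M -> exists x : M, x <> 0.
Proof. by case. Qed.

Lemma simple_submod M (V : submod M) : simple M ->
  (forall x, V x -> x = 0) \/ (forall x, V x).
Proof.
move=> [_ /(_ V)[E|E]]; [left=> x Vx|right=> x].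
  by have : (V : set M) x by []; rewrite E.
by rewrite E.
Qed.

Lemma simpleI M : (exists x : M, x <> 0) ->
  (forall V : submod M, (exists2 x, V x & x <> 0) -> forall x, V x) -> simple M.
Proof.
move=> M0 H; split=> // V; have [[x Vx x0]|V0] := pselect (exists2 x, V x & x <> 0).
  by right; apply/seteqP; split=> // y _; apply: (H V); exists x.
left; apply/seteqP; split=> [x Vx|x ->]; last exact: submod0.
by apply: contrapT => x0; apply: V0; exists x.
Qed.

Lemma simple_onto M N (f : {linear M -> N}) :
  simple N -> (exists x, f x <> 0) -> onto f.
Proof.
move=> sN [x fx] y; have [H|H] := simple_submod (submod_im f (submod_full M)) sN.
  by case: fx; apply: H; exists x.
by have [z _ <-] := H y; exists z.
Qed.

Lemma simple_inj M N (f : {linear M -> N}) :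
  simple M -> (exists x, f x <> 0) -> injective f.
Proof.
move=> sM [x fx]; have [H|H] := simple_submod (ker f) sM.
  exact: inj_ker0.
by case: fx; apply: H.
Qed.

Lemma schur M N (f : {linear M -> N}) :
  simple M -> simple N -> (exists x, f x <> 0) -> miso M N.
Proof.
by move=> sM sN f0; apply: (misoP (f := f)); [apply: simple_inj | apply: simple_onto].
Qed.

Lemma simple_miso M N : miso M N -> simple M -> simple N.
Proof.
move=> /miso_map[f fI fP] sM; apply: simpleI.
  have [x x0] := simple_neq0 sM; exists (f x) => fx; apply: x0.
  by apply: fI; rewrite fx linear0.
move=> V [y Vy y0] z; have [x fx] := fP y; have [w <-] := fP z.
have [H|H] := simple_submod (submod_preim f V) sM; last exact: H.
by case: y0; rewrite -fx (H x) ?linear0 //= fx.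
Qed.

Definition maximal_in M (V W : submod M) :=
  [/\ V `<=` W, ~ W `<=` V &
      forall U : submod M, V `<=` U -> U `<=` W -> U `<=` V \/ W `<=` U].

Lemma maximal_in_simple M (V W : submod M) :
  maximal_in V W -> simple (subquot W V).
Proof.
move=> [VW nWV VWm]; apply: simpleI.
  have [x /not_implyP[Wx Vx]] : exists x, ~ (W x -> V x) by apply/existsNP.
  exists (qpi (submod_trace W V) (to_submod Wx)).
  by move/qpi_eq0.
move=> U [y Uy y0] z.
pose U' := submod_add V (submod_im (sval_lin W) (submod_preim (qpi (submod_trace W V)) U)).
have VU' : V `<=` U' by apply: submod_addl.
have U'W : U' `<=` W.
  move=> x [v Vv [w _ wE]]; rewrite -(subrK v x) -wE; apply: submodD.
    exact: sval_linP.
  exact: VW.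
case: (VWm U' VU' U'W) => H.
  case: y0; have [w wE] := qpi_onto y; rewrite -wE; apply/qpi_eq0/H/submod_addr.
  by exists w => //; move: Uy; rewrite -wE.
have [w <-] := qpi_onto z.
have [v Vv [u Uu uE]] := H _ (sval_linP w).
suff -> : qpi (submod_trace W V) w = qpi (submod_trace W V) u by [].
apply/qpiP; change (V (sval_lin W (w - u))).
by rewrite linearB uE subKr.
Qed.

(** Zorn's lemma on submodules that avoid a given x. With x = 1 it gives maximal left ideals; with
    other x it gives the hyperplanes needed in the proof that artinian rings have finite length. *)
Lemma submod_zorn M (V : submod M) x : ~ V x ->
  exists2 W : submod M, V `<=` W /\ ~ W x &
    forall U : submod M, W `<=` U -> ~ U x -> U `<=` W.
Proof.
move=> Vx; pose T := {W : submod M | V `<=` W /\ ~ W x}.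
pose t0 : T := exist _ V (conj (fun x Vx => Vx) Vx).
pose r (a b : T) := `[< (sval a : set M) `<=` sval b >].
have [] := @Zorn T r.
- by move=> a; apply/asboolP.
- by move=> a b c /asboolP ab /asboolP bc; apply/asboolP => y /ab/bc.
- move=> [a Pa] [b Pb] /asboolP /= ab /asboolP /= ba.
  have E : a = b by apply: submod_ext => y; split=> [/ab|/ba].
  by subst b; rewrite (Prop_irrelevance Pa Pb).
- move=> F Ftot; have [[f Ff]|F0] := pselect (exists f, F f); last first.
    by exists t0 => s Fs; case: F0; exists s.
  pose U y := exists2 s, F s & sval s y.
  have U0 : U 0 by exists f => //; apply: submod0.
  have UP a u v : U u -> U v -> U (a *: u + v).
    move=> [s Fs su] [s' Fs' sv].
    case: (Ftot s s' Fs Fs') => /asboolP le; [exists s'|exists s] => //;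
    by apply: submodP => //; apply: le.
  have UT : V `<=` Submod U0 UP /\ ~ Submod U0 UP x.
    split=> [y Vy|[s _]]; last by case: (svalP s).
    by exists f => //; apply: (proj1 (svalP f)).
  by exists (exist _ (Submod U0 UP) UT) => s Fs; apply/asboolP => y sy; exists s.
move=> [W PW] Wmax; exists W => // U WU Ux.
have PU : V `<=` U /\ ~ U x by split=> // y /(proj1 PW)/WU.
have /(congr1 sval) /= -> // : exist _ U PU = exist _ W PW :> T.
by apply: Wmax; apply/asboolP.
Qed.

Lemma submod_zorn_maximal (V : submod R^o) : ~ V 1 ->
  exists2 W : submod R^o, V `<=` W & maximal_in W (submod_full R^o).
Proof.
move=> V1; have [W [VW W1] Wmax] := submod_zorn V1; exists W => //; split=> //.
  by move/(_ 1 I).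
move=> U WU _; have [U1|U1] := pselect (U 1); last by left; apply: Wmax.
by right=> x _; rewrite -[x]mulr1; apply: (submodZ x U1).
Qed.

(* The additive span of G, characterised by its induction principle. *)
Definition addspan (M : zmodType) (G : M -> Prop) (x : M) :=
  forall V : M -> Prop, V 0 -> (forall u v, V u -> V v -> V (u + v)) ->
    (forall g, G g -> V g) -> V x.

Lemma addspan0 (M : zmodType) (G : M -> Prop) : addspan G 0.
Proof. by []. Qed.
Lemma addspanD (M : zmodType) (G : M -> Prop) x y :
  addspan G x -> addspan G y -> addspan G (x + y).
Proof. by move=> Gx Gy V V0 VD VG; exact: VD (Gx V V0 VD VG) (Gy V V0 VD VG). Qed.
Lemma addspan_gen (M : zmodType) (G : M -> Prop) x : G x -> addspan G x.
Proof. by move=> Gx V _ _; apply. Qed.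

Lemma addspan_map (M N : zmodType) (G : M -> Prop) (G' : N -> Prop) (f : M -> N) x :
  f 0 = 0 -> {morph f : u v / u + v} ->
  (forall g, G g -> addspan G' (f g)) -> addspan G x -> addspan G' (f x).
Proof.
move=> f0 fD fG /(_ (fun y => addspan G' (f y))); apply=> //; first by rewrite f0; apply: addspan0.
by move=> u v Gu Gv; rewrite fD; apply: addspanD.
Qed.

Section Act.
Variables (H : ideal R) (M : lmodType R) (V : submod M).

Definition act_gen (x : M) := exists h y, [/\ H h, V y & x = h *: y].

Fact act_closed (a : R) u v :
  addspan act_gen u -> addspan act_gen v -> addspan act_gen (a *: u + v).
Proof.
move=> Gu Gv; apply: addspanD Gv.
apply: (addspan_map (f := *:%R a)) Gu; [exact: scaler0|exact: scalerDr|].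
move=> _ [h [y [Hh Vy ->]]]; apply: addspan_gen; exists (a * h), y.
by rewrite scalerA; split=> //; apply: idealMl.
Qed.

(** The submodule HV. The additive span is already stable under scalars because H absorbs
    multiplication on the left. *)
Definition act : submod M := Submod (addspan0 (G := act_gen)) act_closed.

Lemma act_in h y : H h -> V y -> act (h *: y).
Proof. by move=> Hh Vy; apply: addspan_gen; exists h, y. Qed.

Lemma act_ind (Q : M -> Prop) : Q 0 -> (forall u v, Q u -> Q v -> Q (u + v)) ->
  (forall h y, H h -> V y -> Q (h *: y)) -> forall x, act x -> Q x.
Proof.
by move=> Q0 QD QG x /(_ Q); apply=> // _ [h [y [Hh Vy ->]]]; apply: QG.
Qed.

Lemma act_sub_ind (W : submod M) :
  (forall h y, H h -> V y -> W (h *: y)) -> act `<=` W.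
Proof. by move=> HW; apply: act_ind => //; [apply: submod0 | apply: submodD]. Qed.

Lemma act_sub : act `<=` V.
Proof. by apply: act_sub_ind => h y _; apply: submodZ. Qed.

End Act.

Lemma act_mono (H H' : ideal R) M (V V' : submod M) :
  H `<=` H' -> V `<=` V' -> act H V `<=` act H' V'.
Proof.
by move=> HH' VV'; apply: act_sub_ind => h y /HH' Hh /VV' Vy; apply: act_in.
Qed.

Lemma act_map H M N (f : {linear M -> N}) (V : submod M) (W : submod N) :
  (forall x, V x -> W (f x)) -> forall x, act H V x -> act H W (f x).
Proof.
move=> VW; apply: (act_sub_ind (W := submod_preim f (act H W))) => h y Hh Vy /=.
by rewrite linearZ; apply: act_in => //; apply: VW.
Qed.

Fact orbit_map_linear M (x : M) : linear (fun a : R^o => (a : R) *: x).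
Proof. by move=> a u v; rewrite scalerDl scalerA. Qed.
Definition orbit_map M (x : M) : {linear R^o -> M} := mk_linear (orbit_map_linear x).

(* V = HV *)
Definition hfull H M (V : submod M) := forall x, V x -> act H V x.

(** H = HH, seen as fullness of the left ideal H, so that the lemmas on [hfull] apply to it. *)
Definition idem_ideal H := hfull H (ideal_left H).

(** For h in H and y in V, the map [orbit_map y] carries h, an element of HH, into H(HV). *)
Lemma act_hfull H M (V : submod M) : idem_ideal H -> hfull H (act H V).
Proof.
move=> Hid; apply: (act_sub_ind (W := act H (act H V))) => h y Hh Vy.
apply: (act_map (f := orbit_map y)) (Hid h Hh) => a /= Ha.
exact: act_in.
Qed.

Lemma hfull_map H M N (f : {linear M -> N}) (V : submod M) :
  hfull H V -> hfull H (submod_im f V).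
Proof. by move=> HV _ [x /HV Vx <-]; apply: act_map Vx => y Vy; exists y. Qed.

Lemma hfull_onto H M N (f : {linear M -> N}) : onto f ->
  hfull H (submod_full M) -> hfull H (submod_full N).
Proof.
by move=> fP HM y _; have [x <-] := fP y; apply: act_map (HM x I).
Qed.

Lemma hfull_submodP H M (V : submod M) :
  hfull H (submod_full (submod_type V)) <-> hfull H V.
Proof.
split=> HV x Vx.
  by apply: (act_map (f := sval_lin V)) (HV (to_submod Vx) I) => y _; apply: sval_linP.
have [w Hw wE] : submod_im (sval_lin V) (act H (submod_full _)) (sval_lin V x).
  apply: act_sub_ind (HV _ (sval_linP x)) => h y Hh Vy.
  by exists (h *: to_submod Vy); [apply: act_in | rewrite linearZ].
by rewrite -(sval_lin_inj wE).
Qed.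

End Submodules.

(** * Finite length and dual bases *)

Section FiniteLength.
Variable R : pzRingType.
Implicit Types M N L P : lmodType R.

(** Finite length without composition series: a strictly increasing numerical function on
    submodules. It pulls back along images and preimages, so submodules and quotients inherit it at
    once; its value at the top is an upper bound for the length. *)
Definition rank_function M (r : submod M -> nat) :=
  forall V W : submod M, V `<=` W -> ~ W `<=` V -> (r V < r W)%N.

Lemma rank_le M (r : submod M -> nat) (V W : submod M) :
  rank_function r -> V `<=` W -> (r V <= r W)%N.
Proof.
move=> rP VW; have [WV|WV] := pselect (W `<=` V); last exact/ltnW/rP.
by rewrite (submod_ext (W := W) (fun x => conj (VW x) (WV x))).
Qed.

Definition length_le M n :=
  exists2 r, @rank_function M r & (r (submod_full M) <= n)%N.

Definition finlen M := exists n, length_le M n.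

Lemma length_le_inj M N (f : {linear N -> M}) n :
  injective f -> length_le M n -> length_le N n.
Proof.
move=> fI [r rP rn]; exists (fun V => r (submod_im f V)).
  move=> V W VW WV; apply: rP => [_ [x Vx <-]|H]; first by exists x => //; apply: VW.
  by apply: WV => x Wx; have [|y Vy /fI <-] := H (f x); first by exists x.
exact: leq_trans (rank_le rP _) rn.
Qed.

(** A proper embedding lowers the bound strictly. This drives the induction in
    [trace_projective]. *)
Lemma length_lt_inj M N (f : {linear N -> M}) n :
  injective f -> ~ onto f -> length_le M n -> exists2 m, (m < n)%N & length_le N m.
Proof.
move=> fI fP [r rP rn]; exists (r (submod_im f (submod_full N))).
  apply: leq_trans rn; apply: rP => // H; apply: fP => y.
  by have [x _ <-] := H y I; exists x.
exists (fun V => r (submod_im f V)) => // V W VW WV; apply: rP.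
  by move=> _ [x Vx <-]; exists x => //; apply: VW.
by move=> H; apply: WV => x Wx; have [|y Vy /fI <-] := H (f x); first by exists x.
Qed.

Lemma finlen_inj M N (f : {linear N -> M}) : injective f -> finlen M -> finlen N.
Proof. by move=> fI [n Mn]; exists n; apply: (length_le_inj fI Mn). Qed.

Lemma finlen_sub M (V : submod M) : finlen M -> finlen (submod_type V).
Proof. exact/finlen_inj/(@sval_lin_inj _ _ V). Qed.

Lemma finlen_onto M N (g : {linear M -> N}) : onto g -> finlen M -> finlen N.
Proof.
move=> gP [n [r rP rn]]; exists n; exists (fun V => r (submod_preim g V)).
  move=> V W VW WV; apply: rP => [x|H]; first exact: VW.
  by apply: WV => y; have [x <-] := gP y; apply: H.
exact: leq_trans (rank_le rP _) rn.
Qed.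

Lemma finlen_quot M (V : submod M) : finlen M -> finlen (quotmod V).
Proof. exact/finlen_onto/(@qpi_onto _ _ V). Qed.

(** The rank of V is the rank of its intersection with the kernel plus the rank of its image; by the
    modular law one of the two grows strictly. *)
Lemma finlen_ext M N (g : {linear M -> N}) :
  finlen (submod_type (ker g)) -> finlen N -> finlen M.
Proof.
move=> [m [r rP _]] [n [s sP _]].
pose t V := (r (submod_preim (sval_lin (ker g)) V) + s (submod_im g V))%N.
exists (t (submod_full M)); exists t => // V W VW WV.
have iVW : submod_im g V `<=` submod_im g W.
  by move=> _ [x Vx <-]; exists x => //; apply: VW.
have pVW : submod_preim (sval_lin (ker g)) V `<=` submod_preim (sval_lin (ker g)) W.
  by move=> x; apply: VW.
have [WVi|WVi] := pselect (submod_im g W `<=` submod_im g V); last first.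
  by rewrite /t -addnS leq_add // ?rank_le //; apply: sP.
rewrite /t -addSn leq_add // ?rank_le //; apply: rP => // H; apply: WV.
apply: (submod_modular (N := ker g)) => // [x [Wx gx]|x Wx].
  by apply: (H (to_submod (V := ker g) gx)).
have [|v Vv gv] := WVi (g x); first by exists x.
by exists v => //=; rewrite linearB gv subrr.
Qed.

Lemma finlen_zero M : (forall x : M, x = 0) -> finlen M.
Proof.
move=> M0; exists 0%N; exists (fun=> 0%N) => // V W _ [] x _.
by rewrite (M0 x); apply: submod0.
Qed.

Lemma finlen_prod M N : finlen M -> finlen N -> finlen (M * N)%type.
Proof.
move=> Mf Nf; apply: (finlen_ext (g := @pair_snd R M N : {linear _ -> _})) => //.
pose f : {linear submod_type (ker (@pair_snd R M N)) -> M} :=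
  (@pair_fst R M N : {linear _ -> _}) \o sval_lin _.
apply: (finlen_inj (f := f)) Mf => x y xy; apply: sval_lin_inj.
have := sval_linP x; have := sval_linP y; move: xy; rewrite /f /=.
case: (val x) (val y) => [a b] [c d]; rewrite /pair_fst /pair_snd /=.
by move=> -> -> ->.
Qed.

Fact ffun_uncons_linear M m : linear (fun f : {ffun 'I_m.+1 -> M} =>
  (f ord0, [ffun i => f (lift ord0 i)]) : (M * {ffun 'I_m -> M})%type).
Proof. by move=> a u v; congr pair; [|apply/ffunP => i]; rewrite !ffunE. Qed.

Lemma finlen_ffun M m : finlen M -> finlen {ffun 'I_m -> M}.
Proof.
move=> Mf; elim: m => [|m IHm]; first by apply: finlen_zero => x; apply/ffunP => -[].
apply: (finlen_inj (f := mk_linear (@ffun_uncons_linear M m))); last exact: finlen_prod.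
move=> f g [] fg0 /ffunP fgS; apply/ffunP => i.
case: (unliftP ord0 i) => [j|] -> //.
by have := fgS j; rewrite !ffunE.
Qed.

Definition free_map_fun M m (x : 'I_m -> M) (c : {ffun 'I_m -> R^o}) : M :=
  \sum_i (c i : R) *: x i.
Fact free_map_linear M m (x : 'I_m -> M) : linear (free_map_fun x).
Proof.
move=> a u v; rewrite /free_map_fun scaler_sumr -big_split /=.
by apply: eq_bigr => i _; rewrite !ffunE scalerDl scalerA.
Qed.
Definition free_map M m (x : 'I_m -> M) : {linear {ffun 'I_m -> R^o} -> M} :=
  mk_linear (free_map_linear x).

Lemma free_mapE M m (x : 'I_m -> M) c : free_map x c = \sum_i (c i : R) *: x i.
Proof. by []. Qed.

Lemma fgP M : finitely_generated M <-> exists m (x : 'I_m -> M), onto (free_map x).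
Proof.
split=> [[s sP]|[m [x xP]]].
  exists (size s), (fun i : 'I_(size s) => s`_i) => y.
  have [c ->] := sP y; exists [ffun i : 'I_(size s) => c i].
  by rewrite free_mapE; apply: eq_bigr => i _; rewrite ffunE.
exists (mkseq (fun k => if insub k is Some i then x i else 0) m) => y.
have [c <-] := xP y; exists (fun k => if insub k is Some i then c i else 0).
rewrite free_mapE size_mkseq; apply: eq_bigr => i _.
by rewrite nth_mkseq // valK.
Qed.

Lemma finlen_fg M : finlen R^o -> finitely_generated M -> finlen M.
Proof.
by move=> Rf /fgP[m [x xP]]; apply: (finlen_onto xP); apply: finlen_ffun.
Qed.

Lemma rank_max M (Q : submod M -> Prop) (V0 : submod M) : finlen M -> Q V0 ->
  exists2 V, Q V & forall W, Q W -> V `<=` W -> W `<=` V.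
Proof.
move=> [n [r rP _]]; have [k] := ubnP (r (submod_full M) - r V0)%N.
elim: k V0 => // k IHk V; rewrite ltnS => Vk QV.
have [VM|] := pselect (forall W, Q W -> V `<=` W -> W `<=` V); first by exists V.
move=> /existsNP[W /not_implyP[QW /not_implyP[VW WV]]].
apply: (IHk W) => //; apply: leq_trans Vk; apply: ltn_sub2l; last exact: rP.
by apply: leq_trans (rP _ _ VW WV) _; apply: rank_le.
Qed.

Lemma rank_min M (Q : submod M -> Prop) (V0 : submod M) : finlen M -> Q V0 ->
  exists2 V, Q V & forall W, Q W -> W `<=` V -> V `<=` W.
Proof.
move=> [n [r rP _]]; have [k] := ubnP (r V0).
elim: k V0 => // k IHk V; rewrite ltnS => Vk QV.
have [VM|] := pselect (forall W, Q W -> W `<=` V -> V `<=` W); first by exists V.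
move=> /existsNP[W /not_implyP[QW /not_implyP[VW WV]]].
by apply: (IHk W) => //; apply: leq_trans Vk; apply: rP.
Qed.

Fact span_seq0 M (s : seq M) : exists c : nat -> R, 0 = \sum_(i < size s) c i *: s`_i.
Proof. by exists (fun=> 0); rewrite big1 // => i _; rewrite scale0r. Qed.
Fact span_seq_closed M (s : seq M) (a : R) u v :
  (exists c : nat -> R, u = \sum_(i < size s) c i *: s`_i) ->
  (exists c : nat -> R, v = \sum_(i < size s) c i *: s`_i) ->
  exists c : nat -> R, a *: u + v = \sum_(i < size s) c i *: s`_i.
Proof.
move=> [c ->] [d ->]; exists (fun i => a * c i + d i).
rewrite scaler_sumr -big_split; apply: eq_bigr => i _.
by rewrite scalerDl scalerA.
Qed.
Definition span_seq M (s : seq M) : submod M :=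
  Submod (span_seq0 s) (@span_seq_closed M s).

Lemma fg_finlen M : finlen M -> finitely_generated M.
Proof.
move=> Mf.
have [_ [s ->] smax] := rank_max (Q := fun V => exists s, V = span_seq s) Mf
  (ex_intro _ [::] erefl).
exists s => x; apply: (smax (span_seq (x :: s))); first by exists (x :: s).
  move=> y [c ->]; exists (fun i => if i is j.+1 then c j else 0).
  by rewrite big_ord_recl /= scale0r add0r.
exists (fun i => if i is j.+1 then 0 else 1).
by rewrite big_ord_recl /= scale1r big1 ?addr0 // => i _; rewrite scale0r.
Qed.

Lemma maximal_in_exists M (W : submod M) : finlen M -> (exists2 x, W x & x <> 0) ->
  exists V, maximal_in V W.
Proof.
move=> Mf [x Wx x0].
have [|V [VW WV] Vmax] := rank_max (Q := fun V => V `<=` W /\ ~ W `<=` V)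
  (V0 := submod_zero M) Mf.
  by split=> [y ->|H]; [apply: submod0 | apply: x0; apply: H].
exists V; split=> // U VU UW; have [WU|WU] := pselect (W `<=` U); first by right.
by left; apply: Vmax.
Qed.

Lemma simple_quot M (V : submod M) :
  maximal_in V (submod_full M) -> simple (quotmod V).
Proof.
move=> /maximal_in_simple; apply: simple_miso.
apply: (subquot_iso (g := qpi V \o sval_lin (submod_full M))).
  by move=> y; have [x <-] := qpi_onto y; exists (@to_submod _ _ (submod_full M) x I).
by move=> x; apply: qpi_eq0.
Qed.

Lemma simple_quot_exists M : finlen M -> (exists x : M, x <> 0) ->
  exists2 V : submod M, maximal_in V (submod_full M) & simple (quotmod V).
Proof.
move=> Mf [x x0]; have [|V Vmax] := maximal_in_exists (W := submod_full M) Mf.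
  by exists x.
by exists V => //; apply: simple_quot.
Qed.

(** Descends from M by [step] until 0 is reached; each step costs at least one unit of rank, so the
    descent ends. It serves both for composition series, where every submodule is good, and for
    filtrations by standard modules, where good means projective and full for an ideal. *)
Lemma filtration_exists M (good : submod M -> Prop) (Q : lmodType R -> Prop) :
  finlen M -> good (submod_full M) ->
  (forall V, good V -> (exists2 x, V x & x <> 0) ->
     exists V', [/\ good V', V' `<=` V, ~ V `<=` V' & Q (subquot V V')]) ->
  exists l (F : nat -> submod M),
    filtration l F /\ forall t, (t < l)%N -> Q (layer F t).
Proof.
move=> [n [r rP _]] gM step.
pose nz (V : submod M) := exists2 x, V x & x <> 0.
have /choice[next nextP] : forall V, exists V', good V -> nz V ->
    [/\ good V', V' `<=` V, ~ V `<=` V' & Q (subquot V V')].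
  move=> V; have [[gV nV]|H] := pselect (good V /\ nz V).
    by have [V' HV'] := step V gV nV; exists V'.
  by exists V => gV nV; case: H.
pose F t := iter t next (submod_full M).
have FP l : (forall t, (t < l)%N -> nz (F t)) ->
    good (F l) /\ (r (F l) + l <= r (submod_full M))%N.
  elim: l => [|l IHl] nzF; first by rewrite addn0.
  have [gl rl] := IHl (fun t tl => nzF t (ltnW tl)).
  have [g' le1 le2 _] := nextP _ gl (nzF l (leqnn _)).
  split=> //; apply: leq_trans rl; rewrite addnS -addSn leq_add2r.
  exact: rP.
have ex : exists l, `[< ~ nz (F l) >].
  have [H|/existsNP[l Hl]] := pselect (forall l, nz (F l)); last by exists l; apply/asboolP.
  have [_] := FP (r (submod_full M)).+1 (fun t _ => H t).
  by rewrite addnS ltnNge leq_addl.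
case: (ex_minnP ex) => l /asboolP Fl lmin.
have nzF t : (t < l)%N -> nz (F t).
  by move=> tl; apply: contrapT => /asboolP/lmin; rewrite leqNgt tl.
have stepF t : (t < l)%N -> F t.+1 `<=` F t /\ Q (layer F t).
  move=> tl; have [gt _] := FP t (fun s st => nzF s (ltn_trans st tl)).
  by have [_ ? _ ?] := nextP _ gt (nzF t tl).
exists l, F; split=> [|t /stepF[]//]; split=> [||t /stepF[]//].
  by apply/seteqP; split.
apply/seteqP; split=> [x Fx|x ->]; last exact: submod0.
by apply: contrapT => x0; apply: Fl; exists x.
Qed.

Lemma composition_exists M : finlen M ->
  exists l (F : nat -> submod M), composition_series l F.
Proof.
move=> Mf; apply: (filtration_exists (good := fun=> True)) => // V _ V0.
have [V' V'm] := maximal_in_exists Mf V0; have [? ? _] := V'm.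
by exists V'; split=> //; apply: maximal_in_simple.
Qed.

(** The last term of the filtration that contains the image of g gives a nonzero map into one layer.
    This is how a nonzero map out of a projective cover detects a composition factor. *)
Lemma filtration_hit P M (g : {linear P -> M}) l (F : nat -> submod M) :
  filtration l F -> (exists x, g x <> 0) ->
  exists t, [/\ (t < l)%N, forall x, F t (g x) &
    exists g' : {linear P -> layer F t},
      (forall x, g' x = 0 <-> F t.+1 (g x)) /\ exists x, g' x <> 0].
Proof.
move=> [F0 Fl _] [x0 gx0].
have ex : exists t, `[< ~ forall x, F t (g x) >].
  by exists l; apply/asboolP => /(_ x0); rewrite -[F l _]/((F l : set M) _) Fl.
case: (ex_minnP ex) => -[|t] /asboolP Ft tmin.
  by case: Ft => x; rewrite -[F _ _]/((F 0%N : set M) _) F0.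
have Ftg x : F t (g x).
  have [H|H] := pselect (forall x, F t (g x)); first exact: H.
  by have := tmin t; rewrite ltnn => /(_ (introT (asboolP _) H)).
have tl : (t < l)%N.
  apply: tmin; apply/asboolP => /(_ x0).
  by rewrite -[F l _]/((F l : set M) _) Fl.
have [g1 g1P] := factor_inj (g := sval_lin (F t)) (f := g) (@sval_lin_inj _ _ _)
  (fun x => ex_intro _ (to_submod (Ftg x)) erefl).
have gP x : qpi (submod_trace (F t) (F t.+1)) (g1 x) = 0 <-> F t.+1 (g x).
  by rewrite -g1P; apply: qpi_eq0.
exists t; split=> //; exists (qpi (submod_trace (F t) (F t.+1)) \o g1).
split=> //; move/existsNP: Ft => [x Fx]; exists x => gx.
by apply: Fx; apply/gP.
Qed.

Lemma onto_endo_inj M (f : {linear M -> M}) : finlen M -> onto f -> injective f.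
Proof.
move=> [n [r rP _]] fP; apply: inj_ker0 => x fx; apply: contrapT => x0.
(* [K k] is the kernel of the k-th iterate of f. If f is onto and not injective these kernels grow
   strictly for ever. *)
pose K k := iter k (submod_preim f) (submod_zero M).
have Kle k : K k `<=` K k.+1.
  elim: k => [y ->|k IHk y]; first exact: submod0.
  exact: IHk.
have Kn k : ~ K k.+1 `<=` K k.
  elim: k => [|k IHk] H; first by apply: x0; apply: H; rewrite /= fx.
  by apply: IHk => y; have [z <-] := fP y; apply: H.
have rK k : (k <= r (K k))%N.
  by elim: k => // k IHk; apply: leq_ltn_trans IHk _; apply: rP.
have := rK (r (submod_full M)).+1.
by rewrite ltnNge rank_le.
Qed.

(** * Dual bases and projective covers *)

Definition dual_basis M := exists m (x : 'I_m -> M) (v : 'I_m -> {linear M -> R^o}),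
  forall y, y = \sum_k (v k y : R) *: x k.

Fact coord_map_linear m (i : 'I_m) : linear (fun c : {ffun 'I_m -> R^o} => c i).
Proof. by move=> a u v; rewrite !ffunE. Qed.
Definition coord_map m (i : 'I_m) : {linear {ffun 'I_m -> R^o} -> R^o} :=
  mk_linear (coord_map_linear i).

Lemma dual_basisP M : dual_basis M <-> finitely_generated M /\ projective M.
Proof.
split=> [[m [x [v xv]]]|[/fgP[m [x xP]] Mp]].
  split.
    apply/fgP; exists m, x => y; exists [ffun k => v k y].
    by rewrite free_mapE [RHS]xv; apply: eq_bigr => k _; rewrite ffunE.
  move=> N L g f gP; have [z zP] := choice (fun k => gP (f (x k))).
  have hl : linear (fun y => \sum_k (v k y : R) *: z k).
    move=> a s t; rewrite scaler_sumr -big_split; apply: eq_bigr => k _.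
    by rewrite linearP scalerDl scalerA.
  exists (mk_linear hl) => y /=; rewrite linear_sum [in RHS](xv y) linear_sum.
  by apply: eq_bigr => k _; rewrite !linearZ zP.
have [h hP] := Mp _ _ (free_map x) (idfun : {linear M -> M}) xP.
exists m, x, (fun k => coord_map k \o h) => y.
by rewrite -[LHS]hP free_mapE.
Qed.

Lemma dual_basis_retract M N : retract M N -> dual_basis N -> dual_basis M.
Proof.
move=> [i [p ip]] [m [x [v xv]]]; exists m, (fun k => p (x k)).
exists (fun k => v k \o i) => y.
rewrite -[LHS]ip (xv (i y)) linear_sum; apply: eq_bigr => k _.
by rewrite linearZ.
Qed.

Lemma dual_basis_prod M N : dual_basis M -> dual_basis N -> dual_basis (M * N)%type.
Proof.
move=> /dual_basisP[fM pM] /dual_basisP[fN pN]; apply/dual_basisP.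
by split; [apply: fg_pair | apply: projective_pair].
Qed.

Lemma dual_basis_ring : dual_basis R^o.
Proof.
exists 1%N, (fun=> 1), (fun=> (idfun : {linear R^o -> R^o})) => y.
by rewrite big_ord1; apply: (esym (mulr1 (y : R))).
Qed.

Lemma dual_basis_ffun M m : dual_basis M -> dual_basis {ffun 'I_m -> M}.
Proof.
move=> Mb; elim: m => [|m IHm].
  by exists 0%N, (fun=> 0), (fun=> \0) => y; apply/ffunP => -[].
apply: dual_basis_retract (dual_basis_prod Mb IHm).
exists (mk_linear (@ffun_uncons_linear M m)).
have cl : linear (fun y : (M * {ffun 'I_m -> M})%type =>
    [ffun i => if unlift ord0 i is Some j then y.2 j else y.1] : {ffun 'I_m.+1 -> M}).
  by move=> a u v; apply/ffunP => i; rewrite !ffunE; case: unlift => // j; rewrite !ffunE.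
exists (mk_linear cl) => f; apply/ffunP => i; rewrite ffunE /=.
by case: (unliftP ord0 i) => [j|] -> //; rewrite ffunE.
Qed.

Lemma split_onto P M (g : {linear M -> P}) : projective P -> onto g ->
  exists h : {linear P -> M}, forall x, g (h x) = x.
Proof. by move=> pP gP; apply: (pP _ _ g (idfun : {linear P -> P}) gP). Qed.

Lemma projective_cover_exists (S : lmodType R) : finlen R^o -> simple S ->
  exists P, projective_cover P S.
Proof.
move=> Rf sS; have [x x0] := simple_neq0 sS.
have pP : onto (orbit_map x).
  by apply: simple_onto => //; exists 1; rewrite /= scale1r.
pose Q (U : submod R^o) := forall y, exists2 u, U u & orbit_map x u = y.
have [|U QU Umin] := rank_min (Q := Q) (V0 := submod_full R^o) Rf.
  by move=> y; have [a <-] := pP y; exists a.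
pose p := orbit_map x \o sval_lin U.
have pU : onto p by move=> y; have [u Uu <-] := QU y; exists (to_submod Uu).
have [_ pR] := proj1 (dual_basisP R^o) dual_basis_ring.
have [h hP] := pR _ _ p (orbit_map x) pU.
(* h lifts the map from R to S through U. Restricted to U it is onto by minimality, hence injective
   by finite length, and inverting it yields a retraction of R onto U. *)
have hU : onto (h \o sval_lin U).
  move=> u; pose W := submod_im (sval_lin U \o h) U.
  have [||w Uw wE] := Umin W _ _ (sval_lin U u) (sval_linP u).
  - move=> y; have [w Uw <-] := QU y; exists (sval_lin U (h w)); first by exists w.
    exact: hP.
  - by move=> _ [w _ <-]; apply: sval_linP.
  by exists (to_submod Uw); apply: sval_lin_inj; rewrite -wE.
have hI := onto_endo_inj (finlen_sub U Rf) hU.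
have [k kP] := factor_inj (f := h) hI (fun y => hU (h y)).
have rU : retract (submod_type U) R^o.
  by exists (sval_lin U), k => u; apply: hI; apply: kP.
have [fU prU] := proj1 (dual_basisP _) (dual_basis_retract rU dual_basis_ring).
exists (submod_type U); split=> //; split=> //; exists p; split=> // W WP u.
have [||w Ww wE] := Umin (submod_im (sval_lin U) W) _ _ (sval_lin U u) (sval_linP u).
- move=> y; have [w <-] := pU y; have [v Wv] := WP w.
  rewrite linearB => /subr0_eq E.
  by exists (sval_lin U v) => //; exists v.
- by move=> _ [w _ <-]; apply: sval_linP.
by rewrite -(sval_lin_inj wE).
Qed.

End FiniteLength.

(** * Artin algebras have finite length *)

Section ArtinianRing.
Variables (k : comPzRingType) (kA : artinian k).
Implicit Types I J V W : submod k^o.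

Lemma artinian_min (Q : submod k^o -> Prop) V0 : Q V0 ->
  exists2 V, Q V & forall W, Q W -> W `<=` V -> V `<=` W.
Proof.
move=> QV0; apply: contrapT => H.
have /choice[next nextP] : forall V : {V | Q V}, exists W : {W | Q W},
    sval W `<=` sval V /\ ~ sval V `<=` sval W.
  move=> [V QV]; apply: contrapT => HV; apply: H; exists V => // W QW WV.
  by apply: contrapT => VW; apply: HV; exists (exist _ W QW).
pose N n := sval (iter n next (exist _ V0 QV0)).
have [|m Nm] := kA (N := N); first by move=> n; case: (nextP (iter n next (exist _ V0 QV0))).
have [_ []] := nextP (iter m next (exist _ V0 QV0)).
by have := Nm m.+1 (leqnSn m); rewrite /N /= => ->.
Qed.

(* k/I has finite length. *)
Definition colength_finite I := exists r : submod k^o -> nat,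
  forall V W, I `<=` V -> V `<=` W -> ~ W `<=` V -> (r V < r W)%N.

Lemma colength_rank_le I (r : submod k^o -> nat) :
  (forall V W, I `<=` V -> V `<=` W -> ~ W `<=` V -> (r V < r W)%N) ->
  forall V W, I `<=` V -> V `<=` W -> (r V <= r W)%N.
Proof.
move=> rP V W IV VW; have [WV|WV] := pselect (W `<=` V); last exact/ltnW/rP.
by rewrite (submod_ext (W := W) (fun x => conj (VW x) (WV x))).
Qed.

Lemma colength_finite_max I : maximal_in I (submod_full k^o) -> colength_finite I.
Proof.
move=> [_ _ Im]; exists (fun V => if `[< submod_full k^o `<=` V >] then 1 else 0)%N.
move=> V W IV VW WV; case: asboolP => [fV|_]; first by case: WV => x _; apply: fV.
case: asboolP => // fW; case: WV; case: (Im W) => // [x /IV/VW //|WI] x.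
by move/WI/IV.
Qed.

Lemma submod_add_mono V V' W : V `<=` V' -> submod_add V W `<=` submod_add V' W.
Proof. by move=> VV' x [v /VV' Vv Wx]; exists v. Qed.

(** The first summand measures the image of W in k/I. The second measures the part of W inside I
    through the embedding of I/(I cap J) into k/J. *)
Lemma colength_finite_cap I J :
  colength_finite I -> colength_finite J -> colength_finite (submod_cap I J).
Proof.
move=> [r rP] [s sP].
exists (fun W => r (submod_add W I) + s (submod_add (submod_cap W I) J))%N.
move=> V W IJV VW WV.
have le1 := submod_add_mono (W := I) VW.
have VWI : submod_cap V I `<=` submod_cap W I by move=> x [/VW].
have le2 := submod_add_mono (W := J) VWI.
have [WVi|WVi] := pselect (submod_add W I `<=` submod_add V I); last first.
  rewrite -addSn leq_add //; first by apply: rP => //; apply: submod_addr.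
  by apply: (colength_rank_le sP) => //; apply: submod_addr.
rewrite -addnS leq_add //.
  by apply: (colength_rank_le rP) => //; apply: submod_addr.
apply: sP => // [|H]; first exact: submod_addr.
apply: WV; apply: (submod_modular (N := I)) => // [x [Wx Ix]|x Wx].
  have [v [Vv Iv] Jxv] := H x (@submod_addl _ _ (submod_cap W I) J x (conj Wx Ix)).
  rewrite -(subrK v x); apply: submodD => //; apply: IJV; split=> //.
  exact: submodB.
exact/WVi/submod_addl.
Qed.

(** Between V and I there is nothing else, so one extra unit, counting whether W contains I, is
    enough. *)
Lemma colength_finite_step I V :
  colength_finite I -> maximal_in V I -> colength_finite V.
Proof.
move=> [r rP] [VI _ Vm].
exists (fun W => r (submod_add W I) + if `[< I `<=` W >] then 1 else 0)%N.
move=> U W VU UW WU; have le1 := submod_add_mono (W := I) UW.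
have [WUi|WUi] := pselect (submod_add W I `<=` submod_add U I); last first.
  rewrite -addSn leq_add //; first by apply: rP => //; apply: submod_addr.
  case: asboolP => [IU|]; last by case: asboolP.
  by case: asboolP => // -[] x /IU/UW.
rewrite -addnS leq_add //.
  by apply: (colength_rank_le rP) => //; apply: submod_addr.
have nIU : ~ submod_cap W I `<=` U.
  move=> H; apply: WU; apply: (submod_modular (N := I)) => // x Wx.
  exact/WUi/submod_addl.
case: asboolP => [IU|_]; first by case: nIU => x [_ /IU].
case: asboolP => // -[].
case: (Vm (submod_cap W I)) => [x Vx|x []//|WV|IW x Ix].
- by split; [apply/UW/VU | apply: VI].
- by case: nIU => x /WV/VU.
- by case: (IW x Ix).
Qed.

(** Let I be minimal among the ideals of finite colength; closure under intersection makes it the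
    least one. It has no maximal subideal, which forces I = mI for every maximal ideal m, then I =
    II, and finally I = 0 because I lies in the Jacobson radical. *)
Lemma finlen_artinian : finlen k^o.
Proof.
have [|I If Imin] := artinian_min (Q := colength_finite) (V0 := submod_full k^o).
  by exists (fun=> 0%N) => V W fV _ [] x _; apply: fV.
have Ileast J : colength_finite J -> I `<=` J.
  move=> Jf x Ix; have [|_ //] := Imin _ (colength_finite_cap If Jf) _ x Ix.
  by move=> y [].
have nomax V : ~ maximal_in V I.
  move=> Vm; have [VI IV _] := Vm; apply: IV; apply: Imin => //.
  exact: colength_finite_step Vm.
pose mulset (X Y : k -> Prop) := addspan (fun z : k => exists x y, [/\ X x, Y y & z = x * y]).
have mulset_submod (X : k -> Prop) V : exists W, forall x, W x <-> mulset X V x.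
  suff H (a u v : k) : mulset X V u -> mulset X V v -> mulset X V (a * u + v).
    by exists (@Submod k k^o (mulset X V) (addspan0 (G := _)) H).
  move=> Xu Xv; apply: addspanD => //.
  apply: (addspan_map (f := *%R a)) Xu; [exact: mulr0|exact: mulrDr|].
  move=> _ [x [y [Xx Vy ->]]]; apply: addspan_gen; exists x, (a * y).
  by rewrite mulrCA; split=> //; apply: (submodZ (a : k) Vy).
(* If some x in I were outside mI, then I/mI would be a nonzero vector space over the field k/m, and
   a hyperplane avoiding x would be a maximal subideal of I. The hypothesis on m says that k/m is a
   field, in the form in which it is used. *)
have Imul (m : k -> Prop) :
    (forall a, m a \/ exists b, m (1 - b * a)) -> forall x, I x -> mulset m I x.
  move=> mP x Ix; apply: contrapT => nx.
  have [X XP] := mulset_submod m I.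
  have [W [XW Wx] Wmax] := submod_zorn (V := X) (x := x : k^o) (fun h => nx (proj1 (XP x) h)).
  have WI y : I y -> exists2 w, W w & exists a : k, x = w + a * y \/ y = w + a * x.
    move=> Iy; have [Wy|Wy] := pselect (W y).
      by exists y => //; exists 0; right; rewrite mul0r addr0.
    have [w Ww [a aE]] : submod_add W (cyc (y : k^o)) x.
      apply: contrapT => H; apply: Wy; apply: (Wmax (submod_add W (cyc (y : k^o)))) => //.
        exact: submod_addl.
      exact/submod_addr/cyc_id.
    by exists w => //; exists a; left; rewrite -[a * y]aE addrC subrK.
  have mW a y : m a -> I y -> W (a * y).
    by move=> ma Iy; apply/XW/XP; apply: addspan_gen; exists a, y.
  have WI' y : I y -> exists2 w, W w & exists a : k, y = w + a * x.
    move=> Iy; have [w Ww [a [xE|yE]]] := WI y Iy; last by exists w => //; exists a.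
    case: (mP a) => [ma|[b mb]].
      by case: Wx; rewrite xE; apply: submodD => //; apply: mW.
    exists ((1 - b * a) * y - b * w); last first.
      by exists b; rewrite xE mulrDr addrA subrK mulrBl mul1r mulrA subrK.
    by apply: submodB; [apply: mW | apply: (submodZ (b : k) Ww)].
  apply: (nomax (submod_cap W I)); split=> [y []//|H|U WU UI].
    by apply: Wx; case: (H x Ix).
  have [Ux|Ux] := pselect (U x).
    right=> y Iy; have [w Ww [a yE]] := WI' y Iy; rewrite yE.
    have Iw : I w.
      have -> : w = y - a * x by rewrite yE addrK.
      by apply: submodB => //; apply: (submodZ (a : k) Ix).
    by apply: submodD; [apply: WU | apply: (submodZ (a : k) Ux)].
  left=> y Uy; split; last exact: UI.
  have [w Ww [a [xE|yE]]] := WI y (UI y Uy).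
    case: Ux; rewrite xE; have ay : U (a * y) by apply: (submodZ (a : k) Uy).
    apply: submodD => //; apply: WU; split=> //.
    have -> : w = x - a * y by rewrite xE addrK.
    by apply: submodB => //; apply: UI.
  have Iw : I w.
    have -> : w = y - a * x by rewrite yE addrK.
    by apply: submodB; [apply: UI | apply: (submodZ (a : k) Ix)].
  have Uax : U (a * x).
    have -> : a * x = y - w by rewrite yE addrC addKr.
    by apply: submodB => //; apply: WU.
  case: (mP a) => [ma|[b mb]].
    by rewrite yE; apply: submodD => //; apply: mW.
  case: Ux; have -> : x = (1 - b * a) * x + b * (a * x) by rewrite mulrA -mulrDl subrK mul1r.
  apply: submodD; last exact: (submodZ (b : k) Uax).
  by apply: WU; split; [apply: mW | apply: (submodZ ((1 - b * a) : k) Ix)].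
(* W is minimal above I with I contained in WI. If W were larger than I, choose W' maximal in W
   above I and let m be the annihilator of W/W'; then I = mI lies in (mW)I, hence in W'I, against
   minimality. *)
have II i : I i -> mulset I I i.
  have [|W [IW IWI] Wmin] := artinian_min
    (Q := fun W => I `<=` W /\ forall x, I x -> mulset W I x) (V0 := submod_full k^o).
    by split=> // y Iy; apply: addspan_gen; exists 1, y; rewrite mul1r.
  have [WI|WI] := pselect (W `<=` I).
    by move=> /IWI; apply: (addspan_map (f := id)) => // _ [a [b [/WI Ia Ib ->]]];
      apply: addspan_gen; exists a, b.
  have [r rP] := If.
  have [W' [IW' W'W WW'] W'max] : exists2 W' : submod k^o, [/\ I `<=` W', W' `<=` W & ~ W `<=` W'] &
      forall U : submod k^o, W' `<=` U -> U `<=` W -> ~ W `<=` U -> U `<=` W'.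
    suff : forall n V, (r W - r V < n)%N -> I `<=` V -> V `<=` W -> ~ W `<=` V ->
      exists2 W' : submod k^o, [/\ I `<=` W', W' `<=` W & ~ W `<=` W'] &
      forall U : submod k^o, W' `<=` U -> U `<=` W -> ~ W `<=` U -> U `<=` W'.
      by move=> H; apply: (H _ I (ltnSn _)).
    elim=> // n IHn V; rewrite ltnS => Vn IV VW WV.
    have [H|] := pselect (forall U : submod k^o, V `<=` U -> U `<=` W -> ~ W `<=` U -> U `<=` V).
      by exists V.
    move=> /existsNP[U /not_implyP[VU /not_implyP[UW /not_implyP[WU UV]]]].
    apply: (IHn U) => //; last by move=> y /IV/VU.
    apply: leq_trans Vn; apply: ltn_sub2l; last exact: rP.
    by apply: (rP V W).
  have /existsNP[x /not_implyP[Wx W'x]] := WW'.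
  have Wgen y : W y -> exists2 w, W' w & exists a : k, y = w + a * x.
    move=> Wy; have [w W'w [a aE]] : submod_add W' (cyc (x : k^o)) y.
      have [H|H] := pselect (W `<=` submod_add W' (cyc (x : k^o))); first exact: H.
      case: W'x; apply: (W'max (submod_add W' (cyc (x : k^o)))) => //.
      + exact: submod_addl.
      + move=> z [w /W'W Ww [a aE]]; rewrite -(subrK w z) aE.
        by apply: submodD => //; apply: (submodZ (a : k) Wx).
      + exact/submod_addr/cyc_id.
    by exists w => //; exists a; rewrite -[a * x]aE addrC subrK.
  pose m a := W' (a * x).
  have mmax a : m a \/ exists b, m (1 - b * a).
    have [ma|ma] := pselect (m a); [by left|right].
    have [H|H] := pselect (submod_add W' (cyc (a * x : k^o)) x).
      have [w W'w [b bE]] := H; exists b; rewrite /m mulrBl mul1r -mulrA.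
      by rewrite -[b * (a * x)]bE subKr.
    case: ma; apply: (W'max (submod_add W' (cyc (a * x : k^o)))) => //.
    + exact: submod_addl.
    + move=> z [w /W'W Ww [b bE]]; rewrite -(subrK w z) bE.
      by apply: submodD => //; apply: (submodZ (b : k) (submodZ (a : k) Wx)).
    + by move=> HW; apply/H/HW.
    + exact/submod_addr/cyc_id.
  have mW a y : m a -> W y -> W' (a * y).
    move=> ma /Wgen[w W'w [b ->]]; rewrite mulrDr; apply: submodD.
      exact: (submodZ (a : k) W'w).
    by rewrite mulrCA; apply: (submodZ (b : k) ma).
  case: WW'; apply: Wmin => //; split=> // y Iy.
  apply: (addspan_map (f := id)) (Imul m mmax y Iy) => // _ [a [z [ma Iz ->]]].
  apply: (addspan_map (f := *%R a)) (IWI z Iz); [exact: mulr0|exact: mulrDr|].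
  move=> _ [b [c [Wb Ic ->]]]; apply: addspan_gen; exists (a * b), c.
  by rewrite mulrA; split=> //; apply: mW.
have I0 x : I x -> x = 0.
  move=> Ix; apply: contrapT => x0.
  (* L is minimal with LI nonzero, and z in L satisfies zI nonzero. Since I = II, the ideal zI
     qualifies as well, so it is all of L and z = zi for some i in I. *)
  have [|L [z [y [Lz Iy zy0]]] Lmin] := artinian_min
    (Q := fun L => exists x y, [/\ L x, I y & x * y <> 0]) (V0 := submod_full k^o).
    by exists 1, x; rewrite mul1r.
  have zl : linear (fun i : k^o => (z * i : k) : k^o).
    by move=> a u v; rewrite mulrDr /= [z * (a *: u)]mulrCA.
  have [||i Ii zi] := Lmin (submod_im (mk_linear zl) I) _ _ z Lz.
  - apply: contrapT => H; apply: zy0.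
    have H' : forall t, mulset I I t -> z * t = 0.
      move=> t /(_ (fun t => z * t = 0)); apply; first exact: mulr0.
        by move=> u v zu zv; rewrite mulrDr zu zv addr0.
      move=> _ [a [b [Ia Ib ->]]]; apply: contrapT => zab; apply: H.
      by exists (z * a), b; split=> //; [exists a | rewrite -mulrA].
    by apply: H'; apply: II.
  - by move=> _ [i Ii <-] /=; rewrite mulrC; apply: (submodZ (i : k) Lz).
  move: zi => /= zi; apply: zy0.
  (* Every maximal ideal has finite colength and so contains I; hence 1 - i lies in no maximal
     ideal, and z(1 - i) = 0 forces z = 0. *)
  have [b bE] : exists b : k, 1 = b * (1 - i).
    apply: contrapT => H.
    have [|m cm mm] := @submod_zorn_maximal k (cyc (1 - i : k^o)); first exact: H.
    have mi : m i by apply: (Ileast _ (colength_finite_max mm)).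
    have [_ nm _] := mm; apply: nm => a _; rewrite -[a]mulr1.
    apply: (submodZ (a : k)); rewrite -(subrK i 1); apply: submodD => //.
    exact/cm/cyc_id.
  have -> : z = b * (z - z * i) by rewrite -{1}[z]mul1r bE -mulrA mulrBl mul1r [i * z]mulrC.
  by rewrite zi subrr mulr0 mul0r.
have [r rP] := If; exists (r (submod_full k^o)); exists r => // V W VW.
by apply: rP => // x /I0 ->; apply: submod0.
Qed.

End ArtinianRing.

(** A is a k-linear image of a finite free k-module, and one-sided ideals pull back to k-submodules;
    centrality of the image of k takes care of the right ideals. *)
Lemma finlen_artin (A : pzRingType) : artin_algebra A ->
  finlen A^o /\ finlen (A^c)^o.
Proof.
move=> [k [phi [kA phiC [s sP]]]].
have [n [r rP _]] := finlen_ffun (size s) (finlen_artinian kA).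
pose f (c : {ffun 'I_(size s) -> k^o}) : A := \sum_i phi (c i : k) * s`_i.
have fP a : exists c, f c = a.
  have [c ->] := sP a; exists [ffun i : 'I_(size s) => c i].
  by apply: eq_bigr => i _; rewrite ffunE.
have fl a u v : f (a *: u + v) = phi a * f u + f v.
  rewrite mulr_sumr -big_split; apply: eq_bigr => i _.
  by rewrite !ffunE raddfD mulrDl mulrA -rmorphM.
have f0 : f 0 = 0 by rewrite /f big1 // => i _; rewrite ffunE raddf0 mul0r.
split.
  have H (V : submod A^o) : exists W : submod {ffun 'I_(size s) -> k^o},
      forall c, W c <-> V (f c).
    have V0 : V (f 0) by rewrite f0; apply: submod0.
    have VP a u v : V (f u) -> V (f v) -> V (f (a *: u + v)).
      by move=> Vu Vv; rewrite fl; apply: (submodP (phi a : A) Vu Vv).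
    by exists (Submod (submod_set := fun c => V (f c)) V0 VP).
  have [g gP] := choice H; exists (r (g (submod_full A^o))); exists (r \o g) => // V W VW WV.
  apply: rP => [c /gP Vc|H']; first exact/gP/VW.
  by apply: WV => a; have [c <-] := fP a => Wc; apply/gP/H'/gP.
have H (V : submod (A^c)^o) : exists W : submod {ffun 'I_(size s) -> k^o},
    forall c, W c <-> V (f c).
  have V0 : V (f 0) by rewrite f0; apply: submod0.
  have VP a u v : V (f u) -> V (f v) -> V (f (a *: u + v)).
    by move=> Vu Vv; rewrite fl phiC; apply: (submodP (phi a : A^c) Vu Vv).
  by exists (Submod (submod_set := fun c => V (f c)) V0 VP).
have [g gP] := choice H; exists (r (g (submod_full (A^c)^o))); exists (r \o g) => // V W VW WV.
apply: rP => [c /gP Vc|H']; first exact/gP/VW.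
by apply: WV => a; have [c <-] := fP a => Wc; apply/gP/H'/gP.
Qed.

(** * Projective ideals and radicals modulo ideals *)

Section Ideals.
Variable R : pzRingType.
Implicit Types H K : ideal R.

Lemma ideal_ext H K : (forall x, H x <-> K x) -> H = K.
Proof.
case: H K => [H H0 HB Hl Hr] [K K0 KB Kl Kr] /= HK.
have E : H = K by apply/funext => x; apply/propext.
move: H0 HB Hl Hr; rewrite {}E => H0 HB Hl Hr.
by rewrite (Prop_irrelevance H0 K0) (Prop_irrelevance HB KB)
  (Prop_irrelevance Hl Kl) (Prop_irrelevance Hr Kr).
Qed.

Lemma ideal_sum H m (x : 'I_m -> R) : (forall i, H (x i)) -> H (\sum_i x i).
Proof. by move=> Hx; elim/big_ind: _ => //; [apply: ideal0 | apply: idealD]. Qed.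

(** A dual basis of H as a left ideal. The coordinates are total functions on the ring constrained
    only on H, so that no submodule type occurs and [dualL] of the opposite ideal is [dualR] by
    conversion. *)
Definition dualL H := exists m (h : 'I_m -> R) (phi : 'I_m -> R -> R),
  [/\ forall j, H (h j),
      forall j x y, H x -> H y -> phi j (x + y) = phi j x + phi j y,
      forall j a x, H x -> phi j (a * x) = a * phi j x &
      forall x, H x -> x = \sum_j phi j x * h j].

Definition dualR H := exists m (h : 'I_m -> R) (phi : 'I_m -> R -> R),
  [/\ forall j, H (h j),
      forall j x y, H x -> H y -> phi j (x + y) = phi j x + phi j y,
      forall j a x, H x -> phi j (x * a) = phi j x * a &
      forall x, H x -> x = \sum_j h j * phi j x].

Lemma dualLP H : dualL H <-> dual_basis (submod_type (ideal_left H)).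
Proof.
split=> [[m [h [phi [Hh phiD phiM hphi]]]]|[m [x [v xv]]]].
  have vl j : linear (fun y => phi j (sval_lin (ideal_left H) y) : R^o).
    move=> a u w; have Hu := sval_linP u; have Hw := sval_linP w.
    by rewrite linearP phiD ?phiM //; apply: idealMl.
  exists m, (fun j => to_submod (V := ideal_left H) (Hh j)), (fun j => mk_linear (vl j)).
  move=> y; apply: sval_lin_inj; rewrite linear_sum [LHS]hphi; last exact: sval_linP.
  by apply: eq_bigr => j _; rewrite linearZ.
exists m, (fun j => sval_lin _ (x j)).
exists (fun j y => if pselect (H y) is left Hy
                   then v j (to_submod (V := ideal_left H) Hy) else 0).
split.
- by move=> j; apply: (sval_linP (x j)).
- move=> j y z Hy Hz; case: pselect => [Hyz|[]]; last exact: idealD.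
  case: pselect => // Hy'; case: pselect => // Hz'.
  by rewrite -linearD; congr (v j _); apply: sval_lin_inj.
- move=> j a y Hy; case: pselect => [Hay|[]]; last exact: idealMl.
  case: pselect => // Hy'.
  have -> : to_submod (V := ideal_left H) Hay = a *: to_submod (V := ideal_left H) Hy'.
    exact: sval_lin_inj.
  by rewrite linearZ.
- move=> y Hy; have := congr1 (sval_lin _) (xv (to_submod (V := ideal_left H) Hy)).
  rewrite linear_sum to_submodK => {1}->; apply: eq_bigr => j _.
  rewrite linearZ; case: pselect => // Hy'.
  by rewrite (Prop_irrelevance Hy' Hy).
Qed.

(* x lies in the Jacobson radical modulo K. *)
Definition rad_mod K (x : R) := forall a, exists b,
  K (1 - (1 - a * x) * b) /\ K (1 - b * (1 - a * x)).

Definition radcond H K :=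
  forall x j y, H x -> rad_mod K j -> H y -> K (x * j * y).

(* If 1 - uv is invertible modulo K with inverse b, then so is 1 - vu, with
   inverse 1 + vbu. *)
Lemma quasi_inverseL (u v b : R) :
  1 - (1 - v * u) * (1 + v * b * u) = v * (1 - (1 - u * v) * b) * u.
Proof.
have -> : v * (1 - (1 - u * v) * b) * u = v * u - (1 - v * u) * (v * b * u).
  by rewrite !(mulrBl, mulrBr, mul1r, mulr1, mulrA).
by rewrite mulrDr mulr1 opprD addrA subKr.
Qed.

Lemma quasi_inverseR (u v b : R) :
  1 - (1 + v * b * u) * (1 - v * u) = v * (1 - b * (1 - u * v)) * u.
Proof.
have -> : v * (1 - b * (1 - u * v)) * u = v * u - (v * b * u) * (1 - v * u).
  by rewrite !(mulrBl, mulrBr, mul1r, mulr1, mulrA).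
by rewrite mulrDl mul1r opprD addrA subKr.
Qed.

(** Left-right symmetry of the Jacobson radical modulo K. It makes the radical condition invariant
    under passage to the opposite ring. *)
Lemma rad_mod_sym K x : rad_mod K x <-> forall a, exists b,
  K (1 - (1 - x * a) * b) /\ K (1 - b * (1 - x * a)).
Proof.
split=> H a; have [b [Kl Kr]] := H a.
  exists (1 + x * b * a); rewrite quasi_inverseL quasi_inverseR.
  by split; apply/idealMr/idealMl.
exists (1 + a * b * x); rewrite quasi_inverseL quasi_inverseR.
by split; apply/idealMr/idealMl.
Qed.

Lemma setmulP (X Y : set R) z :
  setmul X Y z <-> addspan (fun t => exists x y, [/\ X x, Y y & t = x * y]) z.
Proof.
split=> [[m [x [y [Xx Yy ->]]]]|].
  elim/big_ind: _ => [|u v|i _]; [exact: addspan0|exact: addspanD|].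
  by apply: addspan_gen; exists (x i), (y i).
move/(_ (setmul X Y)); apply.
- exists 0%N, (fun=> 0), (fun=> 0).
  by split=> [[]//|[]//|]; rewrite big_ord0.
- move=> _ _ [m [x [y [Xx Yy ->]]]] [n [x' [y' [Xx' Yy' ->]]]].
  exists (m + n)%N.
  exists (fun i => match fintype.split i with inl a => x a | inr b => x' b end).
  exists (fun i => match fintype.split i with inl a => y a | inr b => y' b end).
  split=> [i|i|]; try by case: fintype.split.
  rewrite big_split_ord; congr (_ + _); apply: eq_bigr => i _.
    by rewrite -[lshift n i]/(unsplit (inl i)) unsplitK.
  by rewrite -[rshift m i]/(unsplit (inr i)) unsplitK.
- move=> _ [x [y [Xx Yy ->]]]; exists 1%N, (fun=> x), (fun=> y).
  by split=> //; rewrite big_ord1.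
Qed.

Lemma idem_idealP H : idem_ideal H <-> setmul H H = H.
Proof.
split=> [Hid|E x Hx].
  apply/seteqP; split=> [x [m [y [z [Hy _ ->]]]]|x Hx].
    by apply: ideal_sum => i; apply/idealMr.
  apply/setmulP; apply: (addspan_map (f := id)) (Hid x Hx) => // _ [h [y [Hh Hy ->]]].
  by apply: addspan_gen; exists h, y.
have : setmul H H x by rewrite E.
move/setmulP; apply: (addspan_map (f := id)) => // _ [h [y [Hh Hy ->]]].
by apply: addspan_gen; exists h, y.
Qed.

Lemma dualL_full H : (forall x, H x) -> dualL H.
Proof.
move=> Hf; exists 1%N, (fun=> 1), (fun _ x => x); split=> // x _.
by rewrite big_ord1 mulr1.
Qed.

Lemma dualR_full H : (forall x, H x) -> dualR H.
Proof.
move=> Hf; exists 1%N, (fun=> 1), (fun _ x => x); split=> // x _.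
by rewrite big_ord1 mul1r.
Qed.

Lemma dualL_zero H : (forall x, H x -> x = 0) -> dualL H.
Proof.
move=> H0; exists 0%N, (fun=> 0), (fun _ x => x); split=> // [[]//|x /H0 ->].
by rewrite big_ord0.
Qed.

Lemma dualR_zero H : (forall x, H x -> x = 0) -> dualR H.
Proof.
move=> H0; exists 0%N, (fun=> 0), (fun _ x => x); split=> // [[]//|x /H0 ->].
by rewrite big_ord0.
Qed.

End Ideals.

(** * The Jacobson radical of a ring and of its quotients *)

Section Jacobson.
Variable Q : pzRingType.

Lemma maximal_rightP (N : submod (Q^c)^o) :
  maximal_in N (submod_full (Q^c)^o) -> maximal_right_ideal N.
Proof.
move=> [_ NT Nm]; split=> [E|N' NN'].
  by apply: NT => x _; have : (N : set _) x by rewrite E.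
case: (Nm N' NN') => // H; [left|right]; apply/seteqP; split=> //.
Qed.

Lemma jacobsonP (x : Q) : jacobson x <->
  forall a, exists b, (1 - x * a) * b = 1 /\ b * (1 - x * a) = 1.
Proof.
split=> [Jx|H N [NT Nm]].
  have rinv a : exists b, (1 - x * a) * b = 1.
    apply: contrapT => H.
    have [|W NW Wm] := @submod_zorn_maximal Q^c (cyc (1 - x * a : (Q^c)^o)).
      by move=> [b bE]; apply: H; exists b; apply: esym.
    have Wx := Jx W (maximal_rightP Wm); have [_ nW _] := Wm; apply: nW => y _.
    have -> : y = (y : Q^c) *: (1 : (Q^c)^o) by exact: (esym (mul1r (y : Q))).
    apply: submodZ; have -> : (1 : (Q^c)^o) = (1 - x * a) + x * a.
      exact: (esym (subrK (x * a) (1 : Q))).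
    apply: submodD; first exact/NW/cyc_id.
    exact: (submodZ (a : Q^c) Wx).
  move=> a; have [b bE] := rinv a; exists b; split=> //.
  (* The right inverse b of 1 - xa equals 1 + xab, so it is again of the form 1 - xa' and has a
     right inverse, which must be 1 - xa. *)
  have [c cE] := rinv (- (a * b)).
  have E : 1 - x * - (a * b) = b.
    by rewrite mulrN opprK -{1}bE mulrBl mul1r mulrA subrK.
  rewrite E in cE; suff -> : 1 - x * a = c by [].
  by rewrite -[RHS]mul1r -[X in _ = X * _]bE -mulrA cE mulr1.
apply: contrapT => Nx; apply: NT.
have [E|E] := Nm (submod_add N (cyc (x : (Q^c)^o))) (@submod_addl _ _ _ _).
  by case: Nx; have : (N : set _) x by rewrite -E; apply/submod_addr/cyc_id.
have [n Nn [a aE]] : submod_add N (cyc (x : (Q^c)^o)) (1 : Q).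
  by rewrite -[submod_add _ _ _]/((submod_add _ _ : set _) _) E.
have {}aE : 1 - x * a = n by rewrite -[x * a]aE subKr.
have [b [bE _]] := H a; apply/seteqP; split=> // y _.
have -> : y = (n : Q) * (b * (y : Q)) by rewrite mulrA -aE bE mul1r.
exact: (@submodZ Q^c (Q^c)^o N (b * (y : Q)) n Nn).
Qed.

End Jacobson.

Section QuotientRing.
Variables (A : pzRingType) (K : ideal A).

Lemma quotring_piE (x y : A) :
  quotring_pi K x * quotring_pi K y = quotring_pi K (x * y).
Proof. exact: quotring_piM. Qed.

Lemma quotring_pi_eq0 (x : A) : quotring_pi K x = 0 <-> K x.
Proof. by rewrite -(quotring_pi0 K) quotring_piP subr0. Qed.

Lemma jacobson_quot (x : A) : jacobson (quotring_pi K x) <-> rad_mod K x.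
Proof.
rewrite jacobsonP rad_mod_sym; split=> H a.
  have [b [bl br]] := H (quotring_pi K a); exists (generic_quotient.repr b).
  move: bl br; rewrite -[b]quotring_reprK -[1]/(quotring_pi K 1).
  rewrite quotring_piE -quotring_piB !quotring_piE quotring_reprK.
  by move=> /esym/quotring_piP ? /esym/quotring_piP.
have [b [bl br]] := H (generic_quotient.repr a); exists (quotring_pi K b).
rewrite -[a in x in _ - x]quotring_reprK -[1]/(quotring_pi K 1).
rewrite quotring_piE -quotring_piB !quotring_piE.
by split; apply/esym/quotring_piP.
Qed.

End QuotientRing.

Lemma layer_radical_zeroP (A : pzRingType) (H : nat -> ideal A) i :
  layer_radical_zero H i <-> radcond (H i) (H i.+1).
Proof.
rewrite /layer_radical_zero; set K := H i.+1; set L := ideal_mod _ _.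
split=> [E x j y Hx Kj Hy|HK].
  apply/quotring_pi_eq0.
  have : setmul (setmul L (@jacobson (quotring K))) L (quotring_pi K (x * j * y)).
    apply/setmulP; apply: addspan_gen.
    exists (quotring_pi K (x * j)), (quotring_pi K y).
    split; [|by exists y|by rewrite quotring_piE].
    apply/setmulP; apply: addspan_gen; exists (quotring_pi K x), (quotring_pi K j).
    by split; [exists x | apply/jacobson_quot | rewrite quotring_piE].
  by rewrite E.
apply/seteqP; split=> [z|z ->]; last first.
  by apply/setmulP; apply: addspan0.
move/setmulP/(_ (fun z => z = 0)); apply=> //; first by move=> u v -> ->; rewrite addr0.
move=> _ [u [_ [uP [y Hy <-] ->]]].
move/setmulP: uP => /(_ (fun u => u * quotring_pi K y = 0)); apply.
- exact: mul0r.
- by move=> v w v0 w0; rewrite mulrDl v0 w0 addr0.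
move=> _ [_ [j [[x Hx <-] Jj ->]]].
move: Jj; rewrite -[j]quotring_reprK => /jacobson_quot Kj.
rewrite (quotring_piE K x) (quotring_piE K (x * _)).
by apply/quotring_pi_eq0; apply: HK.
Qed.

(** * Passage to the opposite ring *)

Section Opposite.
Variable R : pzRingType.

Definition ideal_op (H : ideal R) : ideal R^c :=
  @Ideal R^c (H : R -> Prop) (ideal0 H) (@idealB R H) (@idealMr R H) (@idealMl R H).

Definition ideal_unop (H : ideal R^c) : ideal R :=
  @Ideal R (H : R -> Prop) (ideal0 H) (@idealB R^c H) (@idealMr R^c H) (@idealMl R^c H).

Lemma dualL_op (H : ideal R) : dualL (ideal_op H) <-> dualR H.
Proof. by []. Qed.
Lemma rad_mod_op (K : ideal R) x : rad_mod (ideal_op K) x <-> rad_mod K x.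
Proof.
rewrite (rad_mod_sym K); split=> H a; have [b [? ?]] := H a; exists b; split=> //.
Qed.

Lemma radcond_op (H K : ideal R) : radcond (ideal_op H) (ideal_op K) <-> radcond H K.
Proof.
split=> HK x j y Hx Kj Hy.
  have := HK y j x Hy (proj2 (rad_mod_op K j) Kj) Hx.
  by rewrite -mulrA.
rewrite -mulrA; exact: (HK y j x Hy (proj1 (rad_mod_op K j) Kj) Hx).
Qed.

Lemma idem_ideal_op (H : ideal R) : idem_ideal (ideal_op H) <-> idem_ideal H.
Proof.
split=> Hid x Hx; apply: (addspan_map (f := id)) (Hid x Hx) => // _ [h [y [Hh Hy ->]]];
  by apply: addspan_gen; exists y, h.
Qed.

Lemma ideal_right_op (H : ideal R) : ideal_right H = ideal_left (ideal_op H).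
Proof. exact: submod_ext. Qed.

End Opposite.

Lemma projective_leftP (R : pzRingType) (H : ideal R) : finlen R^o ->
  projective (submod_type (ideal_left H)) <-> dualL H.
Proof.
move=> Rf; rewrite dualLP dual_basisP; split=> [?|[]//]; split=> //.
exact/fg_finlen/finlen_sub.
Qed.

Lemma projective_rightP (A : pzRingType) (H : ideal A) : finlen (A^c)^o ->
  projective (submod_type (ideal_right H)) <-> dualR H.
Proof. by move=> Af; rewrite ideal_right_op projective_leftP. Qed.

(** * Reflections and coreflections *)

Section UniversalArrows.
Variable C : addcat.
Implicit Types D E : subcat C.

Definition coreflection D (X : C) := exists (Y : C) (eps : hom Y X),
  [/\ D Y, monic eps & forall Z (g : hom Z X), D Z -> exists h, eps \oc h = g].

Definition reflection D (X : C) := exists (Y : C) (eta : hom X Y),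
  [/\ D Y, epic eta & forall Z (g : hom X Z), D Z -> exists h, h \oc eta = g].

(** A right adjoint amounts to a universal arrow for each object. Uniqueness of lifts comes from the
    arrow being a monomorphism, so functoriality, naturality and the triangle identities all follow
    by cancelling [eps]. *)
Lemma right_rejectiveP D : right_rejective D <-> forall X, coreflection D X.
Proof.
split=> [[G [adj epsM]] X|H].
  exists (sval (G X)), (adj_counit adj X); split; [exact: svalP|exact: epsM|].
  move=> Z g DZ; pose Z' : fullsub D := exist _ Z DZ.
  exists (fhom G (g : hom (inclusion D Z') X) \oc adj_unit adj Z').
  have := adj_counit_nat adj (g : hom (inclusion D Z') X).
  rewrite /= compA => ->.
  by rewrite -compA [X in g \oc X](adj_triangleF adj Z') compm1.
have T X : {Y : C & {eps : hom Y X | [/\ D Y, monic eps &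
    forall Z (g : hom Z X), D Z -> exists h, eps \oc h = g]}}.
  by have /cid[Y /cid[eps P]] := H X; exists Y, eps.
pose Y X := projT1 (T X); pose eps X : hom (Y X) X := sval (projT2 (T X)).
have DY X : D (Y X) by case: (svalP (projT2 (T X))).
have epsM X : monic (eps X) by case: (svalP (projT2 (T X))).
have L X Z (g : hom Z X) : D Z -> {h : hom Z (Y X) | eps X \oc h = g}.
  by move=> DZ; apply: cid; case: (svalP (projT2 (T X))) => _ _; apply.
pose lift X Z g DZ := sval (@L X Z g DZ).
have liftP X Z g DZ : eps X \oc @lift X Z g DZ = g by apply: (svalP (L X Z g DZ)).
pose G0 X : fullsub D := exist _ (Y X) (DY X).
pose G1 X X' (f : hom X X') : hom (G0 X) (G0 X') := lift X' (Y X) (f \oc eps X) (DY X).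
have G1id X : G1 X X (idm X) = idm (G0 X).
  by apply: epsM; rewrite liftP comp1m compm1.
have G1comp X X' X'' (g : hom X' X'') (f : hom X X') :
    G1 X X'' (g \oc f) = G1 X' X'' g \oc G1 X X' f.
  apply: epsM; rewrite liftP; change (G1 X' X'' g \oc G1 X X' f) with
    (@comp C _ _ _ (G1 X' X'' g) (G1 X X' f)).
  by rewrite compA liftP -!compA liftP.
pose G := @Functor C (fullsub D) G0 G1 G1id G1comp.
pose un (X : fullsub D) : hom X (G (inclusion D X)) :=
  lift (sval X) (sval X) (idm _) (svalP X).
have unE (X : fullsub D) : eps (sval X) \oc un X = idm (sval X) by apply: liftP.
have un_nat (X X' : fullsub D) (f : hom X X') :
    un X' \oc f = fhom G (fhom (inclusion D) f) \oc un X.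
  apply: epsM; change (eps (sval X') \oc (@comp C _ _ _ (un X') f) =
    eps (sval X') \oc (@comp C _ _ _ (G1 _ _ f) (un X))).
  by rewrite !compA unE liftP -compA unE comp1m compm1.
have eps_nat X X' (f : hom X X') :
    eps X' \oc fhom (inclusion D) (fhom G f) = f \oc eps X by apply: liftP.
have triG X : fhom G (eps X) \oc un (G X) = idm (G X).
  apply: epsM; change (eps X \oc (@comp C _ _ _ (G1 _ _ (eps X)) (un (G X))) =
    eps X \oc idm (Y X)).
  by rewrite compA liftP -compA unE.
by exists G, (@Adjunction _ _ (inclusion D) G un eps un_nat eps_nat unE triG).
Qed.

Lemma left_rejectiveP D : left_rejective D <-> forall X, reflection D X.
Proof.
split=> [[F [adj etaE]] X|H].
  exists (sval (F X)), (adj_unit adj X); split; [exact: svalP|exact: etaE|].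
  move=> Z g DZ; pose Z' : fullsub D := exist _ Z DZ.
  exists (adj_counit adj Z' \oc fhom F (g : hom X (inclusion D Z'))).
  have := adj_unit_nat adj (g : hom X (inclusion D Z')).
  rewrite /= => E.
  transitivity ((adj_counit adj Z' : hom (sval (F Z)) Z) \oc
    (@comp C _ _ _ (fhom F (g : hom X (inclusion D Z'))) (adj_unit adj X))).
    by rewrite compA.
  rewrite -E compA.
  by rewrite [X in X \oc g](adj_triangleG adj Z') comp1m.
have T X : {Y : C & {eta : hom X Y | [/\ D Y, epic eta &
    forall Z (g : hom X Z), D Z -> exists h, h \oc eta = g]}}.
  by have /cid[Y /cid[eta P]] := H X; exists Y, eta.
pose Y X := projT1 (T X); pose eta X : hom X (Y X) := sval (projT2 (T X)).
have DY X : D (Y X) by case: (svalP (projT2 (T X))).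
have etaE X : epic (eta X) by case: (svalP (projT2 (T X))).
have L X Z (g : hom X Z) : D Z -> {h : hom (Y X) Z | h \oc eta X = g}.
  by move=> DZ; apply: cid; case: (svalP (projT2 (T X))) => _ _; apply.
pose ext X Z g DZ := sval (@L X Z g DZ).
have extP X Z g DZ : @ext X Z g DZ \oc eta X = g by apply: (svalP (L X Z g DZ)).
pose F0 X : fullsub D := exist _ (Y X) (DY X).
pose F1 X X' (f : hom X X') : hom (F0 X) (F0 X') := ext X (Y X') (eta X' \oc f) (DY X').
have F1id X : F1 X X (idm X) = idm (F0 X).
  by apply: etaE; rewrite extP comp1m compm1.
have F1comp X X' X'' (g : hom X' X'') (f : hom X X') :
    F1 X X'' (g \oc f) = F1 X' X'' g \oc F1 X X' f.
  apply: etaE; rewrite extP; change (F1 X' X'' g \oc F1 X X' f) with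
    (@comp C _ _ _ (F1 X' X'' g) (F1 X X' f)).
  by rewrite -compA extP !compA extP.
pose F := @Functor C (fullsub D) F0 F1 F1id F1comp.
pose co (X : fullsub D) : hom (F (inclusion D X)) X :=
  ext (sval X) (sval X) (idm _) (svalP X).
have coE (X : fullsub D) : @comp C _ _ _ (co X) (eta (sval X)) = idm (sval X) by apply: extP.
have eta_nat X X' (f : hom X X') :
    eta X' \oc f = fhom (inclusion D) (fhom F f) \oc eta X by rewrite /= extP.
have co_nat (X X' : fullsub D) (f : hom X X') :
    co X' \oc fhom F (fhom (inclusion D) f) = f \oc co X.
  apply: etaE; change ((@comp C _ _ _ (co X') (F1 _ _ f)) \oc eta (sval X) =
    (@comp C _ _ _ f (co X)) \oc eta (sval X)).
  by rewrite -!compA coE extP compA coE comp1m compm1.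
have triF X : co (F X) \oc fhom F (eta X) = idm (F X).
  apply: etaE; change ((@comp C _ _ _ (co (F X)) (F1 _ _ (eta X))) \oc eta X =
    idm (Y X) \oc eta X).
  by rewrite -compA extP compA [X in X \oc eta _](coE (F0 X)).
by exists F, (@Adjunction _ _ F (inclusion D) eta co eta_nat co_nat triF coE).
Qed.

End UniversalArrows.

Section RejectiveSubcategories.
Variable C : addcat.
Implicit Types D E : subcat C.

Lemma right_rejective_sub D E : (forall X, E X -> D X) ->
  right_rejective E -> right_rejective (subcat_in D E).
Proof.
move=> ED /right_rejectiveP H; apply/right_rejectiveP => -[X DX].
have [Y [eps [EY epsM epsP]]] := H X.
exists (exist _ Y (ED Y EY)), eps; split=> // [Z g h|Z g EZ]; first exact: epsM.
exact: (epsP (sval Z) g EZ).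
Qed.

Lemma left_rejective_sub D E : (forall X, E X -> D X) ->
  left_rejective E -> left_rejective (subcat_in D E).
Proof.
move=> ED /left_rejectiveP H; apply/left_rejectiveP => -[X DX].
have [Y [eta [EY etaE etaP]]] := H X.
exists (exist _ Y (ED Y EY)), eta; split=> // [Z g h|Z g EZ]; first exact: etaE.
exact: (etaP (sval Z) g EZ).
Qed.

(* The reflection into D makes a monomorphism of D a monomorphism of C. *)
Lemma right_rejective_trans D E : (forall X, E X -> D X) ->
  rejective D -> right_rejective (subcat_in D E) -> right_rejective E.
Proof.
move=> ED [/right_rejectiveP rD /left_rejectiveP lD] /right_rejectiveP rE.
apply/right_rejectiveP => X.
have [Y [eps [DY epsM epsP]]] := rD X.
have [[Z DZ] [del [/= EZ delM delP]]] := rE (exist _ Y DY).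
exists Z, (eps \oc (del : @hom C Z Y)); split=> // [W g h|W g EW].
  rewrite -!compA => /epsM gh.
  have [W' [eta [DW' etaE etaP]]] := lD W.
  have [g' g'E] := etaP Z g DZ; have [h' h'E] := etaP Z h DZ.
  move: gh; rewrite -g'E -h'E !compA => /etaE gh; congr (_ \oc eta).
  exact: (delM (exist _ W' DW') g' h' gh).
have [h hE] := epsP W g (ED W EW).
have [h' h'E] := delP (exist _ W (ED W EW)) h EW.
by exists h'; rewrite -compA [X in eps \oc X]h'E.
Qed.

(** The dual argument: the coreflection into D makes an epimorphism of D an epimorphism of C. *)
Lemma left_rejective_trans D E : (forall X, E X -> D X) ->
  rejective D -> left_rejective (subcat_in D E) -> left_rejective E.
Proof.
move=> ED [/right_rejectiveP rD /left_rejectiveP lD] /left_rejectiveP lE.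
apply/left_rejectiveP => X.
have [Y [eta [DY etaE etaP]]] := lD X.
have [[Z DZ] [del [/= EZ delE delP]]] := lE (exist _ Y DY).
exists Z, ((del : @hom C Y Z) \oc eta); split=> // [W g h|W g EW].
  rewrite !compA => /etaE gh.
  have [W' [eps [DW' epsM epsP]]] := rD W.
  have [g' g'E] := epsP Z g DZ; have [h' h'E] := epsP Z h DZ.
  move: gh; rewrite -g'E -h'E -!compA => /epsM gh; congr (eps \oc _).
  exact: (delE (exist _ W' DW') g' h' gh).
have [h hE] := etaP W g (ED W EW).
have [h' h'E] := delP (exist _ W (ED W EW)) h EW.
by exists h'; rewrite compA [X in X \oc eta]h'E.
Qed.

Lemma reflection_biproduct D X1 X2 X : biproduct X1 X2 X ->
  reflection D X1 -> reflection D X2 -> reflection D X.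
Proof.
move=> [i [j [p [q [pi qj pj qi ipjq]]]]] [Y1 [n1 [DY1 n1E n1P]]] [Y2 [n2 [DY2 n2E n2P]]].
have [Y BY] := addcat_sum Y1 Y2; have DY := subcat_sum BY DY1 DY2.
have [i' [j' [p' [q' [p'i' q'j' p'j' q'i' E']]]]] := BY.
exists Y, (i' \oc n1 \oc p + j' \oc n2 \oc q); split=> // [Z s t st|Z g DZ].
  have si : s \oc i' = t \oc i'.
    apply: n1E; move: (congr1 (fun f => f \oc i) st).
    rewrite !compDr !compDl -!compA pi qi !compm1 !compm0 !addr0.
    by rewrite !compA.
  have sj : s \oc j' = t \oc j'.
    apply: n2E; move: (congr1 (fun f => f \oc j) st).
    rewrite !compDr !compDl -!compA pj qj !compm1 !compm0 !add0r.
    by rewrite !compA.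
  by rewrite -[s]compm1 -[t]compm1 -E' !compDr !compA si sj.
have [h1 h1E] := n1P Z (g \oc i) DZ; have [h2 h2E] := n2P Z (g \oc j) DZ.
exists (h1 \oc p' + h2 \oc q').
rewrite compDl !compDr -!compA !(compA p') !(compA q') p'i' q'j' p'j' q'i'.
rewrite !comp0m !comp1m !compm0 addr0 add0r !compA h1E h2E -!compA.
by rewrite -compDr ipjq compm1.
Qed.

End RejectiveSubcategories.

Section QuotientCategory.
Variables (C : precat) (I : cat_ideal C).

Lemma quothom_pi_eq0 (X Y : C) (f : hom X Y) :
  quothom_pi I f = 0 :> @hom (quotcat I) X Y <-> I X Y f.
Proof.
have -> : (0 : @hom (quotcat I) X Y) = quothom_pi I 0 by rewrite /quothom_pi raddf0.
by rewrite quothom_piP subr0.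
Qed.

Lemma quot_radicalP (X Y : C) (f : hom X Y) :
  @radical (quotcat I) X Y (quothom_pi I f) <->
  forall g : hom Y X, exists u : hom X X,
    I X X (u \oc (idm X - g \oc f) - idm X) /\ I X X ((idm X - g \oc f) \oc u - idm X).
Proof.
have piM (X' Y' Z' : C) (g : @hom C Y' Z') (h : @hom C X' Y') :
    (quothom_pi I g : @hom (quotcat I) Y' Z') \oc (quothom_pi I h : @hom (quotcat I) X' Y') =
    quothom_pi I (g \oc h) by apply: quothom_piM.
have piB (g : @hom C Y X) : idm (X : quotcat I) -
    (quothom_pi I g : @hom (quotcat I) Y X) \oc (quothom_pi I f : @hom (quotcat I) X Y) =
    quothom_pi I (idm X - g \oc f).
  by rewrite piM [RHS]raddfB.
split=> H g.
  have [u [ul ur]] := H (quothom_pi I g : @hom (quotcat I) Y X).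
  exists (generic_quotient.repr u); move: ul ur; rewrite piB.
  rewrite -[u]quothom_reprK !piM quothom_reprK.
  by move=> /quothom_piP ? /quothom_piP.
have [u [ul ur]] := H (generic_quotient.repr g).
exists (quothom_pi I u : @hom (quotcat I) X X).
rewrite -[g]quothom_reprK piB !piM.
by split; apply/quothom_piP.
Qed.

End QuotientCategory.

(** * Subcategories of projective modules and trace ideals *)

Section ProjectiveCategory.
Variable R : pzRingType.
Implicit Types (X Y Z : projcat R) (D : subcat (projcat R)) (H K : ideal R).

Definition carrier X : lmodType R := sval X.
Definition happ X Y (f : hom X Y) : {linear carrier X -> carrier Y} := f.
Definition mkhom X Y (f : {linear carrier X -> carrier Y}) : hom X Y := f.
Definition mkobj (M : lmodType R) (b : dual_basis M) : projcat R :=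
  exist _ M (proj1 (dual_basisP M) b).

Lemma carrier_dual X : dual_basis (carrier X).
Proof. exact/dual_basisP/(svalP X). Qed.

Lemma homP X Y (f g : hom X Y) : (forall x, happ f x = happ g x) -> f = g.
Proof. exact: mhomP. Qed.

Lemma happ_eq X Y (f g : hom X Y) : f = g -> forall x, happ f x = happ g x.
Proof. by move=> ->. Qed.

Definition ring_obj : projcat R := mkobj (@dual_basis_ring R).

(** R is a generator: an element x of the kernel gives a map from R to X that f annihilates. *)
Lemma monic_inj X Y (f : hom X Y) : monic f -> injective (happ f).
Proof.
move=> fM; apply: inj_ker0 => x fx.
have /happ_eq/(_ (1 : R^o)) : mkhom (X := ring_obj) (orbit_map x : {linear _ -> carrier X}) = 0.
  apply: fM; rewrite compm0; apply: homP => a.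
  change (happ f ((a : R) *: x) = 0).
  by rewrite linearZ_LR fx scaler0.
by rewrite /= scale1r.
Qed.

Lemma inj_monic X Y (f : hom X Y) : injective (happ f) -> monic f.
Proof.
move=> fI Z g h /happ_eq gh; apply: homP => z; apply: fI; exact: (gh z).
Qed.

(** Closure under summands is stated with biproducts inside the category, so the complement of the
    retract has to be shown finitely generated projective first. *)
Lemma subcat_retract D X Y : retract (carrier X) (carrier Y) -> D Y -> D X.
Proof.
move=> rXY; have /retractP[M' [f [g fK gK]]] := rXY.
have gl : linear g by move=> a u v; apply: (can_inj fK); rewrite gK linearP !gK.
have M'b : dual_basis M'.
  apply: (@dual_basis_retract R M' (carrier Y)) (carrier_dual Y).
  exists (f \o (@pair_in2 R (carrier X) M' : {linear _ -> _})).
  exists ((@pair_snd R (carrier X) M' : {linear _ -> _}) \o mk_linear gl) => x /=.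
  by rewrite fK.
apply: (@subcat_summand _ D X (mkobj M'b) Y).
exists (mkhom (Y := Y) (f \o (@pair_in1 R (carrier X) M' : {linear _ -> _}))).
exists (mkhom (X := mkobj M'b) (Y := Y) (f \o (@pair_in2 R (carrier X) M' : {linear _ -> _}))).
exists (mkhom (X := Y) ((@pair_fst R (carrier X) M' : {linear _ -> _}) \o mk_linear gl)).
exists (mkhom (X := Y) (Y := mkobj M'b) ((@pair_snd R (carrier X) M' : {linear _ -> _}) \o mk_linear gl)).
split; apply: homP => x /=.
- by change ((g (f (x, 0))).1 = x); rewrite fK.
- by change ((g (f (0, x))).2 = x); rewrite fK.
- by change ((g (f (0, x))).1 = 0); rewrite fK.
- by change ((g (f (x, 0))).2 = 0); rewrite fK.
- change (f ((g x).1, 0) + f (0, (g x).2) = x); rewrite -linearD -[RHS]gK.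
  by congr (f _); case: (g x) => u v; congr pair; rewrite /= ?addr0 ?add0r.
Qed.

(** Single values v(z) already form an ideal: a difference of two values is one value on the direct
    sum of the two objects, which belongs to D. *)
Definition trace_set D (a : R) := exists Z, D Z /\
  exists (z : carrier Z) (v : {linear carrier Z -> R^o}), v z = a.

(** Kept as a relation so that the same results apply to the ideals of a given chain and to those
    computed from a chain of subcategories. *)
Definition link H D := forall a, H a <-> trace_set D a.

Fact trace0 D : trace_set D 0.
Proof.
have [Z Z0] := addcat_zero (projcat R); exists Z; split; first exact: subcat_zero.
by exists 0, \0.
Qed.
Fact traceB D x y : trace_set D x -> trace_set D y -> trace_set D (x - y).
Proof.
move=> [Z [DZ [z [v <-]]]] [Z' [DZ' [z' [v' <-]]]].
have [T BT] := addcat_sum Z Z'; exists T; split; first exact: subcat_sum BT DZ DZ'.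
have [i [j [p [q [pi qj pj qi _]]]]] := BT.
exists (happ i z + happ j z'), ((v \o happ p) \+ (\- (v' \o happ q))) => /=.
have E1 : happ p (happ i z) = z := happ_eq pi z.
have E2 : happ q (happ j z') = z' := happ_eq qj z'.
have E3 : happ p (happ j z') = 0 := happ_eq pj z'.
have E4 : happ q (happ i z) = 0 := happ_eq qi z.
by rewrite ![happ p (_ + _)]linearD ![happ q (_ + _)]linearD E1 E2 E3 E4 addr0 add0r.
Qed.
Fact traceMl D a x : trace_set D x -> trace_set D (a * x).
Proof.
move=> [Z [DZ [z [v <-]]]]; exists Z; split=> //; exists (a *: z), v.
exact: linearZ.
Qed.
Fact traceMr D a x : trace_set D x -> trace_set D (x * a).
Proof.
move=> [Z [DZ [z [v <-]]]]; exists Z; split=> //; exists z.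
by exists (orbit_map (a : R^o) \o v).
Qed.
Definition trace_ideal D : ideal R :=
  Ideal (@trace0 D) (@traceB D) (@traceMl D) (@traceMr D).

Section Link.
Variables (H : ideal R) (D : subcat (projcat R)) (HD : link H D).

Lemma link_functional X (v : {linear carrier X -> R^o}) x : D X -> H (v x).
Proof. by move=> DX; apply/HD; exists X; split=> //; exists x, v. Qed.

(** Finitely many elements of HX lie in the image of a single map from an object of D. Applied to a
    dual basis, this yields both the description of D and that of the maps factoring through D. *)
Lemma link_hit X m (y : 'I_m -> carrier X) :
  (forall k, act H (submod_full _) (y k)) ->
  exists Z, D Z /\ exists f : {linear carrier Z -> carrier X},
    forall k, exists z, f z = y k.
Proof.
have join Z Z' (f : {linear carrier Z -> carrier X}) (f' : {linear carrier Z' -> carrier X}) :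
    D Z -> D Z' -> exists T, D T /\ exists g : {linear carrier T -> carrier X},
      forall z z', exists t, g t = f z + f' z'.
  move=> DZ DZ'; have [T BT] := addcat_sum Z Z'; have DT := subcat_sum BT DZ DZ'.
  have [i [j [p [q [pi qj pj qi _]]]]] := BT; exists T; split=> //.
  exists ((f \o happ p) \+ (f' \o happ q)) => z z'; exists (happ i z + happ j z') => /=.
  have E1 : happ p (happ i z) = z := happ_eq pi z.
  have E2 : happ q (happ j z') = z' := happ_eq qj z'.
  have E3 : happ p (happ j z') = 0 := happ_eq pj z'.
  have E4 : happ q (happ i z) = 0 := happ_eq qi z.
  by rewrite ![happ p (_ + _)]linearD ![happ q (_ + _)]linearD E1 E2 E3 E4 addr0 add0r.
have [Z0 Z00] := addcat_zero (projcat R); have DZ0 := subcat_zero D Z00.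
have one x : act H (submod_full (carrier X)) x -> exists Z, D Z /\
    exists f : {linear carrier Z -> carrier X}, exists z, f z = x.
  move: x; apply: act_ind.
  - by exists Z0; split=> //; exists \0, 0.
  - move=> u v [Z [DZ [f [z <-]]]] [Z' [DZ' [f' [z' <-]]]].
    have [T [DT [g gP]]] := join Z Z' f f' DZ DZ'; exists T; split=> //; exists g.
    exact: gP.
  - move=> h x /HD[Z [DZ [z [v <-]]]] _; exists Z; split=> //.
    by exists (orbit_map x \o v), z.
elim: m y => [|m IHm] y yH; first by exists Z0; split=> //; exists \0 => -[].
have [Z [DZ [f [z zE]]]] := one (y ord0) (yH ord0).
have [Z' [DZ' [f' f'P]]] := IHm (y \o lift ord0) (fun k => yH _).
have [T [DT [g gP]]] := join Z Z' f f' DZ DZ'; exists T; split=> //; exists g => k.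
case: (unliftP ord0 k) => [j|] ->.
  by have [z' z'E] := f'P j; have [t tE] := gP 0 z'; exists t; rewrite tE linear0 add0r.
by have [t tE] := gP z 0; exists t; rewrite tE linear0 addr0.
Qed.

(** If X = HX, some object of D maps onto the generators of X, and the resulting epimorphism splits
    because X is projective. *)
Lemma link_hfull X : D X <-> hfull H (submod_full (carrier X)).
Proof.
have [m [x [v xv]]] := carrier_dual X; split=> [DX y _|HX].
  rewrite (xv y); apply: submod_sum => k; apply: act_in => //.
  exact: link_functional.
have [Z [DZ [f fP]]] := @link_hit X m x (fun k => HX _ I).
apply: subcat_retract DZ.
have fO : onto f.
  have [z zP] := choice fP => y; exists (\sum_k (v k y : R) *: z k).
  by rewrite linear_sum [RHS]xv; apply: eq_bigr => k _; rewrite linearZ zP.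
have [_ pX] := svalP X.
have [h hP] := @split_onto R (carrier X) _ f pX fO.
by exists h, f.
Qed.

Lemma link_idem : idem_ideal H.
Proof.
move=> a /HD[Z [DZ [z [v <-]]]].
apply: (act_map (f := v)) (proj1 (link_hfull Z) DZ z I) => y _.
exact: link_functional.
Qed.

Lemma link_factor X Y (f : {linear carrier X -> carrier Y}) :
  (forall x, act H (submod_full (carrier Y)) (f x)) <->
  exists Z, D Z /\ exists (g : {linear carrier Z -> carrier Y})
    (h : {linear carrier X -> carrier Z}), forall x, f x = g (h x).
Proof.
split=> [fH|[Z [DZ [g [h fE]]]] x]; last first.
  by rewrite fE; apply: (act_map (f := g)) (proj1 (link_hfull Z) DZ (h x) I).
have [m [x [v xv]]] := carrier_dual X.
have [Z [DZ [g gP]]] := @link_hit Y m (fun k => f (x k)) (fun k => fH _).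
have [z zP] := choice gP.
have hl : linear (fun y => \sum_k (v k y : R) *: z k).
  move=> a s t; rewrite scaler_sumr -big_split; apply: eq_bigr => k _.
  by rewrite linearP scalerDl scalerA.
exists Z; split=> //; exists g, (mk_linear hl) => y /=.
rewrite [in LHS](xv y) !linear_sum; apply: eq_bigr => k _.
by rewrite !linearZ zP.
Qed.

End Link.

Lemma dual_basis_fin (M : lmodType R) (T : finType) (x : T -> M)
  (v : T -> {linear M -> R^o}) :
  (forall y, y = \sum_t (v t y : R) *: x t) -> dual_basis M.
Proof.
move=> xv; exists #|T|, (fun i => x (enum_val i)), (fun i => v (enum_val i)) => y.
by rewrite [LHS]xv (big_enum_val (A := T) (fun t => (v t y : R) *: x t)).
Qed.

Lemma act_functional H (M : lmodType R) (V : submod M) (v : {linear M -> R^o}) y :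
  act H V y -> H (v y).
Proof.
apply: (act_sub_ind (W := submod_preim v (ideal_left H))) => h x Hh _ /=.
by rewrite linearZ_LR; apply: idealMr.
Qed.

(** The products of the two families form a dual basis of HM: generators h_j x_k, with coordinates
    phi_j(v_k(y)); the latter make sense because v_k maps HM into H. *)
Lemma dual_basis_act H (M : lmodType R) : dualL H -> dual_basis M ->
  dual_basis (submod_type (act H (submod_full M))).
Proof.
move=> [m [h [phi [Hh phiD phiM hphi]]]] [n [x [v xv]]].
set V := act H _.
have vl (t : 'I_n * 'I_m) : linear (fun y => phi t.2 (v t.1 (sval_lin V y)) : R^o).
  have vH := fun y : submod_type V => act_functional (v t.1) (sval_linP y).
  move=> a u w; have := vH (a *: u); rewrite !linearP !linearZ_LR => ?.
  by rewrite phiD ?phiM.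
have Vx (t : 'I_n * 'I_m) : V (h t.2 *: x t.1) by apply: act_in.
pose xs t := to_submod (Vx t); pose vs t := mk_linear (vl t).
apply: (@dual_basis_fin _ _ xs vs) => y; apply: sval_lin_inj.
rewrite linear_sum [LHS]xv.
rewrite -(pair_bigA _ (fun k j => sval_lin V ((vs (k, j) y : R) *: xs (k, j)))) /=.
apply: eq_bigr => k _; rewrite [in LHS](hphi _ (act_functional (v k) (sval_linP y))).
by rewrite scaler_suml; apply: eq_bigr => j _; rewrite scalerA.
Qed.

(** The coreflection of R is injective with image H, so a dual basis of its source becomes one of H.
    Conversely the inclusion of HX is a coreflection of X, projective by [dual_basis_act]. *)
Lemma right_rejective_dualL H D : link H D -> right_rejective D <-> dualL H.
Proof.
move=> HD; rewrite right_rejectiveP; split=> [/(_ ring_obj)|dH X].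
  move=> [Y [eps [DY /monic_inj epsI epsP]]].
  have [m [y [v yv]]] := carrier_dual Y.
  have ex a : exists b, H a -> happ eps b = a.
    have [/HD[Z [DZ [z [w wz]]]]|nH] := pselect (H a); last by exists 0.
    have [g gE] := epsP Z (mkhom (Y := ring_obj) w) DZ.
    by exists (happ g z) => _; rewrite -wz; apply: (happ_eq gE z).
  have [s sP] := choice ex.
  exists m, (fun k => happ eps (y k)), (fun k a => v k (s a)); split.
  - by move=> k; apply: (link_functional HD (happ eps : {linear carrier Y -> R^o})).
  - move=> k a b Ha Hb; rewrite -linearD; congr (v k _); apply: epsI.
    by rewrite linearD !sP //; apply: idealD.
  - move=> k a b Hb; rewrite -[RHS](linearZ_LR (v k) a); congr (v k _); apply: epsI.
    by rewrite linearZ_LR !sP //; apply: idealMl.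
  - move=> a Ha; rewrite -[LHS]sP // [in LHS](yv (s a)) linear_sum.
    by apply: eq_bigr => k _; rewrite linearZ_LR.
have b := dual_basis_act dH (carrier_dual X).
exists (mkobj b), (mkhom (X := mkobj b) (sval_lin _)); split.
- apply/(link_hfull HD)/hfull_submodP; apply: act_hfull.
  exact: link_idem HD.
- by apply: inj_monic; apply: sval_lin_inj.
move=> Z g DZ.
have gH z : act H (submod_full (carrier X)) (happ g z).
  exact: (act_map (f := happ g)) (proj1 (link_hfull HD Z) DZ z I).
have [h hP] := factor_inj (f := happ g) (@sval_lin_inj R _ (act H (submod_full (carrier X))))
  (fun z => ex_intro _ (to_submod (gH z)) erefl).
by exists (mkhom (Y := mkobj b) h); apply: homP.
Qed.

Lemma idempotent_split X (e : {linear carrier X -> carrier X}) :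
  (forall x, e (e x) = e x) ->
  exists Y (j : {linear carrier Y -> carrier X}) (q : {linear carrier X -> carrier Y}),
    (forall y, q (j y) = y) /\ (forall x, j (q x) = e x).
Proof.
move=> ee; pose V := submod_im e (submod_full (carrier X)).
have [q qP] := factor_inj (f := e) (@sval_lin_inj R _ V)
  (fun x => ex_intro _ (to_submod (ex_intro2 _ _ x I erefl : V (e x))) erefl).
have qK y : q (sval_lin V y) = y.
  apply: sval_lin_inj; rewrite qP; have [x _ <-] := sval_linP y; exact: ee.
have b : dual_basis (submod_type V).
  by apply: dual_basis_retract (carrier_dual X); exists (sval_lin V), q.
by exists (mkobj b), (sval_lin V), q.
Qed.

(** The idempotent of X with image X' extends to an endomorphism g of the reflection Y. By
    uniqueness of extensions g is idempotent, and its image is the reflection of X'. *)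
Lemma reflection_retract D X X' : retract (carrier X') (carrier X) ->
  reflection D X -> reflection D X'.
Proof.
move=> [i [p pi]] [Y [eta [DY etaE etaP]]].
pose i' := mkhom (Y := X) i; pose p' := mkhom (X := X) p.
have pi' : p' \oc i' = idm X' by apply: homP.
have [g gE] := etaP Y (eta \oc i' \oc p') DY.
have gg : g \oc g = g.
  apply: etaE; rewrite -compA gE !compA gE -!compA (compA p') pi' comp1m.
  by rewrite !compA.
have [Y' [j [q [qj jq]]]] := idempotent_split (happ_eq gg).
pose j' := mkhom (Y := Y) j; pose q' := mkhom (X := Y) q.
have qj' : q' \oc j' = idm Y' by apply: homP.
have jq' : j' \oc q' = g by apply: homP.
exists Y', (q' \oc eta \oc i'); split.
- by apply: subcat_retract DY; exists j, q.
- move=> Z s t st.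
  have E : q' \oc eta \oc i' \oc p' = q' \oc eta.
    by rewrite -!compA (compA eta) -gE -jq' !compA qj' comp1m.
  have : s \oc q' = t \oc q'.
    by apply: etaE; rewrite -!compA -E !compA -!(compA _ _ i') !compA in st *; rewrite st.
  by move=> /(congr1 (fun f => f \oc j')); rewrite -!compA qj' !compm1.
move=> Z w DZ; have [w' w'E] := etaP Z (w \oc p') DZ.
exists (w' \oc j'); rewrite -!compA (compA j') jq' (compA g) gE.
by rewrite -!compA pi' compm1 compA w'E -compA pi' compm1.
Qed.

(** Every finitely generated projective is a retract of a free module. The free modules are built as
    iterated abstract biproducts, remembering only a basis with its universal property. *)
Lemma projcat_ind (Q : projcat R -> Prop) : Q ring_obj ->
  (forall X, zero_object X -> Q X) ->
  (forall X Y Z, biproduct X Y Z -> Q X -> Q Y -> Q Z) ->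
  (forall X Y, retract (carrier X) (carrier Y) -> Q Y -> Q X) -> forall X, Q X.
Proof.
move=> Qr Q0 Qb Qret X.
have Qf m : exists2 F, Q F & exists x : 'I_m -> carrier F,
    forall (M : lmodType R) (y : 'I_m -> M), exists f : {linear carrier F -> M},
      forall k, f (x k) = y k.
  elim: m => [|m [F QF [x xP]]].
    have [Z Z0] := addcat_zero (projcat R); exists Z; first exact: Q0.
    by exists (fun=> 0) => M y; exists \0 => -[].
  have [T BT] := addcat_sum ring_obj F; exists T; first exact: Qb BT Qr QF.
  have [i [j [p [q [pi qj pj qi _]]]]] := BT.
  exists (fun k => if unlift ord0 k is Some l then happ j (x l) else happ i (1 : R^o)).
  move=> M y; have [f fP] := xP M (y \o lift ord0).
  exists ((orbit_map (y ord0) \o (happ p : {linear _ -> R^o})) \+ (f \o happ q)) => k.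
  case: (unliftP ord0 k) => [l|] -> /=.
    have E1 : happ q (happ j (x l)) = x l := happ_eq qj (x l).
    have E2 : happ p (happ j (x l)) = 0 := happ_eq pj (x l).
    by rewrite E1 [X in X *: _]E2 scale0r add0r fP.
  have E1 : happ p (happ i (1 : R^o)) = (1 : R) := happ_eq pi (1 : R^o).
  have E2 : happ q (happ i (1 : R^o)) = 0 := happ_eq qi (1 : R^o).
  by rewrite E2 [X in X *: _]E1 scale1r linear0 addr0.
have [m [y [v yv]]] := carrier_dual X; have [F QF [x xP]] := Qf m.
have [f fP] := xP _ y; apply: Qret QF.
have hl : linear (fun z => \sum_k (v k z : R) *: x k).
  move=> a s t; rewrite scaler_sumr -big_split; apply: eq_bigr => k _.
  by rewrite linearP scalerDl scalerA.
exists (mk_linear hl), f => z /=; rewrite linear_sum [RHS]yv.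
by apply: eq_bigr => k _; rewrite linearZ_LR fP.
Qed.

Lemma dualR_sum H (phi : R -> R) n (x : 'I_n -> R) (c : 'I_n -> R) :
  (forall x y, H x -> H y -> phi (x + y) = phi x + phi y) ->
  (forall a x, H x -> phi (x * a) = phi x * a) ->
  (forall k, H (x k)) -> phi (\sum_k x k * c k) = \sum_k phi (x k) * c k.
Proof.
move=> phiD phiM Hx.
suff [] : H (\sum_k x k * c k) /\ phi (\sum_k x k * c k) = \sum_k phi (x k) * c k by [].
have phi0 : phi 0 = 0 by rewrite -[0](mulr0 0) phiM ?mulr0 //; apply: ideal0.
elim/big_ind2: _ => [|u u' v v' [Hu <-] [Hv <-]|k _].
- by split=> //; apply: ideal0.
- by split; [apply: idealD | rewrite phiD].
- by split; [apply: idealMr | rewrite phiM].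
Qed.

(* If h_k, phi_k is a dual basis of H as a right ideal, then the left dual
   Hom_R(H, R) is the row space of the idempotent matrix (phi_j (h_k)), and
   z = (h_k) is the image of the inclusion of H into R. *)
Lemma dual_object H : dualR H -> idem_ideal H ->
  exists Y (z : carrier Y), [/\ hfull H (submod_full (carrier Y)),
    forall (M : lmodType R) x, act H (submod_full M) x ->
      exists w : {linear carrier Y -> M}, w z = x &
    forall Z (s t : {linear carrier Y -> carrier Z}), s z = t z -> forall y, s y = t y].
Proof.
move=> [m [h [phi [Hh phiD phiM hphi]]]] Hid.
have phis k n (x c : 'I_n -> R) := dualR_sum (x := x) c (phiD k) (phiM k).
(* Since H = HH, write x as a sum of products ay in H; then phi(ay) = phi(a)y lies in H. *)
have phiH t x : H x -> H (phi t x).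
  move=> /Hid; pose Q y := H y /\ H (phi t y).
  suff HQ : forall y, act H (ideal_left H) y -> Q y by move=> /HQ[].
  apply: act_ind => [|u v [Hu Hu'] [Hv Hv']|a y Ha Hy].
  - have -> : (0 : R) = 0 * 0 by rewrite mulr0.
    by split; [apply/idealMr/ideal0 | rewrite phiM; [apply/idealMl|]; apply: ideal0].
  - by split; [apply: idealD | rewrite phiD //; apply: idealD].
  - by split; [apply: idealMl | rewrite phiM //; apply: idealMl].
pose F := mkobj (dual_basis_ffun m (@dual_basis_ring R)).
pose E (j : 'I_m) : carrier F := [ffun k => phi j (h k)].
pose e : {linear carrier F -> carrier F} := free_map E.
(* Idempotency of the matrix: apply phi_j to the expansion of h_k in the dual basis. *)
have eE j : e (E j) = E j.
  apply/ffunP => k; rewrite /e free_mapE sum_ffunE ffunE [in RHS](hphi _ (Hh k)) phis //.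
  by apply: eq_bigr => l _; rewrite !ffunE.
have ee x : e (e x) = e x.
  have -> : e x = \sum_k (x k : R) *: E k by [].
  rewrite linear_sum; apply: eq_bigr => k _.
  by rewrite linearZ_LR eE.
have [Y [j [q [qj jq]]]] := idempotent_split ee.
have jE y k : j y k = \sum_l (j y l : R) * phi l (h k).
  rewrite -{1}[y]qj jq /e free_mapE sum_ffunE; apply: eq_bigr => l _.
  by rewrite !ffunE.
have yE y : y = \sum_l (j y l : R) *: q (E l).
  rewrite -{1}[y]qj -{1}[y]qj jq /e free_mapE linear_sum.
  by apply: eq_bigr => l _; rewrite linearZ_LR.
pose z : carrier F := [ffun k => h k].
have jz : j (q z) = z.
  rewrite jq; apply/ffunP => k; rewrite /e free_mapE sum_ffunE ffunE [RHS](hphi _ (Hh k)).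
  by apply: eq_bigr => l _; rewrite !ffunE.
exists Y, (q z); split.
- move=> y _; rewrite (yE y); apply: submod_sum => l.
  apply: act_in => //; rewrite jE; apply: ideal_sum => t.
  exact/idealMl/phiH.
- move=> M; apply: act_ind => [|u v [w <-] [w' <-]|a x Ha _].
  + by exists \0.
  + by exists (w \+ w').
  (* The functional sending a row c to the sum of c_k phi_k(a) takes z = (h_k) to a, by the dual
     basis property. *)
  exists (orbit_map x \o (free_map (fun k => phi k a : R^o) \o j)).
  rewrite /= jz /free_map_fun; congr (_ *: x); rewrite [RHS](hphi a Ha).
  by apply: eq_bigr => k _; rewrite ffunE.
move=> Z s t st; pose d : {linear carrier Y -> carrier Z} := s \- t.
have dz : d (q z) = 0 by rewrite /d /= st subrr.
(* From d(z) = 0 and a functional v on Z, the sum of h_i v(d(E_i)) vanishes; applying phi_l to it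
   gives v(d(E_l)) = 0. *)
have dE l : d (q (E l)) = 0.
  have [n [x [v xv]]] := carrier_dual Z.
  have vd k : v k (d (q (E l))) = 0.
    have : phi l (\sum_i h i * v k (d (q (E i)))) = phi l (0 * 0).
      congr (phi l _); transitivity (v k (d (q z))); last by rewrite dz linear0 mulr0.
      rewrite [in RHS](yE (q z)) !linear_sum.
      by apply: eq_bigr => i _; rewrite jz ffunE !linearZ_LR.
    rewrite phis // phiM ?mulr0; last exact: ideal0.
    move=> <-; rewrite {1}(yE (q (E l))) !linear_sum; apply: eq_bigr => i _.
    by rewrite !linearZ_LR jq eE ffunE.
  rewrite (xv (d _)) big1 // => k _.
  by rewrite vd scale0r.
move=> y; apply/subr0_eq; change (d y = 0).
rewrite (yE y) linear_sum big1 // => l _.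
by rewrite linearZ_LR dE scaler0.
Qed.

Lemma reflection_ring H D : link H D -> dualR H -> reflection D ring_obj.
Proof.
move=> HD dH; have [Y [z [HY ext uniq]]] := dual_object dH (link_idem HD).
exists Y, (mkhom (X := ring_obj) (orbit_map z : {linear _ -> carrier Y})); split.
- exact/(link_hfull HD).
- move=> Z s t st; apply: homP; apply: uniq.
  by have := happ_eq st (1 : R^o); rewrite /= scale1r.
move=> Z g DZ.
have [w wE] := ext _ (happ g (1 : R^o)) (proj1 (link_hfull HD Z) DZ _ I).
exists (mkhom w); apply: homP => a.
change (w ((a : R) *: z) = happ g a); rewrite linearZ_LR wE -linearZ_LR.
by congr (happ g _); apply: mulr1.
Qed.

(** Given the reflection of R, let z be the image of 1. Each a in H is S_a(z) for a unique
    functional S_a on Y, and expanding z in a dual basis (y_k, v_k) of Y gives the dual basis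
    v_k(z), S_a(y_k) of H. The converse starts from [dual_object] and spreads from R to all
    objects. *)
Lemma left_rejective_dualR H D : link H D -> left_rejective D <-> dualR H.
Proof.
move=> HD; rewrite left_rejectiveP; split=> [/(_ ring_obj)|dH]; last first.
  apply: projcat_ind.
  - exact: reflection_ring HD dH.
  - move=> X X0; exists X, (idm X); split; first exact: subcat_zero.
      by move=> Z g h; rewrite !compm1.
    by move=> Z g _; exists g; rewrite compm1.
  - exact: reflection_biproduct.
  - by move=> X Y; apply: reflection_retract.
move=> [Y [eta [DY etaE etaP]]]; have [m [y [v yv]]] := carrier_dual Y.
pose z := happ eta (1 : R^o).
have uniq (s t : {linear carrier Y -> R^o}) : s z = t z -> forall x, s x = t x.
  move=> st; apply: (@happ_eq Y ring_obj); apply: etaE; apply: homP => a.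
  have E (r : {linear carrier Y -> R^o}) : r (happ eta a) = (a : R) *: r z.
    rewrite /z -!linearZ_LR; congr (r (happ eta _)).
    exact: (esym (mulr1 (a : R))).
  by change (s (happ eta a) = t (happ eta a)); rewrite !E st.
have ex a : exists s : {linear carrier Y -> R^o}, H a -> s z = a.
  have [/HD[Z [DZ [x [w wx]]]]|nH] := pselect (H a); last by exists \0.
  have [g gE] := etaP Z (mkhom (X := ring_obj) (orbit_map x : {linear _ -> carrier Z})) DZ.
  exists (w \o happ g) => _; rewrite -wx /=; congr (w _).
  by have := happ_eq gE (1 : R^o); rewrite /= scale1r.
have [S SP] := choice ex.
exists m, (fun k => v k z), (fun k a => S a (y k)); split.
- by move=> k; apply: (link_functional HD).
- move=> k a b Ha Hb; apply: (uniq _ (S a \+ S b)).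
  by rewrite /= !SP //; apply: idealD.
- move=> k a b Hb; apply: (uniq _ (orbit_map (a : R^o) \o S b)).
  by rewrite /= !SP //; apply: idealMr.
- move=> a Ha; rewrite -[LHS]SP // [in LHS](yv z) linear_sum.
  by apply: eq_bigr => k _; rewrite linearZ_LR.
Qed.

End ProjectiveCategory.

(** * Cosemisimplicity as a condition on trace ideals *)

Section Cosemisimple.
Variables (R : pzRingType) (H H' : ideal R) (D D' : subcat (projcat R)).
Hypotheses (HD : link H D) (HD' : link H' D') (DD' : forall X, D' X -> D X).

Lemma factor_in (X Y : fullsub D) (f : hom X Y) :
  factor_ideal (subcat_in D D') X Y f <->
  forall x, act H' (submod_full (carrier (sval Y))) (happ (f : hom (sval X) (sval Y)) x).
Proof.
rewrite (link_factor HD' (X := sval X) (Y := sval Y)).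
split=> [[Z [g [h [DZ ->]]]]|[Z [DZ [g [h fE]]]]].
  by exists (sval Z); split=> //; exists g, h.
exists (exist _ Z (DD' DZ)), g, h; split=> //.
exact: (@homP R (sval X) (sval Y)).
Qed.

Lemma radcond_cosemisimple : radcond H H' -> cosemisimple (subcat_in D D').
Proof.
move=> HH' X Y f; rewrite -[f]quothom_reprK.
set f0 : @hom (fullsub D) X Y := generic_quotient.repr f.
move=> /quot_radicalP frad; apply/quothom_pi_eq0.
apply/factor_in; pose F : {linear carrier (sval X) -> carrier (sval Y)} := f0.
have DX := svalP X; have DY := svalP Y.
have [m [y [w yw]]] := carrier_dual (sval Y).
(* The radical is tested against rank one maps y -> w_k(y)T with T = ax. The composite with F is t
   -> al(t)T, and al(T) = a w_k(F x). *)
have crad k x : rad_mod H' (w k (F x)).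
  move=> a; pose T := a *: x; pose al : {linear carrier (sval X) -> R^o} := w k \o F.
  pose g : {linear carrier (sval Y) -> carrier (sval X)} := orbit_map T \o w k.
  have [u [ul ur]] := frad (g : @hom (fullsub D) Y X).
  pose U : {linear carrier (sval X) -> carrier (sval X)} := u.
  pose F1 t := t - (al t : R) *: T.
  have {}ul t : act H' (submod_full (carrier (sval X))) (U (F1 t) - t).
    exact: (proj1 (factor_in _) ul t).
  have {}ur t : act H' (submod_full (carrier (sval X))) (F1 (U t) - t).
    exact: (proj1 (factor_in _) ur t).
  have alT : a * w k (F x) = al T by rewrite /T linearZ_LR.
  have E1 : al (U (F1 T) - T) = (1 - (al T : R)) * (al (U T) : R) - (al T : R).
    have -> : F1 T = (1 - (al T : R)) *: T by rewrite scalerBl scale1r.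
    by rewrite [LHS]linearB [U _]linearZ_LR [al (_ *: _)]linearZ_LR.
  have E2 : al (F1 (U T) - T) = (al (U T) : R) * (1 - (al T : R)) - (al T : R).
    rewrite [LHS]linearB [al (F1 _)]linearB [al (_ *: _)]linearZ_LR.
    by rewrite mulrBr mulr1.
  have ringE (p q r : R) : q - p = r -> 1 - (1 - p + q) = - r.
    by move=> <-; rewrite opprD opprB addrA subrKC opprB.
  (* If U inverts 1 - (T tensor al) modulo D', then 1 + al(UT) inverts the scalar 1 - al(T) modulo
     H'. *)
  exists (1 + (al (U T) : R)); rewrite alT; split.
    rewrite mulrDr mulr1 (ringE _ _ _ (esym E1)) -sub0r; apply: idealB; first exact: ideal0.
    exact: act_functional (ul T).
  rewrite mulrDl mul1r (ringE _ _ _ (esym E2)) -sub0r; apply: idealB; first exact: ideal0.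
  exact: act_functional (ur T).
(* Now F(hx) is a sum of h w_k(F x) y_k with h in H, w_k(F x) in the radical and y_k in HY, which is
   where [radcond] applies. *)
suff Fx x : act H (submod_full (carrier (sval X))) x ->
    act H' (submod_full (carrier (sval Y))) (F x).
  by move=> x; apply: Fx; apply: (proj1 (link_hfull HD _) DX).
apply: (act_sub_ind (W := submod_preim F (act H' (submod_full (carrier (sval Y)))))).
move=> h {}x Hh _; change (act H' (submod_full (carrier (sval Y))) (F (h *: x))).
rewrite linearZ_LR (yw (F x)) scaler_sumr.
apply: submod_sum => k; rewrite scalerA.
have := proj1 (link_hfull HD _) DY (y k) I.
move: (y k); apply: act_ind => [|u v Hu Hv|h' z Hh' _].
- by rewrite scaler0; apply: submod0.
- by rewrite scalerDr; apply: submodD.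
by rewrite scalerA; apply: act_in => //; apply: HH'.
Qed.

(** For elements v(z) and v'(z') of H, the map t -> v(t)jz' is radical modulo D' because j is
    radical modulo H'. Cosemisimplicity makes it factor through D', and its value at z, seen through
    v', is the product v(z)jv'(z'). *)
Lemma cosemisimple_radcond : cosemisimple (subcat_in D D') -> radcond H H'.
Proof.
move=> css _ j _ /HD[Z [DZ [z [v <-]]]] jrad /HD[Z' [DZ' [z' [v' <-]]]].
pose X : fullsub D := exist _ Z DZ; pose Y : fullsub D := exist _ Z' DZ'.
pose f : {linear carrier Z -> carrier Z'} := orbit_map (j *: z') \o v.
have fE : act H' (submod_full (carrier Z')) (f z).
  apply: (proj1 (@factor_in X Y (f : @hom (fullsub D) X Y))).
  apply/quothom_pi_eq0; apply: css.
  apply/quot_radicalP => g; pose G : {linear carrier Z' -> carrier Z} := g.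
  pose T := j *: G z'; have [b [bl br]] := proj1 (rad_mod_sym H' j) jrad (v (G z')).
  have vT : v T = j * v (G z') by rewrite linearZ_LR.
  (* The inverse of 1 - (T tensor v) is 1 + (bT tensor v), where b inverts the scalar 1 - v(T). *)
  pose U : {linear carrier Z -> carrier Z} :=
    (idfun : {linear _ -> _}) \+ (orbit_map (b *: T) \o v).
  have gf t : G (f t) = (v t : R) *: T by rewrite /f /= !linearZ_LR.
  have UE t : U t = t + (v t * b) *: T by rewrite /U /= scalerA.
  exists (U : @hom (fullsub D) X X); split; apply/factor_in => t.
    change (act H' (submod_full (carrier Z)) (U (t - G (f t)) - t)).
    rewrite UE gf linearB linearZ_LR.
    have -> : t - (v t : R) *: T + ((v t - (v t : R) *: v T) * b) *: T - t =
        (- ((v t : R) * (1 - (1 - j * (v (G z') : R)) * b))) *: T.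
      rewrite -vT -(addrA t) addrAC subrr add0r -scaleNr -scalerDl; congr (_ *: T).
      rewrite mulrBr mulr1 opprB addrC; congr (_ - _).
      by rewrite mulrA mulrBr mulr1.
    apply: act_in => //; rewrite -sub0r; apply: idealB; first exact: ideal0.
    exact: idealMl bl.
  change (act H' (submod_full (carrier Z)) ((U t - G (f (U t))) - t)).
  have vU : v (U t) = (v t : R) + (v t : R) * b * (v T : R) by rewrite UE linearD linearZ_LR.
  rewrite gf vU UE.
  have -> : t + (v t * b) *: T - ((v t : R) + (v t : R) * b * (v T : R)) *: T - t =
      (- ((v t : R) * (1 - b * (1 - j * (v (G z') : R))))) *: T.
    rewrite -vT -(addrA t) addrAC subrr add0r -scalerBl; congr (_ *: T).
    rewrite mulrBr mulr1 opprB addrC opprD -addrA addrC; congr (_ - _).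
    by rewrite addrC mulrA mulrBr mulr1.
  apply: act_in => //; rewrite -sub0r; apply: idealB; first exact: ideal0.
  exact: idealMl br.
have := act_functional v' fE.
by rewrite /f /= !linearZ_LR scalerA.
Qed.

End Cosemisimple.

(** * Chains of ideals and chains of subcategories *)

Section FullSubcategoryOfIdeal.
Variable R : pzRingType.

Section Objects.
Variable H : ideal R.

Let hfull_obj (X : projcat R) := hfull H (submod_full (carrier X)).

Fact hfull_obj_iso X Y : isomorphic X Y -> hfull_obj X -> hfull_obj Y.
Proof.
move=> [f [g [_ fg]]]; apply: (hfull_onto (f := happ f)) => y.
by exists (happ g y); apply: (happ_eq fg y).
Qed.
Fact hfull_obj_zero X : zero_object X -> hfull_obj X.
Proof. by move=> X0 x _; rewrite -[x](happ_eq (esym X0)); apply: submod0. Qed.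
Fact hfull_obj_sum X Y Z : biproduct X Y Z ->
  hfull_obj X -> hfull_obj Y -> hfull_obj Z.
Proof.
move=> [i [j [p [q [_ _ _ _ E]]]]] HX HY z _.
have -> : z = happ i (happ p z) + happ j (happ q z) by rewrite -[LHS](happ_eq E).
by apply: submodD; [apply: act_map (HX (happ p z) I)|apply: act_map (HY (happ q z) I)].
Qed.
Fact hfull_obj_summand X Y Z : biproduct X Y Z -> hfull_obj Z -> hfull_obj X.
Proof.
move=> [i [j [p [q [pi _ _ _ _]]]]]; apply: (hfull_onto (f := happ p)) => x.
by exists (happ i x); apply: (happ_eq pi x).
Qed.

Definition hfull_subcat : subcat (projcat R) :=
  Subcat hfull_obj_iso hfull_obj_zero hfull_obj_sum hfull_obj_summand.

(** Projectivity on one side supplies a full object whose functionals reach all of H: the left ideal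
    H itself, or the dual object of the right ideal H. *)
Lemma link_hfull_subcat : idem_ideal H -> dualL H \/ dualR H -> link H hfull_subcat.
Proof.
move=> Hid dH a; split=> [Ha|[Z [HZ [z [v <-]]]]]; last first.
  exact: act_functional (HZ z I).
case: dH => [/dualLP b|dH].
  exists (mkobj b); split; first exact/hfull_submodP.
  by exists (to_submod (V := ideal_left H) Ha), (sval_lin (ideal_left H)).
have [Y [z [HY ext _]]] := dual_object dH Hid.
have [|w wE] := ext R^o a; last by exists Y; split=> //; exists z, w.
have -> : a = a *: (1 : R^o) by rewrite [RHS](mulr1 a).
exact: act_in.
Qed.

End Objects.

Section LinkedChains.
Variables (n : nat) (H : nat -> ideal R) (D : nat -> subcat (projcat R)).
Hypothesis HD : forall i, (i <= n)%N -> link (H i) (D i).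
Hypotheses (H0 : forall x, H 0 x) (Hn : forall x, H n x -> x = 0).
Hypothesis Hdec : forall i, (i < n)%N -> H i.+1 `<=` H i.

Lemma linked_subcat_chain : subcat_chain n D.
Proof.
split=> [X|X /(link_hfull (HD (leqnn n))) HX|i lin X].
- apply/(link_hfull (HD (leq0n n))) => x _; rewrite -[x]scale1r.
  exact: act_in.
- apply: homP => x; change (x = 0); have := HX x I.
  move: x {HX}; apply: act_ind => // [u v -> ->|h y /Hn -> _]; first by rewrite addr0.
  by rewrite scale0r.
move/(link_hfull (HD lin)) => HX; apply/(link_hfull (HD (ltnW lin))) => x /HX.
by apply: act_mono => //; apply: Hdec.
Qed.

Lemma linked_cosemisimple i : (i < n)%N ->
  cosemisimple (subcat_in (D i) (D i.+1)) <-> radcond (H i) (H i.+1).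
Proof.
move=> lin; have [_ _ DD] := linked_subcat_chain.
split; last by apply: radcond_cosemisimple (HD (ltnW lin)) (HD lin) (DD i lin).
exact: cosemisimple_radcond (HD (ltnW lin)) (HD lin) (DD i lin).
Qed.

Lemma linked_total_right : total_right_rejective_chain n D <->
  forall i, (i < n)%N -> dualL (H i.+1) /\ radcond (H i) (H i.+1).
Proof.
split=> [[_ DP] i lin|HP].
  have [rD cD] := DP i lin; split; first exact/(right_rejective_dualL (HD lin)).
  exact/linked_cosemisimple.
split=> [|i lin]; first exact: linked_subcat_chain.
have [dH rH] := HP i lin; split; first exact/(right_rejective_dualL (HD lin)).
exact/linked_cosemisimple.
Qed.

Lemma linked_total_left : total_left_rejective_chain n D <->
  forall i, (i < n)%N -> dualR (H i.+1) /\ radcond (H i) (H i.+1).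
Proof.
split=> [[_ DP] i lin|HP].
  have [rD cD] := DP i lin; split; first exact/(left_rejective_dualR (HD lin)).
  exact/linked_cosemisimple.
split=> [|i lin]; first exact: linked_subcat_chain.
have [dH rH] := HP i lin; split; first exact/(left_rejective_dualR (HD lin)).
exact/linked_cosemisimple.
Qed.

End LinkedChains.

(* A chain of idempotent ideals, not necessarily strict. *)
Definition weak_chain n (H : nat -> ideal R) :=
  [/\ forall x, H 0 x, forall x, H n x -> x = 0,
      forall i, (i < n)%N -> H i.+1 `<=` H i,
      forall i, (i <= n)%N -> idem_ideal (H i) &
      forall i, (i < n)%N -> radcond (H i) (H i.+1)].

Lemma trace_weak_chain n D : subcat_chain n D ->
  (forall i, (i < n)%N -> cosemisimple (subcat_in (D i) (D i.+1))) ->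
  weak_chain n (fun i => trace_ideal (D i)).
Proof.
move=> [D0 Dn Ddec] css.
have H0 x : trace_ideal (D 0%N) x.
  exists (ring_obj R); split; first exact: D0.
  by exists (1 : R^o), (orbit_map (x : R^o)); apply: mul1r.
have Hn x : trace_ideal (D n) x -> x = 0.
  move=> [Z [/Dn Z0 [z [v <-]]]].
  have -> : z = 0 by rewrite -[z](happ_eq (esym Z0)).
  by rewrite linear0.
have Hdec i : (i < n)%N -> trace_ideal (D i.+1) `<=` trace_ideal (D i).
  by move=> lin x [Z [DZ xE]]; exists Z; split=> //; apply: Ddec.
split=> // [i _|i lin]; first exact: (link_idem (D := D i)).
by apply: (proj1 (linked_cosemisimple (n := n) (D := D) _ H0 Hn Hdec lin)) => //; apply: css.
Qed.

Lemma exists_total_right :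
  (exists n D, @total_right_rejective_chain (projcat R) n D) <->
  exists n H, weak_chain n H /\ forall i, (i <= n)%N -> dualL (H i).
Proof.
split=> [[n [D [Dc DP]]]|[n [H [[H0 Hn Hdec Hid Hrad] dH]]]].
  have [|H0 _ _ _ _] := @trace_weak_chain n D Dc; first by move=> i /DP[].
  exists n, (fun i => trace_ideal (D i)); split.
    by apply: trace_weak_chain => // i /DP[].
  move=> [|i] lin; first exact: dualL_full.
  by have [rD _] := DP i lin; apply/(right_rejective_dualL (D := D i.+1)).
exists n, (fun i => hfull_subcat (H i)).
apply/(linked_total_right (H := H)) => // i lin.
  by apply: link_hfull_subcat; [apply: Hid | left; apply: dH].
by split; [apply: dH | apply: Hrad].
Qed.

Lemma exists_total_left :
  (exists n D, @total_left_rejective_chain (projcat R) n D) <->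
  exists n H, weak_chain n H /\ forall i, (i <= n)%N -> dualR (H i).
Proof.
split=> [[n [D [Dc DP]]]|[n [H [[H0 Hn Hdec Hid Hrad] dH]]]].
  have [|H0 _ _ _ _] := @trace_weak_chain n D Dc; first by move=> i /DP[].
  exists n, (fun i => trace_ideal (D i)); split.
    by apply: trace_weak_chain => // i /DP[].
  move=> [|i] lin; first exact: dualR_full.
  by have [rD _] := DP i lin; apply/(left_rejective_dualR (D := D i.+1)).
exists n, (fun i => hfull_subcat (H i)).
apply/(linked_total_left (H := H)) => // i lin.
  by apply: link_hfull_subcat; [apply: Hid | right; apply: dH].
by split; [apply: dH | apply: Hrad].
Qed.

Lemma rejective_chain_total n D : @rejective_chain (projcat R) n D ->
  total_right_rejective_chain n D /\ total_left_rejective_chain n D.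
Proof.
move=> [Dc DP]; have [D0 _ Ddec] := Dc.
suff rD i : (i <= n)%N -> rejective (D i).
  by split; split=> // i lin; have [cD _] := DP i lin; have [] := rD _ lin.
elim: i => [_|i IHi lin].
  split; [apply/right_rejectiveP | apply/left_rejectiveP] => X; exists X, (idm X); split=> //.
  - by move=> Z g h; rewrite !comp1m.
  - by move=> Z g _; exists g; rewrite comp1m.
  - by move=> Z g h; rewrite !compm1.
  - by move=> Z g _; exists g; rewrite compm1.
have [_ [rE lE]] := DP i lin; have rDi := IHi (ltnW lin); split.
  exact: right_rejective_trans (Ddec i lin) rDi rE.
exact: left_rejective_trans (Ddec i lin) rDi lE.
Qed.

Lemma exists_rejective :
  (exists n D, @rejective_chain (projcat R) n D) <->
  exists n H, weak_chain n H /\ forall i, (i <= n)%N -> dualL (H i) /\ dualR (H i).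
Proof.
split=> [[n [D Drej]]|[n [H [[H0 Hn Hdec Hid Hrad] dH]]]].
  have [[Dc DR] [_ DL]] := rejective_chain_total Drej.
  have Hc : weak_chain n (fun i => trace_ideal (D i)).
    by apply: trace_weak_chain => // i /DR[].
  have [H0 _ _ _ _] := Hc; exists n, (fun i => trace_ideal (D i)); split=> //.
  move=> [|i] lin; first by split; [apply: dualL_full | apply: dualR_full].
  have [rD _] := DR i lin; have [lD _] := DL i lin; split.
    exact/(right_rejective_dualL (D := D i.+1)).
  exact/(left_rejective_dualR (D := D i.+1)).
have HD i : (i <= n)%N -> link (H i) (hfull_subcat (H i)).
  by move=> lin; apply: link_hfull_subcat; [apply: Hid | left; case: (dH i lin)].
exists n, (fun i => hfull_subcat (H i)).
have Dc := linked_subcat_chain HD H0 Hn Hdec; have [_ _ Ddec] := Dc.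
split=> // i lin; have [dL dR] := dH i.+1 lin; split.
  exact/(linked_cosemisimple HD)/Hrad.
split; [apply: right_rejective_sub | apply: left_rejective_sub]; try exact: Ddec.
  exact/(right_rejective_dualL (HD _ lin)).
exact/(left_rejective_dualR (HD _ lin)).
Qed.

End FullSubcategoryOfIdeal.

(** * The trace ideal of add eA is AeA *)

Section IdempotentLink.
Variables (A : pzRingType) (e : A) (ee : e * e = e) (H : ideal A).
Hypothesis HE : (H : set A) = setmul (setmul setT (set1 e)) setT.

Let N : submod (A^c)^o :=
  @Submod A^c (A^c)^o (fun x => exists a : A, x = e * a) (emod0 e) (@emodP A e).

Lemma emod_ideal (x y : A) : H (x * e * y).
Proof.
rewrite -[H _]/((H : set A) _) HE; apply/setmulP; apply: addspan_gen; exists (x * e), y; split=> //.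
by apply/setmulP; apply: addspan_gen; exists x, e.
Qed.

Lemma emod_ideal_ind (Q : A -> Prop) : Q 0 -> (forall u v, Q u -> Q v -> Q (u + v)) ->
  (forall x y, Q (x * e * y)) -> forall a, H a -> Q a.
Proof.
move=> Q0 QD Qe a; rewrite -[H _]/((H : set A) _) HE => /setmulP/(_ Q); apply=> //.
move=> _ [u [y [/setmulP + _ ->]]] => /(_ (fun u => forall y, Q (u * y))); apply.
- by move=> {}y; rewrite mul0r.
- by move=> s t Qs Qt {}y; rewrite mulrDl; apply: QD.
- by move=> _ [x [_ [_ -> ->]]] {}y; apply: Qe.
Qed.

Lemma emod_dual_basis : dual_basis (emod e).
Proof.
apply: (@dual_basis_retract A^c (emod e) (A^c)^o) (@dual_basis_ring A^c).
have Ne b : N (orbit_map (e : (A^c)^o) b) by exists (b : A).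
have [p pP] := factor_inj (f := orbit_map (e : (A^c)^o)) (@sval_lin_inj A^c _ N)
  (fun b => ex_intro _ (to_submod (Ne b)) erefl).
exists (sval_lin N), p => y; apply: (@sval_lin_inj A^c _ N); rewrite pP.
have [a aE] := sval_linP y; rewrite [in LHS]aE [RHS]aE.
by change (e * (e * a) = e * a); rewrite mulrA ee.
Qed.

(** A functional u on eA satisfies u(eb) = u(e)eb, since e is idempotent; conversely xey is the
    value at ey of left multiplication by x. *)
Lemma link_emod : link (ideal_op H) (add_subcat (emod e)).
Proof.
move=> a; split; last first.
  move=> [Z [/add_modP[m [i [p pi]]] [z [v <-]]]].
  have uH (u : {linear emod e -> (A^c)^o}) (y : emod e) : H (u y).
    have [b bE] := @sval_linP A^c _ N y.
    have Nee : N e by exists 1; rewrite mulr1.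
    have -> : y = (b : A^c) *: (to_submod Nee : emod e) by apply: (@sval_lin_inj A^c _ N).
    rewrite linearZ_LR.
    have -> : to_submod Nee = (e : A^c) *: to_submod Nee.
      by apply: (@sval_lin_inj A^c _ N); change (e = e * e); rewrite ee.
    rewrite linearZ_LR; exact: emod_ideal.
  rewrite -(pi z).
  have dl (k : 'I_m) : linear (fun y : emod e =>
      [ffun l => if l == k then y else 0] : {ffun 'I_m -> emod e}).
    by move=> b s t; apply/ffunP => l; rewrite !ffunE; case: eqP => // _;
      rewrite scaler0 addr0.
  have -> : i z = \sum_k mk_linear (dl k) (i z k).
    apply/ffunP => l; rewrite sum_ffunE (bigD1 l) //= big1 ?addr0 ?ffunE ?eqxx //.
    by move=> k /negPf kl; rewrite ffunE eq_sym kl.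
  rewrite !linear_sum; apply: (ideal_sum (H := H)) => k.
  exact: (uH (v \o (p \o mk_linear (dl k)))).
pose Z := mkobj emod_dual_basis.
have DZ : add_subcat (emod e) Z.
  apply/add_modP; exists 1%N.
  have cl : linear (fun y : emod e => [ffun=> y] : {ffun 'I_1 -> emod e}).
    by move=> b s t; apply/ffunP => l; rewrite !ffunE.
  have dl : linear (fun y : {ffun 'I_1 -> emod e} => y ord0).
    by move=> b s t; rewrite !ffunE.
  by exists (mk_linear cl), (mk_linear dl) => y; rewrite /= ffunE.
move: a; apply: (emod_ideal_ind (Q := trace_set (add_subcat (emod e)))).
- exact: trace0.
- by move=> u v; apply: (idealD (H := trace_ideal (add_subcat (emod e)))).
move=> x y; exists Z; split=> //.
have Ny : N (e * y) by exists y.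
exists (to_submod Ny), (orbit_map (x : (A^c)^o) \o sval_lin N).
by change (x * (e * y) = x * e * y); rewrite mulrA.
Qed.

End IdempotentLink.

(** * From standard modules to chains of ideals *)

Section ProjectiveCovers.
Variable R : pzRingType.
Implicit Types M N P S X : lmodType R.

Lemma cover_max P S : simple S -> projective_cover P S ->
  exists p : {linear P -> S}, onto p /\
    forall V : submod P, (exists2 x, V x & p x <> 0) -> forall x, V x.
Proof.
move=> sS [_ [_ [p [pO psup]]]]; exists p; split=> // V [x Vx px].
apply: psup => y; have [H|H] := simple_submod (submod_im p V) sS.
  by case: px; apply: H; exists x.
by have [u Vu uE] := H (p y); exists u => //; rewrite linearB uE subrr.
Qed.

Lemma cover_simple_quot P S N (g : {linear P -> N}) :
  simple S -> projective_cover P S -> simple N -> (exists x, g x <> 0) -> miso N S.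
Proof.
move=> sS /(cover_max sS)[p [pO pmax]] sN [x gx].
have [x' gx'|h hE] := factor_onto (f := p) (simple_onto sN (ex_intro _ x gx)).
  apply: contrapT => px; apply: gx.
  by apply: (pmax (ker g)); exists x'.
apply: (schur (f := h)) => //; have [y y0] := simple_neq0 sS.
by have [z zE] := pO y; exists (g z); rewrite hE zE.
Qed.

Lemma cover_lift P S X (g : {linear X -> S}) : projective_cover P S -> projective X ->
  onto g -> exists h : {linear X -> P}, onto h.
Proof.
move=> [_ [_ [p [pO psup]]]] pX gO; have [h hE] := pX _ _ p g pO.
exists h => y; suff [x _ xE] : submod_im h (submod_full X) y by exists x.
apply: psup => z; have [x xE] := gO (p z).
by exists (h x); [exists x | rewrite linearB hE xE subrr].
Qed.

Lemma act_submod (H : ideal R) M (V : submod M) x :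
  act H V x -> submod_im (sval_lin V) (act H (submod_full _)) x.
Proof.
move: x; apply: act_sub_ind => h y Hh Vy.
by exists (h *: to_submod Vy); [apply: act_in | rewrite linearZ].
Qed.

Lemma act_onto (H : ideal R) M N (f : {linear M -> N}) y : onto f ->
  act H (submod_full N) y -> exists2 x, act H (submod_full M) x & f x = y.
Proof.
move=> fO; move: y; apply: (act_sub_ind (W := submod_im f (act H (submod_full M)))).
move=> h y Hh _; have [x <-] := fO y; exists (h *: x); first exact: act_in.
by rewrite linearZ.
Qed.

(** Full modules are closed under extensions; the terms are treated from the bottom of the
    filtration upwards. *)
Lemma hfull_layers (H : ideal R) M l (F : nat -> submod M) : filtration l F ->
  (forall t, (t < l)%N -> hfull H (submod_full (layer F t))) -> hfull H (submod_full M).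
Proof.
move=> [F0 Fl _] HF.
suff Ht t : (t <= l)%N -> forall x, F (l - t)%N x -> act H (submod_full M) x.
  move=> x _; apply: (Ht l) => //; rewrite subnn.
  by rewrite -[F _ _]/((F 0%N : set M) _) F0.
elim: t => [_|t IHt tl] x.
  by rewrite subn0 -[F _ _]/((F l : set M) _) Fl => ->; apply: submod0.
have tE : (l - t = (l - t.+1).+1)%N by rewrite subnSK.
set s := (l - t.+1)%N => Fx.
have sl : (s < l)%N by rewrite /s ltn_subrL (leq_ltn_trans _ tl).
pose q := qpi (submod_trace (F s) (F s.+1)).
have [w Hw /qpiP wE] := act_onto (f := q) (@qpi_onto _ _ _) (HF s sl (q (to_submod Fx)) I).
have Fxw : F s.+1 (x - sval_lin (F s) w).
  have := submodN wE; rewrite opprB.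
  by change (F s.+1 (x - sval_lin (F s) w) -> F s.+1 (x - sval_lin (F s) w)).
rewrite -(subrK (sval_lin (F s) w) x); apply: submodD.
  by apply: IHt; rewrite ?tE // ltnW.
exact: (act_map (f := sval_lin (F s))) Hw.
Qed.

Lemma act_fun_exists (H : ideal R) M N (f : {linear M -> N}) :
  exists g : {linear submod_type (act H (submod_full M)) -> submod_type (act H (submod_full N))},
    forall x, sval_lin _ (g x) = f (sval_lin _ x).
Proof.
apply: (factor_inj (f := f \o sval_lin _)); first exact: sval_lin_inj.
move=> x; have Hx := act_map (f := f) (W := submod_full N) (fun _ _ => I) (sval_linP x).
by exists (to_submod Hx).
Qed.

Lemma act_retract (H : ideal R) M N : retract M N ->
  retract (submod_type (act H (submod_full M))) (submod_type (act H (submod_full N))).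
Proof.
move=> [i [p pi]]; have [i' i'E] := act_fun_exists H i; have [p' p'E] := act_fun_exists H p.
by exists i', p' => x; apply: sval_lin_inj; rewrite p'E i'E.
Qed.

Lemma act_prod_retract (H : ideal R) M N :
  retract (submod_type (act H (submod_full (M * N)%type)))
    (submod_type (act H (submod_full M)) * submod_type (act H (submod_full N)))%type.
Proof.
have [f1 f1E] := act_fun_exists H (@pair_fst R M N : {linear _ -> _}).
have [f2 f2E] := act_fun_exists H (@pair_snd R M N : {linear _ -> _}).
have [g1 g1E] := act_fun_exists H (@pair_in1 R M N : {linear _ -> _}).
have [g2 g2E] := act_fun_exists H (@pair_in2 R M N : {linear _ -> _}).
exists ((@pair_in1 _ _ _ \o f1) \+ (@pair_in2 _ _ _ \o f2)), (pair_map g1 g2) => x.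
apply: sval_lin_inj; rewrite /= /pair_map /= addr0 add0r.
change (sval_lin _ (g1 (f1 x) + g2 (f2 x)) = sval_lin _ x).
rewrite linearD g1E g2E f1E f2E; case: (sval_lin _ x) => u v.
by congr pair; rewrite /= ?addr0 ?add0r.
Qed.

Lemma dual_basis_miso M N : miso M N -> dual_basis N -> dual_basis M.
Proof.
move=> MN; have [f [g fK gK]] := MN.
have gl : linear g by move=> a u v; apply: (can_inj fK); rewrite gK linearP !gK.
by apply: dual_basis_retract; exists f, (mk_linear gl).
Qed.

Lemma split_kernel X P (h : {linear X -> P}) (s : {linear P -> X}) :
  (forall y, h (s y) = y) ->
  exists2 k : {linear X -> submod_type (ker h)},
    (forall x, sval_lin _ (k x) = x - s (h x)) & forall y, k (sval_lin _ y) = y.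
Proof.
move=> hs; pose f : {linear X -> X} := (idfun : {linear X -> X}) \- (s \o h).
have fk x : ker h (f x) by change (h (x - s (h x)) = 0); rewrite linearB hs subrr.
have [k kE] := factor_inj (f := f) (@sval_lin_inj _ _ (ker h))
  (fun x => ex_intro _ (to_submod (fk x)) erefl).
exists k => // y; apply: sval_lin_inj; rewrite kE.
change (sval_lin _ y - s (h (sval_lin _ y)) = sval_lin _ y).
by rewrite (sval_linP y : h _ = 0) linear0 subr0.
Qed.

Lemma split_retract X P (h : {linear X -> P}) (s : {linear P -> X}) :
  (forall y, h (s y) = y) -> retract X (P * submod_type (ker h))%type.
Proof.
move=> hs; have [k kE _] := split_kernel hs.
exists ((@pair_in1 _ _ _ \o h) \+ (@pair_in2 _ _ _ \o k)), (pair_map s (sval_lin _)) => x.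
rewrite /= /pair_map /= addr0 add0r.
by change (s (h x) + sval_lin _ (k x) = x); rewrite kE addrC subrK.
Qed.

Lemma rad_kills (K : ideal R) N j : simple N -> (forall a y, K a -> a *: y = 0 :> N) ->
  rad_mod K j -> forall y : N, j *: y = 0.
Proof.
move=> sN KN Kj y; apply: contrapT => jy.
have [H|H] := simple_submod (cyc (j *: y)) sN.
  by apply: jy; apply: H; apply: cyc_id.
have [a aE] := H y; have [b [_ Kb]] := Kj a; apply: jy.
suff -> : y = 0 by rewrite scaler0.
have := KN _ y Kb; rewrite scalerBl scale1r -scalerA scalerBl scale1r -scalerA -aE.
by rewrite subrr scaler0 subr0.
Qed.

End ProjectiveCovers.

Section StronglyQuasiHereditaryToChain.
Variables (R : pzRingType) (Rf : finlen R^o).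
Variables (I : Type) (S P : I -> lmodType R) (le : I -> I -> Prop).
Variable K : forall i, submod (P i).
Hypothesis Scomp : complete_simples S.
Hypothesis Pcov : forall i, projective_cover (P i) (S i).
Hypothesis lePO : partial_order le.
Hypothesis Kst : forall i, standard_kernel S le i (K i).
Let Delta i : lmodType R := quotmod (K i).
Hypothesis Dmult : forall i, composition_mult (Delta i) (S i) 1.
Hypothesis Kfilt : forall i, delta_filtered Delta (submod_type (K i)).
Hypothesis Kmult : forall i j m,
  delta_mult Delta (submod_type (K i)) j m -> m <> 0%N -> le i j /\ i <> j.
Hypothesis Kproj : forall i, projective (submod_type (K i)).

Let Ssimple i : simple (S i).
Proof. by case: Scomp. Qed.

Let Pdual i : dual_basis (P i).
Proof. by apply/dual_basisP; case: (Pcov i) => ? []. Qed.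

Let Pfin i : finlen (P i).
Proof. by apply: finlen_fg => //; case: (Pcov i). Qed.

Section Trace.
Variable U : I -> Prop.

(** Generators of the trace of the P(j) with j in U. The family is not closed under direct sums, so
    the ideal needs the additive span. *)
Definition trace_gen (a : R) :=
  exists j (x : P j) (phi : {linear P j -> R^o}), U j /\ a = phi x.

Fact cover_traceB x y : addspan trace_gen x -> addspan trace_gen y -> addspan trace_gen (x - y).
Proof.
move=> Tx Ty; apply: addspanD Tx _.
apply: (addspan_map (f := -%R)) Ty; [exact: oppr0|exact: opprD|].
move=> _ [j [u [phi [Uj ->]]]]; apply: addspan_gen; exists j, (- u), phi.
by rewrite linearN.
Qed.
Fact cover_traceMl a x : addspan trace_gen x -> addspan trace_gen (a * x).
Proof.
apply: (addspan_map (f := *%R a)); [exact: mulr0|exact: mulrDr|].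
move=> _ [j [u [phi [Uj ->]]]]; apply: addspan_gen; exists j, (a *: u), phi.
by rewrite linearZ.
Qed.
Fact cover_traceMr a x : addspan trace_gen x -> addspan trace_gen (x * a).
Proof.
apply: (addspan_map (f := fun x => x * a)); [exact: mul0r| |].
  by move=> u v; apply: mulrDl.
move=> _ [j [u [phi [Uj ->]]]]; apply: addspan_gen; exists j, u.
by exists (orbit_map (a : R^o) \o phi).
Qed.

Definition cover_trace : ideal R :=
  Ideal (addspan0 (G := trace_gen)) cover_traceB cover_traceMl cover_traceMr.

Lemma cover_trace_in j (x : P j) (phi : {linear P j -> R^o}) :
  U j -> cover_trace (phi x).
Proof. by move=> Uj; apply: addspan_gen; exists j, x, phi. Qed.

Lemma cover_trace_hfull j : U j -> hfull cover_trace (submod_full (P j)).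
Proof.
move=> Uj y _; have [m [x [v xv]]] := Pdual j; rewrite (xv y).
by apply: submod_sum => k; apply: act_in => //; apply: cover_trace_in.
Qed.

Lemma cover_trace_idem : idem_ideal cover_trace.
Proof.
move=> a /(_ (act cover_trace (ideal_left cover_trace))); apply.
- exact: submod0.
- by move=> u v; apply: submodD.
move=> _ [j [x [phi [Uj ->]]]].
apply: (act_map (f := phi)) (cover_trace_hfull Uj (x := x) _) => // y _.
exact: cover_trace_in.
Qed.

End Trace.

(** The image hits a layer of a composition series, and the only simple quotient of P(j) is S(j);
    hence S(j) is a factor of the standard module. *)
Lemma hom_Delta i j (g : {linear P j -> Delta i}) : (exists x, g x <> 0) -> le j i.
Proof.
move=> g0; have [l [F Fc]] := composition_exists (finlen_quot (K i) (Pfin i)).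
have [Ff Fs] := Fc; have [t [tl _ [g' [_ g'0]]]] := filtration_hit Ff g0.
have LS := cover_simple_quot (Ssimple j) (Pcov j) (Fs t tl) g'0.
have [|j' le' LS'] := proj1 (Kst i) (layer F t).
  by exists l, F; split=> //; exists t => //; apply: miso_refl.
suff -> : j = j' by [].
case: Scomp => _ Sinj _; apply: Sinj.
exact: miso_trans (miso_sym LS) LS'.
Qed.

Section UpperSet.
Variable U : I -> Prop.
Hypothesis Uup : forall i j, U i -> le i j -> U j.

Lemma trace_Delta i : ~ U i -> act (cover_trace U) (submod_full (P i)) `<=` K i.
Proof.
move=> Ui; apply: act_sub_ind => h y Hh _.
move: Hh => /(_ (fun h => K i (h *: y))); apply.
- by rewrite scale0r; apply: submod0.
- by move=> u v Ku Kv; rewrite scalerDl; apply: submodD.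
move=> _ [j [x [phi [Uj ->]]]]; apply/qpi_eq0; apply: contrapT => H.
apply: Ui; apply: (Uup Uj).
by apply: (hom_Delta (g := qpi (K i) \o (orbit_map y \o phi))); exists x.
Qed.

Lemma Delta_neq0 i : exists x : P i, ~ K i x.
Proof.
have [l [F [[Ff _] F1]]] := Dmult i.
have /card_gt0P[t] : (0 < #|[set t : 'I_l | `[< miso (layer F t) (S i) >]]%SET|)%N.
  by rewrite -[#|_|]/(nb_layers l F (S i)) F1.
rewrite inE => /asboolP/miso_sym/(simple_miso (M := S i))/(_ (Ssimple i)) sL.
have [y y0] := simple_neq0 sL; have [w wE] := qpi_onto y.
have [x xE] := qpi_onto (sval_lin (F t) w); exists x => /qpi_eq0 x0.
apply: y0; rewrite -wE (_ : w = 0) ?linear0 //.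
by apply: sval_lin_inj; rewrite -xE x0 linear0.
Qed.

(** A nonzero projective X splits as P(i) plus ker h. The complement is shorter; for P(i), either i
    lies in U and HP(i) = P(i), or HP(i) = HK(i) with K(i) projective and again shorter than X. *)
Lemma trace_projective n X : length_le X n -> dual_basis X ->
  dual_basis (submod_type (act (cover_trace U) (submod_full X))).
Proof.
set H := cover_trace U.
elim/ltn_ind: n X => n IHn X Xn Xb.
have [X0|] := pselect (forall x : X, x = 0).
  exists 0%N, (fun=> 0), (fun=> \0) => y; rewrite big_ord0.
  by apply: sval_lin_inj; rewrite [LHS]X0 linear0.
move=> /existsNP[x0 x00].
have Xf : finlen X by exists n.
have [_ Xp] := proj1 (dual_basisP X) Xb.
have [V _ sV] := simple_quot_exists Xf (ex_intro _ x0 x00).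
have [i [f fI fO]] : exists i, exists2 f : {linear quotmod V -> S i}, injective f & onto f.
  by case: Scomp => _ _ /(_ _ sV)[i /miso_map]; exists i.
have gO : onto (f \o qpi V).
  by move=> y; have [z <-] := fO y; have [x <-] := qpi_onto z; exists x.
have [h hO] := cover_lift (Pcov i) Xp gO.
have Pp : projective (P i) by case: (Pcov i) => _ [].
have [s hs] := split_onto Pp hO.
have [k kE kK] := split_kernel hs.
(* As z is outside K(i), the element s(z) lies neither in ker h nor in s(K(i)); both are therefore
   properly embedded in X. *)
have [z Kz] := Delta_neq0 i.
have Xb' : dual_basis (submod_type (act H (submod_full (submod_type (ker h))))).
  have [|m mn Lm] := length_lt_inj (@sval_lin_inj _ _ (ker h)) _ Xn.
    move=> /(_ (s z))[y yE]; apply: Kz.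
    by rewrite -(hs z) -yE (sval_linP y : h _ = 0); apply: submod0.
  apply: IHn Lm _ => //; apply: dual_basis_retract Xb.
  by exists (sval_lin _), k.
have Pb : dual_basis (submod_type (act H (submod_full (P i)))).
  have [Ui|Ui] := pselect (U i).
    apply: dual_basis_miso (Pdual i); apply: (misoP (f := sval_lin _)).
      exact: sval_lin_inj.
    by move=> y; exists (to_submod (cover_trace_hfull Ui (x := y) Logic.I)).
  pose KM := submod_type (K i).
  have KMb : dual_basis KM.
    by apply/dual_basisP; split=> //; apply/fg_finlen/finlen_sub.
  have [||m mn Lm] := @length_lt_inj _ X KM (s \o sval_lin (K i)) n _ _ Xn.
  - move=> u v /= /(congr1 h); rewrite !hs; exact: sval_lin_inj.
  - move=> /(_ (s z))[y yE]; apply: Kz; rewrite -(hs z) -yE /= hs.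
    exact: sval_linP.
  have [q qE] := act_fun_exists H (sval_lin (K i)).
  apply: dual_basis_miso (IHn m mn _ Lm KMb); apply: miso_sym.
  apply: (misoP (f := q)) => [u v uv|y].
    do 2 apply: sval_lin_inj; rewrite -!qE uv //.
  (* HP(i) = H(HP(i)) is contained in HK(i), because HP(i) is contained in K(i). *)
  have /act_submod[w Hw wE] : act H (K i) (sval_lin _ y).
    apply: act_mono (act_hfull (cover_trace_idem (U := U)) (sval_linP y)) => //.
    exact: trace_Delta.
  by exists (to_submod Hw); apply: sval_lin_inj; rewrite qE.
apply: dual_basis_retract (dual_basis_prod Pb Xb').
apply: retract_trans (act_prod_retract H _ _).
exact/act_retract/(split_retract hs).
Qed.

Lemma cover_trace_dualL : dualL (cover_trace U).
Proof.
have [n Rn] := Rf; have := trace_projective Rn (@dual_basis_ring R).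
rewrite dualLP; suff -> : act (cover_trace U) (submod_full R^o) = ideal_left (cover_trace U) by [].
apply: submod_ext => x; split=> [|Hx].
  apply: act_sub_ind => h y Hh _; exact: idealMr.
have -> : x = (x : R) *: (1 : R^o) by exact: (esym (mulr1 (x : R))).
exact: act_in.
Qed.

End UpperSet.

(** K(i) is filtered by quotients of the P(j) with j strictly above i, and those are full for the
    trace of U. *)
Lemma K_hfull (U : I -> Prop) i : (forall j, le i j -> i <> j -> U j) ->
  hfull (cover_trace U) (K i).
Proof.
move=> Ui; apply/hfull_submodP; have [l [F FD]] := Kfilt i; have [Ff Fl] := FD.
apply: (hfull_layers Ff) => t tl; have [j LD] := Fl t tl.
have [||le_ij ij] := Kmult (i := i) (j := j) (m := nb_layers l F (Delta j)).
- by exists l, F.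
- apply/eqP; rewrite -lt0n; apply/card_gt0P; exists (Ordinal tl).
  by rewrite inE; apply/asboolP.
have [f _ fO] := miso_map (miso_sym LD).
apply: (hfull_onto fO); apply: (hfull_onto (@qpi_onto _ _ (K j))).
by apply: cover_trace_hfull; apply: Ui.
Qed.

(** The second hypothesis makes the part of U outside U' an antichain with everything strictly above
    it in U sent into U'. For i and i' there, a map from P(i) to the standard module of i' vanishes
    unless i = i'; if i = i', it vanishes because it passes through the radical element j. So the
    image lies in K(i'), which is full for H'. *)
Lemma cover_radcond (U U' : I -> Prop) : (forall i j, U' i -> le i j -> U' j) ->
  (forall i, ~ U' i -> forall j, le i j -> i <> j -> U i -> U' j) ->
  radcond (cover_trace U) (cover_trace U').
Proof.
move=> U'up UU'; set H' := cover_trace U'.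
suff main i i' (p : P i) (q : P i') (phi : {linear P i -> R^o}) j :
    U i -> U i' -> rad_mod H' j ->
    act H' (submod_full (P i')) (((phi p : R) * j) *: q).
  move=> x j y Hx Hj; move: x Hx => x /(_ (fun x => cover_trace U y -> H' (x * j * y))); apply.
  - by move=> _; rewrite !mul0r; apply: ideal0.
  - by move=> u v Hu Hv Hy; rewrite !mulrDl; apply: idealD; [apply: Hu | apply: Hv].
  move=> _ [i [p [phi [Ui ->]]]] /(_ (fun y => H' (phi p * j * y))); apply.
  - by rewrite mulr0; apply: ideal0.
  - by move=> u v Hu Hv; rewrite mulrDr; apply: idealD.
  move=> _ [i' [q [psi [Ui' ->]]]].
  have := act_functional psi (main i i' p q phi j Ui Ui' Hj).
  by rewrite linearZ_LR.
move=> Ui Ui' Hj.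
have [Ui''|nUi'] := pselect (U' i'); first exact: cover_trace_hfull.
pose f : {linear P i -> P i'} := orbit_map (j *: q) \o phi.
have fE x : f x = ((phi x : R) * j) *: q by rewrite /f /= scalerA.
rewrite -fE; have [Ui''|nUi] := pselect (U' i).
  exact: (act_map (f := f)) (cover_trace_hfull Ui'' (x := p) Logic.I).
suff fK x : K i' (f x).
  have := K_hfull (fun j le_ij ij => UU' i' nUi' j le_ij ij Ui') (fK p).
  exact: act_mono.
apply/qpi_eq0; apply: contrapT => fx.
pose g : {linear P i -> Delta i'} := qpi (K i') \o f.
have g0 : exists x, g x <> 0 by exists x.
have ii' : i = i'.
  apply: contrapT => ii'; apply: nUi'; apply: (UU' i) => //.
  exact: hom_Delta g0.
subst i'; have [l [F [Fc F1]]] := Dmult i; have [Ff Fs] := Fc.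
have [t [tl _ [g' [g'E g'0]]]] := filtration_hit Ff g0.
have [z Kz] := Delta_neq0 i.
have q0 : exists x, qpi (K i) x <> 0 by exists z => /qpi_eq0.
have [t' [t'l _ [q' [q'E q'0]]]] := filtration_hit Ff q0.
(* Both g and the projection reach a layer isomorphic to S(i), and S(i) occurs once. On that layer g
   is the projection followed by a multiple of j, and j kills a simple module killed by H'. *)
have uniq_t : t = t'.
  have := F1; rewrite /nb_layers => /eqP/cards1P[t0 tE].
  have H s (sl : (s < l)%N) (h : {linear P i -> layer F s}) :
      (exists x, h x <> 0) -> Ordinal sl = t0.
    move=> h0; suff : Ordinal sl \in [set t0]%SET by rewrite inE => /eqP.
    rewrite -tE inE; apply/asboolP.
    exact: cover_simple_quot (Ssimple i) (Pcov i) (Fs s sl) h0.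
  by have := H t tl g' g'0; rewrite -(H t' t'l q' q'0) => -[].
subst t'; have [y gy] := g'0; apply: gy; apply/g'E; apply/q'E.
rewrite fE -scalerA linearZ_LR linearZ_LR.
suff -> : j *: q' q = 0 by rewrite scaler0.
apply: (rad_kills (Fs t tl) _ Hj) => a w H'a.
have [v <-] := simple_onto (Fs t tl) q'0 w; rewrite -linearZ_LR; apply/q'E.
have -> : qpi (K i) (a *: v) = 0; last exact: submod0.
by apply/qpi_eq0; apply: (trace_Delta U'up nUi); apply: act_in.
Qed.

Lemma strongly_qh_weak_chain :
  exists n (H : nat -> ideal R), weak_chain n H /\ forall i, (i <= n)%N -> dualL (H i).
Proof.
have [le_refl le_anti le_trans] := lePO; have [_ Sinj Sall] := Scomp.
have [l [F Fc]] := composition_exists Rf; have [Ff Fs] := Fc.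
(* A nonzero functional on P(j) makes S(j) a factor of R, so only finitely many layers have to be
   inspected. *)
have occ j : exists2 t, (t < l)%N & miso (layer F t) (S j).
  have [m [x [v xv]]] := Pdual j; have [z Kz] := Delta_neq0 j.
  have [k vk] : exists k, v k z <> 0.
    apply: contrapT => H; apply: Kz; rewrite (xv z) big1 ?submod0 //; first exact: submod0.
    move=> k _; rewrite (_ : v k z = 0) ?scale0r //.
    by apply: contrapT => vk; apply: H; exists k.
  have [t [tl _ [g' [_ g'0]]]] := filtration_hit Ff (ex_intro _ z vk).
  by exists t => //; apply: cover_simple_quot (Ssimple j) (Pcov j) (Fs t tl) g'0.
pose above i : {set 'I_l} :=
  [set t : 'I_l | `[< exists2 j, le i j /\ i <> j & miso (layer F t) (S j) >]]%SET.
pose c i := #|above i|.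
have c_lt i j : le i j -> i <> j -> (c j < c i)%N.
  move=> ij nij; apply: proper_card; apply/properP; split.
    apply/fintype.subsetP => t; rewrite !inE => -[k [jk njk] Lk].
    exists k => //; split; first exact: le_trans jk.
    by move=> ik; apply: nij; apply: le_anti => //; rewrite ik.
  have [t tl Lt] := occ j; exists (Ordinal tl).
    by rewrite inE; apply/asboolP; exists j.
  rewrite inE; apply/negP => /asboolP[k [_ njk] Lk]; apply: njk.
  by apply: Sinj; apply: miso_trans (miso_sym Lt) Lk.
have c_le i j : le i j -> (c j <= c i)%N.
  by move=> ij; have [<-//|nij] := pselect (i = j); apply/ltnW/c_lt.
(* [c i] counts the layers of R whose simple is strictly above i, and it decreases strictly along
   the order. The level sets are thus antichains; [U 0] is everything because c is at most l, and
   [U l.+1] is empty. *)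
pose U s i := (c i < l.+1 - s)%N.
have Uup s i j : U s i -> le i j -> U s j.
  by move=> Ui /c_le ji; apply: leq_ltn_trans ji Ui.
exists l.+1, (fun s => cover_trace (U s)); split; last by move=> s _; apply: (cover_trace_dualL (Uup s)).
(* Otherwise a maximal left ideal W contains the trace. With R/W isomorphic to S(j), the cover P(j)
   -> S(j) lifts to a functional with values in the trace, hence in W, and so it would be zero. *)
have top1 : cover_trace (U 0%N) 1.
  apply: contrapT => H1.
  have [|W HW Wm] := @submod_zorn_maximal R (ideal_left (cover_trace (U 0%N))); first exact: H1.
  have [j LS] := Sall _ (simple_quot Wm).
  have [f fI fO] := miso_map (miso_sym LS).
  have [p [pO _]] := cover_max (Ssimple j) (Pcov j).
  have [_ [Pp _]] := Pcov j.
  have [phi phiE] := Pp _ _ (qpi W) (f \o p) (@qpi_onto _ _ W).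
  have [y y0] := simple_neq0 (Ssimple j); have [x xE] := pO y.
  apply: y0; apply: fI; rewrite linear0 -xE -[LHS]phiE; apply/qpi_eq0/HW.
  apply: cover_trace_in; rewrite /U subn0 ltnS.
  by rewrite -[X in (_ <= X)%N](card_ord l) max_card.
split.
- by move=> x; rewrite -[x]mulr1; apply: idealMl.
- move=> x /(_ (fun x => x = 0)); apply=> //; first by move=> u v -> ->; rewrite addr0.
  by move=> g [j [y [phi [+ _]]]]; rewrite /U subnn.
- move=> s _ x; apply: (addspan_map (f := id)) => // _ [j [y [phi [Uj ->]]]].
  apply: addspan_gen; exists j, y, phi; split=> //; apply: leq_trans Uj _.
  by rewrite leq_sub2l.
- by move=> s _; apply: cover_trace_idem.
move=> s sl; apply: cover_radcond; first exact: Uup.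
move=> i _ j ij nij Ui; apply: leq_trans (c_lt i j ij nij) _.
by rewrite -ltnS subnSK.
Qed.

End StronglyQuasiHereditaryToChain.

(** * From chains of ideals to standard modules *)

Section Representatives.
Variable R : pzRingType.

Lemma simple_cyclic (M : lmodType R) : simple M ->
  exists2 N : submod R^o, simple (quotmod N) & miso M (quotmod N).
Proof.
move=> sM; have [x x0] := simple_neq0 sM.
have xO : onto (orbit_map x).
  by apply: simple_onto => //; exists 1; rewrite /= scale1r.
have E := miso_sym (first_iso xO).
by exists (ker (orbit_map x)) => //; apply: simple_miso E sM.
Qed.

(** Every simple module is cyclic, so its isomorphism class is recorded by the set of left ideals N
    with R/N in the class; a representative is then chosen for each such set. *)
Lemma complete_simples_exist :
  exists (I : Type) (S : I -> lmodType R), complete_simples S.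
Proof.
pose cls (N N' : submod R^o) := miso (quotmod N') (quotmod N).
pose I := {Q : submod R^o -> Prop | exists2 N, simple (quotmod N) & Q = cls N}.
have ex (i : I) : exists N, simple (quotmod N) /\ sval i = cls N.
  by have [N sN E] := svalP i; exists N.
pose rep i := sval (cid (ex i)).
have repP i : simple (quotmod (rep i)) /\ sval i = cls (rep i) by apply: (svalP (cid (ex i))).
exists I, (fun i => quotmod (rep i)); split.
- by move=> i; case: (repP i).
- move=> i j ij; have E : sval i = sval j.
    rewrite (proj2 (repP i)) (proj2 (repP j)); apply/funext => N; apply/propext.
    by split=> H; apply: miso_trans H _ => //; apply: miso_sym.
  move: i j E {ij} => [Q QP] [Q' Q'P] /= E; subst Q'.
  by rewrite (Prop_irrelevance QP Q'P).
move=> M sM; have [N sN MN] := simple_cyclic sM.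
exists (exist _ (cls N) (ex_intro2 _ _ N sN erefl) : I); apply: miso_trans MN _.
set i := exist _ _ _; have [_ E] := repP i.
by have : cls (rep i) N by rewrite -E; apply: miso_refl.
Qed.

End Representatives.

Section ChainToStronglyQuasiHereditary.
Variables (R : pzRingType) (Rf : finlen R^o).
Variables (n : nat) (H : nat -> ideal R).
Hypotheses (Hc : weak_chain n H) (Hdual : forall i, (i <= n)%N -> dualL (H i)).

Let H0 x : H 0 x. Proof. by case: Hc. Qed.
Let Hn x : H n x -> x = 0. Proof. by case: Hc => _ + _ _ _; apply. Qed.
Let Hid i : (i <= n)%N -> idem_ideal (H i). Proof. by case: Hc => _ _ _ + _; apply. Qed.
Let Hrad i : (i < n)%N -> radcond (H i) (H i.+1). Proof. by case: Hc => _ _ _ _; apply. Qed.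

Let Hmono i j : (i <= j)%N -> (j <= n)%N -> H j `<=` H i.
Proof.
move=> ij jn; have [_ _ Hdec _ _] := Hc.
elim: j ij jn => [|j IHj]; first by rewrite leqn0 => /eqP -> _ x.
rewrite leq_eqVlt => /orP[/eqP -> _ x //|]; rewrite ltnS => ij jn x.
by move=> /(Hdec j jn); apply: IHj => //; apply: ltnW.
Qed.

Definition kills (K : ideal R) (M : lmodType R) := forall h (y : M), K h -> h *: y = 0.

Lemma kills_onto K (M N : lmodType R) (f : {linear M -> N}) : onto f -> kills K M -> kills K N.
Proof. by move=> fO KM h y Kh; have [x <-] := fO y; rewrite -linearZ_LR KM ?linear0. Qed.

Lemma kills_miso K (M N : lmodType R) : miso M N -> kills K M -> kills K N.
Proof. by move=> /miso_map[f _ fO]; apply: kills_onto fO. Qed.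

Lemma kills_hfull K (M : lmodType R) : kills K M -> hfull K (submod_full M) ->
  forall x : M, x = 0.
Proof.
move=> KM HM x; move: (HM x I); move: x.
by apply: act_ind => [//|u v -> ->|h y Kh _]; [rewrite addr0 | apply: KM].
Qed.

Lemma level_exists (M : lmodType R) : simple M ->
  exists l, [/\ (l < n)%N, ~ kills (H l) M & kills (H l.+1) M].
Proof.
move=> sM; have [x x0] := simple_neq0 sM.
have ex : exists l, `[< kills (H l) M >].
  by exists n; apply/asboolP => h y /Hn ->; rewrite scale0r.
case: (ex_minnP ex) => -[|l] /asboolP Hl lmin.
  by case: x0; rewrite -[x]scale1r; apply: Hl.
exists l; split=> //; last by move=> /asboolP/lmin; rewrite ltnn.
by apply: lmin; apply/asboolP => h y /Hn ->; rewrite scale0r.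
Qed.

Variables (J : Type) (S P : J -> lmodType R).
Hypothesis Scomp : complete_simples S.
Hypothesis Pcov : forall i, projective_cover (P i) (S i).

Let Ssimple i : simple (S i).
Proof. by case: Scomp. Qed.

Let lev i := sval (cid (level_exists (Ssimple i))).
Let lev_lt i : (lev i < n)%N.
Proof. by case: (svalP (cid (level_exists (Ssimple i)))). Qed.
Let lev_act i : ~ kills (H (lev i)) (S i).
Proof. by case: (svalP (cid (level_exists (Ssimple i)))). Qed.
Let lev_kills i : kills (H (lev i).+1) (S i).
Proof. by case: (svalP (cid (level_exists (Ssimple i)))). Qed.

Definition level_le i j := i = j \/ (lev i < lev j)%N.

Lemma level_le_order : partial_order level_le.
Proof.
split=> [i|i j|i j k]; first by left.
  by move=> [//|ij] [//|ji]; have := ltn_trans ij ji; rewrite ltnn.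
move=> [->//|ij] [<-|jk]; right=> //; exact: ltn_trans jk.
Qed.

Let Pdual i : dual_basis (P i).
Proof. by apply/dual_basisP; case: (Pcov i) => ? []. Qed.

Let Pproj i : projective (P i).
Proof. by case: (Pcov i) => _ []. Qed.

Let Pfin i : finlen (P i).
Proof. by apply: finlen_fg => //; case: (Pcov i). Qed.

Let K i : submod (P i) := act (H (lev i).+1) (submod_full (P i)).
Let Delta i : lmodType R := quotmod (K i).

Lemma Delta_kills i : kills (H (lev i).+1) (Delta i).
Proof.
move=> h y Hh; have [x <-] := qpi_onto y; rewrite -linearZ_LR.
by apply/qpi_eq0; apply: act_in.
Qed.

Lemma K_ker i (p : {linear P i -> S i}) x : K i x -> p x = 0.
Proof.
apply: (act_sub_ind (W := ker p)) => h y Hh _; change (p (h *: y) = 0).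
by rewrite linearZ_LR lev_kills.
Qed.

Lemma Delta_nonzero i : exists x : Delta i, x <> 0.
Proof.
have [p [pO _]] := cover_max (Ssimple i) (Pcov i).
have [y y0] := simple_neq0 (Ssimple i); have [x xE] := pO y.
by exists (qpi (K i) x) => /qpi_eq0/(K_ker p); rewrite xE.
Qed.

(** H_l does not kill S(i), so H_l P(i) is not inside the largest proper submodule. *)
Lemma cover_hfull i : hfull (H (lev i)) (submod_full (P i)).
Proof.
have [p [pO pmax]] := cover_max (Ssimple i) (Pcov i).
move=> x _; apply: pmax.
have /existsNP[h /existsNP[y /not_implyP[Hh hy]]] := lev_act (i := i).
have [z zE] := pO y; exists (h *: z); first exact: act_in.
by rewrite linearZ_LR zE.
Qed.

Lemma Delta_level i t : (t <= n)%N -> hfull (H t) (submod_full (Delta i)) -> (t <= lev i)%N.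
Proof.
move=> tn HD; rewrite leqNgt; apply/negP => lt.
have [x x0] := Delta_nonzero i; apply: x0; apply: kills_hfull HD x.
by move=> h y Hh; apply: Delta_kills; apply: Hmono Hh.
Qed.

(** The left inverse b of 1 - ac equals 1 + bac and so has a left inverse too, which makes it
    two-sided. *)
Lemma left_inverse_rad (L : ideal R) c :
  (forall a, exists b, b * (1 - a * c) = 1) -> rad_mod L c.
Proof.
move=> linv a; have [b bE] := linv a; have [d dE] := linv (- (b * a)).
have E : 1 - - (b * a) * c = b.
  by rewrite mulNr opprK -{1}bE mulrBr mulr1 mulrA subrK.
rewrite E in dE; exists b; rewrite bE subrr.
have -> : 1 - a * c = d by rewrite -[LHS]mul1r -[X in X * _ = _]dE -mulrA bE mulr1.
by rewrite dE subrr; split; apply: ideal0.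
Qed.

(* ker p is superfluous, so its images in R lie in the Jacobson radical. *)
Lemma cover_ker_rad i (p : {linear P i -> S i}) (L : ideal R)
    (v : {linear P i -> R^o}) x :
  (forall V : submod (P i), (exists2 x, V x & p x <> 0) -> forall x, V x) ->
  p x = 0 -> (exists y, p y <> 0) -> rad_mod L (v x).
Proof.
move=> pmax px [y0 py0]; apply: left_inverse_rad => a.
pose W := cyc (1 - a * (v x : R) : R^o).
suff [b bE] : W 1 by exists b; apply: esym.
suff HW y : W (v y).
  have -> : (1 : R^o) = (1 - a * (v x : R)) + a * (v x : R) by exact: (esym (subrK _ (1 : R))).
  apply: submodD; first exact: cyc_id.
  exact: (submodZ a (HW x)).
apply: (pmax (submod_preim v W)).
exists (y0 - ((v y0 : R) * a) *: x); last by rewrite linearB linearZ_LR px scaler0 subr0.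
exists (v y0 : R); rewrite linearB linearZ_LR.
by change ((v y0 : R) - (v y0 : R) * a * (v x : R) = (v y0 : R) * (1 - a * (v x : R)));
  rewrite mulrBr mulr1 mulrA.
Qed.

(** H_l kills the radical of the standard module: x has radical coordinates v_k(x), the y_k lie in
    H_l P(i), and H_l rad H_l falls into H_(l+1). *)
Lemma cover_rad_act i (p : {linear P i -> S i}) x h :
  (forall V : submod (P i), (exists2 x, V x & p x <> 0) -> forall x, V x) ->
  p x = 0 -> (exists y, p y <> 0) -> H (lev i) h -> K i (h *: x).
Proof.
move=> pmax px py Hh; have [m [y [v yv]]] := Pdual i.
rewrite (yv x) scaler_sumr; apply: submod_sum => k; rewrite scalerA.
have := cover_hfull (x := y k) I; move: (y k).
apply: act_ind => [|u w Ku Kw|h' z Hh' _].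
- by rewrite scaler0; apply: submod0.
- by rewrite scalerDr; apply: submodD.
rewrite scalerA; apply: act_in => //; apply: Hrad => //.
exact: (cover_ker_rad (p := p)).
Qed.

(** A layer not killed by H_l cannot come from a term inside the radical; by locality its term is
    the whole module. Hence S(i) occurs only at the top, and all other factors have lower level. *)
Lemma series_top i l (F : nat -> submod (Delta i)) t : composition_series l F ->
  (t < l)%N -> ~ kills (H (lev i)) (layer F t) ->
  (forall y, F t y) /\ miso (layer F t) (S i).
Proof.
move=> [Ff Fs] tl nk.
have [p [pO pmax]] := cover_max (Ssimple i) (Pcov i).
have py : exists y, p y <> 0.
  by have [y y0] := simple_neq0 (Ssimple i); have [x xE] := pO y; exists x; rewrite xE.
have Ftop y : F t y.
  have [x <-] := qpi_onto y; apply: (pmax (submod_preim (qpi (K i)) (F t))).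
  apply: contrapT => Hp; apply: nk => h z Hh; have [w <-] := qpi_onto z.
  rewrite -linearZ_LR; apply/qpi_eq0; change (F t.+1 (sval_lin (F t) (h *: w))).
  have [u uE] := qpi_onto (sval_lin (F t) w).
  have -> : sval_lin (F t) (h *: w) = 0; last exact: submod0.
  rewrite linearZ_LR -uE -linearZ_LR; apply/qpi_eq0; apply: (cover_rad_act pmax) => //.
  apply: contrapT => pu; apply: Hp; exists u => //.
  by change (F t (qpi (K i) u)); rewrite uE; apply: sval_linP.
split=> //.
have [g gP] := factor_inj (f := qpi (K i)) (@sval_lin_inj _ _ (F t))
  (fun x => ex_intro _ (to_submod (Ftop (qpi (K i) x))) erefl).
apply: (cover_simple_quot (g := qpi (submod_trace (F t) (F t.+1)) \o g)
  (Ssimple i) (Pcov i) (Fs t tl)).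
have [y y0] := simple_neq0 (Fs t tl); have [w wE] := qpi_onto y.
have [x xE] := qpi_onto (sval_lin (F t) w); exists x.
change (qpi (submod_trace (F t) (F t.+1)) (g x) <> 0).
suff -> : g x = w by rewrite wE.
by apply: sval_lin_inj; rewrite gP.
Qed.

Lemma layer_kills (L : ideal R) (M : lmodType R) (F : nat -> submod M) t :
  kills L M -> kills L (layer F t).
Proof.
move=> LM h z Lh; have [w <-] := qpi_onto z; rewrite -linearZ_LR.
have -> : h *: w = 0 by apply: sval_lin_inj; rewrite linearZ_LR LM // linear0.
exact: linear0.
Qed.

Lemma Delta_factors i : factors_le S level_le i (Delta i).
Proof.
move=> N [l [F [Fc [t tl LN]]]]; have [Ff Fs] := Fc.
have [_ Sinj Sall] := Scomp.
have [j NS] := Sall N (simple_miso LN (Fs t tl)); exists j => //.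
have LS := miso_trans LN NS.
have ji : (lev j <= lev i)%N.
  rewrite leqNgt; apply/negP => ij; apply: (lev_act (i := j)); apply: kills_miso LS _.
  move=> h y Hh; apply: (layer_kills (t := t) (F := F) (@Delta_kills i) y).
  exact: Hmono ij (ltnW (lev_lt j)) _ Hh.
move: ji; rewrite leq_eqVlt => /orP[/eqP ji|]; last by right.
have [|_ LS'] := series_top Fc tl.
  by move=> /(kills_miso LS); rewrite -ji; apply: lev_act.
by left; apply: Sinj; apply: miso_trans (miso_sym LS) LS'.
Qed.

Lemma K_standard i : standard_kernel S level_le i (K i).
Proof.
split=> [|V VS]; first exact: Delta_factors.
pose L := H (lev i).+1; pose M := quotmod V.
have [l [F Fc]] := composition_exists (finlen_quot V (Pfin i)); have [Ff Fs] := Fc.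
have Fk t h y : (t < l)%N -> L h -> F t y -> F t.+1 (h *: y).
  move=> tl Lh Fy; have [|j ji LS] := VS (layer F t).
    by exists l, F; split=> //; exists t => //; apply: miso_refl.
  have kL : kills L (layer F t).
    apply: kills_miso (miso_sym LS) _ => a z La; apply: lev_kills.
    by case: ji => [->//|ji]; apply: Hmono La => //; rewrite ltnS ltnW.
  have := kL h (qpi _ (to_submod Fy)) Lh.
  by rewrite -linearZ_LR => /qpi_eq0.
have [F0 Fl _] := Ff.
(* Each layer is killed by L and L = LL, so LM = L(LM) descends one step at a time through the
   series down to 0. *)
have actF t : (t <= l)%N -> act L (submod_full M) `<=` F t.
  elim: t => [_ x _|t IHt tl x Lx].
    by rewrite -[F _ _]/((F 0%N : set _) _) F0.
  have := act_hfull (Hid (lev_lt i)) Lx; move: x {Lx}.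
  apply: act_sub_ind => h y Lh Ly; apply: Fk => //.
  exact: IHt (ltnW tl) _ Ly.
move=> x Kx; apply/qpi_eq0.
have : F l (qpi V x) by apply: actF => //; apply: act_map Kx.
by rewrite -[F _ _]/((F l : set _) _) Fl.
Qed.

Lemma Delta_mult i : composition_mult (Delta i) (S i) 1.
Proof.
have [l [F Fc]] := composition_exists (finlen_quot (K i) (Pfin i)).
have [[F0 Fl Fdec] Fs] := Fc; exists l, F; split=> //.
have F0' y : F 0 y by rewrite -[F _ _]/((F 0%N : set _) _) F0.
have l0 : (0 < l)%N.
  rewrite lt0n; apply/eqP => l0; have [x x0] := Delta_nonzero i; apply: x0.
  have : F l x by rewrite l0; apply: F0'.
  by rewrite -[F _ _]/((F l : set _) _) Fl.
have F1 : exists y, ~ F 1%N y.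
  have [y y0] := simple_neq0 (Fs 0%N l0); have [w wE] := qpi_onto y.
  exists (sval_lin (F 0%N) w) => F1w; apply: y0; rewrite -wE.
  by apply/qpi_eq0.
have Ft1 t : (t < l)%N -> (0 < t)%N -> F t `<=` F 1%N.
  elim: t => // -[|t] IHt tl _ //; move=> y /(Fdec _ (ltnW tl)).
  by apply: IHt => //; apply: ltnW.
have nk t : miso (layer F t) (S i) -> ~ kills (H (lev i)) (layer F t).
  by move=> LS kL; apply: (lev_act (i := i)); apply: kills_miso LS kL.
have top : miso (layer F 0) (S i).
  have [p [pO pmax]] := cover_max (Ssimple i) (Pcov i).
  have [g gP] := factor_inj (f := qpi (K i)) (@sval_lin_inj _ _ (F 0%N))
    (fun x => ex_intro _ (to_submod (F0' (qpi (K i) x))) erefl).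
  apply: (cover_simple_quot (g := qpi (submod_trace (F 0%N) (F 1%N)) \o g)
    (Ssimple i) (Pcov i) (Fs 0%N l0)).
  have [y Fy] := F1; have [x xE] := qpi_onto y; exists x => /qpi_eq0 Fx.
  by apply: Fy; rewrite -xE -gP.
apply/eqP/cards1P; exists (Ordinal l0); apply/setP => t; rewrite !inE.
apply/asboolP/eqP => [LS|->//]; apply: val_inj => /=.
have [Ftop _] := series_top Fc (ltn_ord t) (nk _ LS).
case: (posnP t) => // t0; have [y Fy] := F1; case: Fy.
exact: Ft1 (ltn_ord t) t0 _ (Ftop y).
Qed.

Lemma hfull_layer_level i t (M : lmodType R) (F : nat -> submod M) s : (t <= n)%N ->
  hfull (H t) (F s) -> miso (layer F s) (Delta i) -> (t <= lev i)%N.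
Proof.
move=> tn Ft /miso_map[f _ fO]; apply: Delta_level => //; apply: (hfull_onto fO).
by apply: (hfull_onto (@qpi_onto _ _ _)); apply/hfull_submodP.
Qed.

(** The multiplicity condition of the order speaks of every filtration of K(i), so fullness must be
    inherited by the terms of an arbitrary one, not only of the one constructed below. *)
Lemma filtration_hfull t (M : lmodType R) l (F : nat -> submod M) : (t <= n)%N ->
  delta_filtration Delta l F -> hfull (H t) (submod_full M) ->
  forall s, (s <= l)%N -> hfull (H t) (F s).
Proof.
move=> tn [[F0 _ Fdec] FD] HM; elim=> [_|s IHs sl].
  suff -> : F 0%N = submod_full M by [].
  by apply: submod_ext => x; rewrite -[F _ _]/((F 0%N : set _) _) F0.
have HF := IHs (ltnW sl); have [j LD] := FD s sl.
have tj := hfull_layer_level tn HF LD.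
have [f fI fO] := miso_map LD.
pose q := qpi (submod_trace (F s) (F s.+1)); pose be : {linear submod_type (F s) -> Delta j} := f \o q.
have beO : onto be.
  by move=> y; have [z <-] := fO y; have [w <-] := qpi_onto z; exists w.
have be0 w : be w = 0 <-> F s.+1 (sval_lin (F s) w).
  split=> [|Fw]; first by rewrite -(linear0 f) => /fI/qpi_eq0.
  by change (f (q w) = 0); rewrite (_ : q w = 0) ?linear0 //; apply/qpi_eq0.
have [la laE] := Pproj (qpi (K j)) beO.
pose lam : {linear P j -> M} := sval_lin (F s) \o la.
(* [lam] lifts P(j) onto the layer. If x lies in the next term, so does [lam p]; then p is in K(j),
   which is full for an ideal contained in H_t, and the correction is absorbed. *)
have dec x : act (H t) (F s) x -> exists p, act (H t) (F s.+1) (x - lam p).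
  move: x; apply: act_ind => [|u v [p Hp] [p' Hp']|h w Hh Fw].
  - by exists 0; rewrite linear0 subr0; apply: submod0.
  - by exists (p + p'); rewrite linearD opprD addrACA; apply: submodD.
  have [p pE] := qpi_onto (be (to_submod Fw)); exists (h *: p).
  rewrite linearZ_LR -scalerBr; apply: act_in => //.
  have : be (to_submod Fw - la p) = 0 by rewrite linearB laE pE subrr.
  by move=> /be0.
move=> x Fx; have [p Hp] := dec x (HF x (Fdec s sl x Fx)).
rewrite -(subrK (lam p) x); apply: submodD => //.
have Flp : F s.+1 (lam p).
  by rewrite -(subKr x (lam p)); apply: submodB => //; apply: act_sub Hp.
have Kp : K j p by apply/qpi_eq0; rewrite -laE; apply/be0.
have : act (H (lev j).+1) (F s.+1) (lam p).
  apply: (act_map (f := lam)) (act_hfull (Hid (lev_lt j)) Kp) => y Ky.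
  by apply/be0; rewrite laE; apply/qpi_eq0.
by apply: act_mono => //; apply: Hmono (leqW tj) (lev_lt j).
Qed.

(** A nonzero projective H_t-full module X maps onto some P(j), hence onto its standard module, with
    kernel K(j) plus ker h. Both summands are projective and H_t-full again, because the level of j
    is at least t, so the step repeats. *)
Lemma projective_filtered t (M : lmodType R) : (t <= n)%N -> finlen M ->
  dual_basis M -> hfull (H t) (submod_full M) -> delta_filtered Delta M.
Proof.
move=> tn Mf Mb HM.
pose good (V : submod M) := dual_basis (submod_type V) /\ hfull (H t) V.
have [||l [F [Ff FD]]] := filtration_exists (good := good)
  (Q := fun N => exists j, miso N (Delta j)) Mf.
- split=> //; apply: dual_basis_miso Mb; apply: (misoP (f := sval_lin _)).
    exact: sval_lin_inj.
  by move=> y; exists (@to_submod _ _ (submod_full M) y I).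
- move=> V [Vb HV] [x0 Vx0 x00]; pose X := submod_type V.
  have Xf : finlen X by apply: finlen_sub.
  have [_ Xp] := proj1 (dual_basisP X) Vb.
  have HX : hfull (H t) (submod_full X) by apply/hfull_submodP.
  have [|W _ sW] := simple_quot_exists Xf.
    by exists (to_submod Vx0) => /(congr1 (sval_lin V)); rewrite linear0.
  have [j [f fI fO]] : exists j, exists2 f : {linear quotmod W -> S j}, injective f & onto f.
    by case: Scomp => _ _ /(_ _ sW)[j /miso_map]; exists j.
  have gO : onto (f \o qpi W).
    by move=> y; have [z <-] := fO y; have [x <-] := qpi_onto z; exists x.
  have [h hO] := cover_lift (Pcov j) Xp gO.
  have [s hs] := split_onto (Pproj (i := j)) hO.
  have [k kE kK] := split_kernel hs.
  pose g : {linear X -> Delta j} := qpi (K j) \o h.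
  have gO' : onto g.
    by move=> y; have [z <-] := qpi_onto y; have [x <-] := hO z; exists x.
  have tj : (t <= lev j)%N by apply: Delta_level => //; apply: hfull_onto gO' HX.
  have gker x : ker g x <-> K j (h x) by apply: qpi_eq0.
  pose V' := submod_im (sval_lin V) (ker g).
  exists V'; split.
  + split.
      have KJb := dual_basis_act (Hdual (lev_lt j)) (Pdual j).
      have kerb : dual_basis (submod_type (ker h)).
        by apply: dual_basis_retract Vb; exists (sval_lin _), k.
      have gb : dual_basis (submod_type (ker g)).
        apply: dual_basis_retract (dual_basis_prod KJb kerb).
        have [a aE] := factor_inj (f := h \o sval_lin (ker g)) (@sval_lin_inj _ _ (K j))
          (fun y => ex_intro _ (to_submod (proj1 (gker _) (sval_linP y))) erefl).
        pose r := pair_map (s \o sval_lin (K j)) (sval_lin (ker h)) : {linear _ -> X}.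
        have rk y : ker g (r y).
          apply/gker; change (K j (h (s (sval_lin (K j) y.1) + sval_lin (ker h) y.2))).
          rewrite linearD hs (sval_linP y.2 : h _ = 0) addr0; exact: sval_linP.
        have [b bE] := factor_inj (f := r) (@sval_lin_inj _ _ (ker g))
          (fun y => ex_intro _ (to_submod (rk y)) erefl).
        exists ((@pair_in1 _ _ _ \o a) \+ (@pair_in2 _ _ _ \o (k \o sval_lin (ker g)))), b => y.
        apply: sval_lin_inj; rewrite bE /r /= /pair_map /= addr0 add0r.
        change (s (sval_lin (K j) (a y)) + sval_lin (ker h) (k (sval_lin (ker g) y)) =
          sval_lin (ker g) y).
        by rewrite aE kE addrC subrK.
      apply: dual_basis_miso gb; apply: miso_sym.
      have [c cE] := factor_inj (f := sval_lin V \o sval_lin (ker g)) (@sval_lin_inj _ _ V')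
        (fun y => ex_intro _ (to_submod (ex_intro2 _ _ (sval_lin (ker g) y) (sval_linP y) erefl
           : V' (sval_lin V (sval_lin (ker g) y)))) erefl).
      apply: (misoP (f := c)) => [u v uv|y].
        by do 2 apply: sval_lin_inj; rewrite -[LHS]cE -[RHS]cE uv.
      have [w gw wE] := sval_linP y; exists (to_submod gw).
      by apply: sval_lin_inj; rewrite cE -wE.
    apply: hfull_map => y /gker Kh.
    rewrite -(subrK (s (h y)) y); apply: submodD.
      rewrite -kE; apply: (act_map (f := sval_lin (ker h) \o k)) (HX y I) => u _.
      apply/gker; change (K j (h (sval_lin (ker h) (k u)))).
      by rewrite (sval_linP (k u) : h _ = 0); apply: submod0.
    have := act_hfull (Hid (lev_lt j)) Kh => /(act_map (f := s) (W := ker g)) H1.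
    apply: act_mono (H1 _) => //; first exact: Hmono (leqW tj) (lev_lt j).
    by move=> u Ku; apply/gker; rewrite hs.
  + by move=> _ [y _ <-]; apply: sval_linP.
  + move=> VV'; have [y y0] := Delta_nonzero j; have [x xE] := gO' y; apply: y0.
    have [w gw /sval_lin_inj wE] := VV' _ (sval_linP x).
    by rewrite -xE -wE.
  + exists j; apply: (subquot_iso gO') => x; split=> [gx|]; first by exists x.
    by move=> [w gw /sval_lin_inj <-].
by exists l, F.
Qed.

Lemma weak_chain_strongly_qh_order : strongly_qh_order S P level_le.
Proof.
exists K; split=> [i|]; first exact: K_standard.
move=> D i; have HK : hfull (H (lev i).+1) (submod_full (submod_type (K i))).
  by apply/hfull_submodP; apply: act_hfull; apply: Hid.
have Kb : dual_basis (submod_type (K i)) by apply: dual_basis_act => //; apply: Hdual.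
split.
- exact: Delta_mult.
- exact: projective_filtered (lev_lt i) (finlen_sub _ (Pfin i)) Kb HK.
- move=> j m [l [F [FD <-]]] m0.
  have /card_gt0P[t] : (0 < #|[set t : 'I_l | `[< miso (layer F t) (Delta j) >]]%SET|)%N.
    by rewrite lt0n; apply/eqP.
  rewrite inE => /asboolP LD.
  have HF := filtration_hfull (lev_lt i) FD HK (ltnW (ltn_ord t)).
  have ij := hfull_layer_level (lev_lt i) HF LD.
  by split; [right | move=> E; move: ij; rewrite E ltnn].
- by case/dual_basisP: Kb.
Qed.

End ChainToStronglyQuasiHereditary.

Lemma module_strongly_qhP (R : pzRingType) : finlen R^o ->
  module_strongly_qh R <->
  exists n (H : nat -> ideal R), weak_chain n H /\ forall i, (i <= n)%N -> dualL (H i).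
Proof.
move=> Rf; split=> [[I [S [P [Scomp [Pcov [le [lePO [K [Kst KP]]]]]]]]]|[n [H [Hc Hdual]]]].
  apply: (strongly_qh_weak_chain Rf Scomp Pcov lePO Kst) => i; by case: (KP i).
have [I [S Scomp]] := complete_simples_exist R; have [Ssimple _ _] := Scomp.
pose P i := sval (cid (projective_cover_exists Rf (Ssimple i))).
have Pcov i : projective_cover (P i) (S i).
  exact: (svalP (cid (projective_cover_exists Rf (Ssimple i)))).
exists I, S, P; split=> //; split=> //.
exists (level_le Hc Scomp); split; first exact: level_le_order.
exact: weak_chain_strongly_qh_order.
Qed.

(** * The equivalences *)

Lemma weak_chain_op (R : pzRingType) n (H : nat -> ideal R) :
  weak_chain n (fun i => ideal_op (H i)) <-> weak_chain n H.
Proof.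
split=> -[H0 Hn Hdec Hid Hrad]; split=> // i lin.
- by apply/idem_ideal_op; apply: Hid.
- by apply/radcond_op; apply: Hrad.
- by apply/idem_ideal_op; apply: Hid.
- by apply/radcond_op; apply: Hrad.
Qed.

Lemma ideal_unopK (R : pzRingType) (H : ideal R^c) : ideal_op (ideal_unop H) = H.
Proof. exact: ideal_ext. Qed.

Lemma exists_chain_op (R : pzRingType) (Q : ideal R -> Prop) (Q' : ideal R^c -> Prop) :
  (forall H, Q' (ideal_op H) <-> Q H) ->
  (exists n H, weak_chain n H /\ forall i, (i <= n)%N -> Q' (H i)) <->
  exists n H, weak_chain n H /\ forall i, (i <= n)%N -> Q (H i).
Proof.
move=> QQ'; split=> -[n [H [Hc HQ]]].
  exists n, (fun i => ideal_unop (H i)); split.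
    apply/weak_chain_op; have -> // : (fun i => ideal_op (ideal_unop (H i))) = H.
    by apply/funext => i; apply: ideal_unopK.
  by move=> i lin; apply/QQ'; rewrite ideal_unopK; apply: HQ.
exists n, (fun i => ideal_op (H i)); split; first exact/weak_chain_op.
by move=> i lin; apply/QQ'; apply: HQ.
Qed.

(** Repeated ideals are deleted one at a time; the conditions on neighbours survive because the
    omitted term equals the one before it. *)
Lemma weak_chain_strict (R : pzRingType) (Q : ideal R -> Prop) n (H : nat -> ideal R) :
  weak_chain n H -> (forall i, (i <= n)%N -> Q (H i)) ->
  exists n' (H' : nat -> ideal R), [/\ weak_chain n' H',
    forall i, (i <= n')%N -> Q (H' i) & forall i, (i < n')%N -> ~ H' i `<=` H' i.+1].
Proof.
elim: n H => [|n IHn] H Hc HQ; first by exists 0%N, H.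
have [Hs|] := pselect (forall i, (i < n.+1)%N -> ~ H i `<=` H i.+1); first by exists n.+1, H.
move=> /existsNP[i /not_implyP[lin /contrapT Hi]].
have [H0 Hn Hdec Hid Hrad] := Hc.
have E : H i = H i.+1 by apply: ideal_ext => x; split=> [/Hi|/(Hdec i lin)].
(* Skips index i+1. The new last term is H n when i = n and H n.+1 otherwise; in the first case the
   two coincide. *)
apply: (IHn (fun j => if (j <= i)%N then H j else H j.+1)) => [|j jn]; last first.
  by case: ifP => _; apply: HQ => //; apply: leqW.
split=> //=.
- move=> x; case: ifP => [ni|_]; last exact: Hn.
  have {ni} ni : i = n by apply/eqP; rewrite eqn_leq -ltnS lin ni.
  by rewrite -ni E ni; apply: Hn.
- move=> j jn; case: (ltnP j i) => ji; first by rewrite ltnW //; apply: Hdec; apply: leqW.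
  case: ifP => [ji'|_]; last exact: Hdec.
  have -> : j = i by apply/eqP; rewrite eqn_leq ji ji'.
  by rewrite E; apply: Hdec; rewrite ltnS; apply: leq_ltn_trans jn.
- by move=> j jn; case: ifP => _; apply: Hid => //; apply: leqW.
move=> j jn; case: (ltnP j i) => ji; first by rewrite ltnW //; apply: Hrad; apply: leqW.
case: ifP => [ji'|_]; last exact: Hrad.
have -> : j = i by apply/eqP; rewrite eqn_leq ji ji'.
by rewrite E; apply: Hrad; rewrite ltnS; apply: leq_ltn_trans jn.
Qed.

Lemma finlen_op_op (A : pzRingType) : finlen A^o -> finlen ((A^c)^c)^o.
Proof.
move=> [n [r rP rn]].
pose f (V : submod ((A^c)^c)^o) : submod A^o :=
  @Submod A A^o (V : A -> Prop) (submod0 V) (@submodP _ _ V).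
exists (r (f (submod_full _))); exists (r \o f) => // V W VW WV.
exact: rP.
Qed.

Lemma dualR_projective (A : pzRingType) (H : ideal A) :
  dualR H -> projective (submod_type (ideal_right H)).
Proof. by rewrite -dualL_op ideal_right_op => /dualLP/dual_basisP[]. Qed.

(** The coordinates descend to A/K: as K = KK, they map K into K. This supplies the projectivity
    over the quotient ring that a heredity chain asks for. *)
Lemma dualR_mod (A : pzRingType) (H K : ideal A) : K `<=` H -> idem_ideal K ->
  dualR H -> dualR (ideal_mod H K).
Proof.
move=> KH Kid [m [h [phi [Hh phiD phiM hphi]]]].
have phi0 j : phi j 0 = 0 by rewrite -[0 in LHS](mulr0 0) phiM ?mulr0 //; apply: ideal0.
have phiK j x : K x -> K (phi j x).
  move=> /Kid; suff HQ : forall y, act K (ideal_left K) y -> K y /\ K (phi j y) by move=> /HQ[].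
  apply: act_ind => [|u v [Ku Ku'] [Kv Kv']|a y Ka Ky].
  - by rewrite phi0; split; apply: ideal0.
  - by split; [apply: idealD | rewrite phiD //; [apply: idealD|apply: KH|apply: KH]].
  - by split; [apply: idealMl | rewrite phiM; [apply: idealMl|apply: KH]].
have ex (xi : quotring K) : exists x, ideal_mod H K xi -> H x /\ quotring_pi K x = xi.
  have [[x Hx xE]|nH] := pselect (ideal_mod H K xi); first by exists x.
  by exists 0 => /nH.
have [r rP] := choice ex; pose psi j xi := quotring_pi K (phi j (r xi)).
have psiE j x : H x -> psi j (quotring_pi K x) = quotring_pi K (phi j x).
  move=> Hx; have [|Hr /quotring_piP Kr] := rP (quotring_pi K x); first by exists x.
  apply/quotring_piP; suff -> : phi j (r (quotring_pi K x)) =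
      phi j (r (quotring_pi K x) - x) + phi j x by rewrite addrK; apply: phiK.
  by rewrite -phiD ?subrK //; apply: KH.
exists m, (fun j => quotring_pi K (h j)), psi; split.
- by move=> j; exists (h j).
- move=> j _ _ [x Hx <-] [y Hy <-].
  by rewrite -quotring_piD !psiE ?phiD ?quotring_piD //; apply: idealD.
- move=> j a _ [x Hx <-]; rewrite -[a]quotring_reprK quotring_piE.
  by rewrite !psiE ?phiM -?quotring_piE //; apply: idealMr.
- move=> _ [x Hx <-]; rewrite [in LHS](hphi x Hx).
  rewrite (big_morph (quotring_pi K) (@quotring_piD A K) (quotring_pi0 K)).
  by apply: eq_bigr => j _; rewrite psiE // quotring_piE.
Qed.

Lemma idem_ideal_mod (A : pzRingType) (H K : ideal A) :
  idem_ideal H -> idem_ideal (ideal_mod H K).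
Proof.
move=> Hid _ [x Hx <-].
apply: (addspan_map (f := quotring_pi K)) (Hid x Hx).
- exact: quotring_pi0.
- exact: quotring_piD.
move=> _ [h [y [Hh Hy ->]]]; apply: addspan_gen.
exists (quotring_pi K h), (quotring_pi K y).
by split; [exists h|exists y|rewrite -[RHS]/(_ * _) quotring_piE].
Qed.

Lemma idempotent_chainP (A : pzRingType) n (H : nat -> ideal A) :
  idempotent_chain n H <->
  [/\ forall x, H 0 x, forall x, H n x -> x = 0,
      forall i, (i < n)%N -> H i.+1 `<=` H i,
      forall i, (i <= n)%N -> idem_ideal (H i) &
      forall i, (i < n)%N -> ~ H i `<=` H i.+1].
Proof.
split=> [[H0 Hn Hid Hdec]|[H0 Hn Hdec Hid Hs]]; split.
- by move=> x; rewrite -[H _ _]/((H 0%N : set A) _) H0.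
- by move=> x; rewrite -[H _ _]/((H n : set A) _) Hn.
- by move=> i /Hdec[].
- by move=> i /Hid ?; apply/idem_idealP.
- by move=> i /Hdec[].
- by apply/seteqP; split.
- by apply/seteqP; split=> [x /Hn //|x ->]; apply: ideal0.
- by move=> i /Hid/idem_idealP.
- by move=> i lin; split; [apply: Hdec | apply: Hs].
Qed.

Lemma strongly_qhP (A : pzRingType) : finlen A^o -> finlen (A^c)^o ->
  strongly_qh A <->
  exists n (H : nat -> ideal A), weak_chain n H /\
    forall i, (i <= n)%N -> dualR (H i) /\ dualL (H i).
Proof.
move=> Alf Arf; split=> [[n [H [[/idempotent_chainP[H0 Hn Hdec Hid _] _] [_ HR] [_ HL]]]]|].
  exists n, H; split.
    by split=> // i /HR[_ /layer_radical_zeroP].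
  move=> i; rewrite leq_eqVlt => /orP[/eqP ->|lin].
    by split; [apply: dualR_zero | apply: dualL_zero].
  have [/(projective_rightP _ Arf) ? _] := HR i lin.
  by have [/(projective_leftP _ Alf) ? _] := HL i lin.
move=> [m [H' [H'c H'd]]].
have [n [H [[H0 Hn Hdec Hid Hrad] Hd Hs]]] :=
  weak_chain_strict (Q := fun L => dualR L /\ dualL L) H'c H'd.
have Hc : idempotent_chain n H by apply/idempotent_chainP.
exists n, H; split; split=> // i lin; have [dR dL] := Hd i (ltnW lin).
- split; last exact/layer_radical_zeroP/Hrad.
    by apply/idem_idealP; apply: idem_ideal_mod; apply: Hid; apply: ltnW.
  by apply/dualR_projective/dualR_mod => //; [apply: Hdec | apply: Hid].
- by split; [apply/projective_rightP | apply/layer_radical_zeroP; apply: Hrad].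
- by split; [apply/projective_leftP | apply/layer_radical_zeroP; apply: Hrad].
Qed.

Lemma right_strongly_heredityP (A : pzRingType) n (H : nat -> ideal A) :
  finlen (A^c)^o -> idempotent_chain n H ->
  right_strongly_heredity_chain n H <->
  forall i, (i < n)%N -> dualR (H i.+1) /\ radcond (H i) (H i.+1).
Proof.
move=> Af Hc; have [H0 Hn _ _ _] := proj1 (idempotent_chainP n H) Hc.
split=> [[_ HP] i lin|HP].
  have [_ /layer_radical_zeroP rH] := HP i lin; split=> //.
  move: (lin); rewrite leq_eqVlt => /orP[/eqP ->|lin']; first exact: dualR_zero.
  by have [/(projective_rightP _ Af)] := HP i.+1 lin'.
split=> // i lin; have [_ rH] := HP i lin; split; last exact/layer_radical_zeroP.
apply/projective_rightP => //; case: i lin {rH} => [|i] lin; first exact: dualR_full.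
by have [] := HP i (ltnW lin).
Qed.

Lemma left_strongly_heredityP (A : pzRingType) n (H : nat -> ideal A) :
  finlen A^o -> idempotent_chain n H ->
  left_strongly_heredity_chain n H <->
  forall i, (i < n)%N -> dualL (H i.+1) /\ radcond (H i) (H i.+1).
Proof.
move=> Af Hc; have [H0 Hn _ _ _] := proj1 (idempotent_chainP n H) Hc.
split=> [[_ HP] i lin|HP].
  have [_ /layer_radical_zeroP rH] := HP i lin; split=> //.
  move: (lin); rewrite leq_eqVlt => /orP[/eqP ->|lin']; first exact: dualL_zero.
  by have [/(projective_leftP _ Af)] := HP i.+1 lin'.
split=> // i lin; have [_ rH] := HP i lin; split; last exact/layer_radical_zeroP.
apply/projective_leftP => //; case: i lin {rH} => [|i] lin; first exact: dualL_full.
by have [] := HP i (ltnW lin).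
Qed.

(** Covers the last index, where e_n = 0 and H_n = 0, so that the link between H_i and add e_i A
    holds up to i = n. *)
Lemma setmul_zero (A : pzRingType) :
  setmul (setmul setT (set1 (0 : A))) setT = [set 0].
Proof.
apply/seteqP; split=> [x|x ->]; last by apply/setmulP; apply: addspan0.
move=> /setmulP/(_ (fun x => x = 0)); apply=> // [u v -> ->|]; first by rewrite addr0.
move=> _ [u [y [/setmulP + _ ->]]] => /(_ (fun u => u * y = 0)); apply.
- exact: mul0r.
- by move=> s t us ut; rewrite mulrDl us ut addr0.
- by move=> _ [a [_ [_ -> ->]]]; rewrite mulr0 mul0r.
Qed.

Theorem theorem3p22 (A : pzRingType) (hA : artin_algebra A) :
  (forall (n : nat) (H : nat -> ideal A) (e : nat -> A),
     idempotent_chain n H ->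
     (forall i : nat, (i < n)%N ->
        e i * e i = e i /\
        (H i : set A) = setmul (setmul setT (set1 (e i))) setT) ->
     e n = 0 ->
     (right_strongly_heredity_chain n H <->
        @total_right_rejective_chain (right_proj A) n
          (fun i => add_subcat (emod (e i)))) /\
     (left_strongly_heredity_chain n H <->
        @total_left_rejective_chain (right_proj A) n
          (fun i => add_subcat (emod (e i))))) /\
  (strongly_qh A <->
     exists (n : nat) (D : nat -> subcat (right_proj A)),
       rejective_chain n D) /\
  (right_strongly_qh A <->
     exists (n : nat) (D : nat -> subcat (right_proj A)),
       total_right_rejective_chain n D) /\
  (left_strongly_qh A <->
     exists (n : nat) (D : nat -> subcat (right_proj A)),
       total_left_rejective_chain n D).
Proof.
have [Alf Arf] := finlen_artin hA; split; [|split; [|split]].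
- move=> n H e Hc He en.
  have [H0 Hn Hdec _ _] := proj1 (idempotent_chainP n H) Hc.
  have HD i : (i <= n)%N -> link (ideal_op (H i)) (add_subcat (emod (e i))).
    rewrite leq_eqVlt => /orP[/eqP ->|/He[ee HE]]; last exact: link_emod.
    apply: link_emod; rewrite en ?mulr0 // setmul_zero.
    by case: Hc.
  rewrite right_strongly_heredityP // left_strongly_heredityP //; split.
    rewrite (linked_total_right HD) //; split=> HP i /HP[dH rH];
      by split=> //; apply/radcond_op.
  rewrite (linked_total_left HD) //; split=> HP i /HP[dH rH];
    by split=> //; apply/radcond_op.
- rewrite strongly_qhP // exists_rejective; apply: iff_sym.
  (* Over [A^c] the two kinds of dual basis change places, hence the swapped conjunction. *)
  exact: (exists_chain_op (Q := fun L => dualR L /\ dualL L)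
    (Q' := fun L => dualL L /\ dualR L)).
- by rewrite /right_strongly_qh module_strongly_qhP // exists_total_right.
(* The modules here are over [(A^c)^c], while the subcategories are over [A^c]; moving chains
   between these opposite rings turns [dualL] into the [dualR] of left rejectivity. *)
- rewrite /left_strongly_qh /right_strongly_qh module_strongly_qhP; last exact: finlen_op_op.
  by rewrite exists_total_left; apply: (exists_chain_op (Q := @dualR _) (Q' := @dualL _)).
Qed.
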